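(* Let $d\geq 2$, $p\geq 1$, $q\geq 1$, $\tau\geq 1$, $0<a\leq 1$, $\alpha,\beta,\gamma\in\mathbb{R}$, and $\mu>1$. Assume that $\tau\leq\mu$. Define $\sigma\in\mathbb{R}$ by $\gamma=a\sigma+(1-a)\beta$. Assume $$\frac{1}{\tau}+\frac{\gamma}{d}=a\left(\frac{1}{p}+\frac{\alpha-1}{d}\right)+(1-a)\left(\frac{1}{q}+\frac{\beta}{d}\right)$$ and $$-(d-1)\leq\alpha-\sigma<0.$$ There exists a positive constant $C$ such that for all radial $u\in L^1_{loc}(\mathbb{R}^d\setminus\{0\})$ and for all $0<R_1<R_2$: (i) if $\frac{1}{\tau}+\frac{\gamma}{d}=0$ and $\mathrm{supp}\,u\subset B_{R_2}$, then $$\left(\int_{\mathbb{R}^d}\frac{|x|^{\gamma\tau}}{\ln^{\mu}(2R_2/|x|)}|u|^\tau\,dx\right)^{\frac{1}{\tau}}\leq C\left\||x|^\alpha\nabla u\right\|^a_{L^p(\mathbb{R}^d\setminus\{0\})}\left\||x|^\beta u\right\|^{1-a}_{L^q(\mathbb{R}^d)};$$ (ii) if $\frac{1}{\tau}+\frac{\gamma}{d}=0$ and $\mathrm{supp}\,u\cap B_{R_1}=\emptyset$, then $$\left(\int_{\mathbb{R}^d}\frac{|x|^{\gamma\tau}}{\ln^{\mu}(2|x|/R_1)}|u|^\tau\,dx\right)^{\frac{1}{\tau}}\leq C\left\||x|^\alpha\nabla u\right\|^a_{L^p(\mathbb{R}^d\setminus\{0\})}\left\||x|^\beta u\right\|^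{1-a}_{L^q(\mathbb{R}^d)}.$$
   Context: $B_R$ denotes the open ball in $\mathbb{R}^d$ centered at the origin with radius $R$. $\nabla u$ is the distributional gradient of $u$ on $\mathbb{R}^d\setminus\{0\}$; the quantity $\||x|^\alpha\nabla u\|_{L^p(\mathbb{R}^d\setminus\{0\})}$ is considered to be $+\infty$ if $\nabla u\notin[L^p_{loc}(\mathbb{R}^d\setminus\{0\})]^d$. The quantities in the inequalities may be infinite; the conventions are $+\infty\cdot 0=0\cdot(+\infty)=0$, $(+\infty)^0=1$ (this corresponds to the case $a=1$), and $+\infty\leq+\infty$. The integrands on the left-hand sides are understood to be $0$ where $u=0$. *)

(* Defs.v *)
From HB Require Import structures.
From mathcomp Require Import all_boot all_order all_algebra.
From mathcomp Require Import all_classical all_reals all_analysis.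
From mathcomp Require Import measurable_realfun.
Set Implicit Arguments.
Unset Strict Implicit.
Unset Printing Implicit Defensive.
Import Order.TTheory GRing.Theory Num.Theory.
Import numFieldNormedType.Exports.
Local Open Scope classical_set_scope.
Local Open Scope ring_scope.

Section borel_rV.
Context {R : realType} {n : nat}.

HB.instance Definition _ := @isMeasurable.Build
  (sigma_display (@open 'rV[R]_n)) 'rV[R]_n <<s @open 'rV[R]_n >>
  (@sigma_algebra0 _ setT _) (@sigma_algebraC _ _)
  (@sigma_algebra_bigcup _ setT _).

Lemma open_measurable_rV (U : set 'rV[R]_n) : open U -> measurable U.
Proof. exact: sub_sigma_algebra. Qed.

Lemma measurable_coord_rV (i : 'I_n) :
  measurable_fun [set: 'rV[R]_n] (fun x => x ord0 i).
Proof.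
apply: (@measurability _ _ _ _ _ _ (@RGenOpens.G R)).
  exact: RGenOpens.measurableE.
move=> _ [_ [a [b ->]] <-]; rewrite setTI; apply: open_measurable_rV.
by apply: open_comp => [x _|]; [exact: coord_continuous|exact: interval_open].
Qed.

Lemma measurable_box_rV (A : 'I_n -> set R) : (forall i, measurable (A i)) ->
  measurable [set x : 'rV[R]_n | forall i, A i (x ord0 i)].
Proof.
move=> mA; have -> : [set x : 'rV[R]_n | forall i, A i (x ord0 i)] =
    \bigcap_(i in [set: 'I_n]) ((fun x => x ord0 i) @^-1` A i).
  by apply/seteqP; split=> [x h i _|x h i]; [exact: h|exact: (h i)].
rewrite -[X in measurable X]setCK setC_bigcap; apply: measurableC.
apply: countable_bigcupT_measurable => // i; apply: measurableC.
by rewrite -[X in measurable X]setTI; exact: measurable_coord_rV.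
Qed.

End borel_rV.

Section cons_rV.
Context {R : realType} {n : nat}.

Definition cons_rV (xv : R * 'rV[R]_n) : 'rV[R]_n.+1 :=
  \row_i oapp (fun j => xv.2 ord0 j) xv.1 (unlift ord0 i).

Lemma cons_rV0 xv : cons_rV xv ord0 ord0 = xv.1.
Proof. by rewrite mxE unlift_none. Qed.

Lemma cons_rVS xv j : cons_rV xv ord0 (lift ord0 j) = xv.2 ord0 j.
Proof. by rewrite mxE liftK. Qed.

Let qrV m (c : 'rV[rat]_m) : 'rV[R]_m := map_mx ratr c.

Let qtail m (c : 'rV[rat]_m.+1) : 'rV[rat]_m := \row_j c ord0 (lift ord0 j).

Let ball_cons (c : 'rV[rat]_n.+1) (e : R) : 0 < e ->
  cons_rV @^-1` ball (qrV c) e =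
  ball (ratr (c ord0 ord0) : R) e `*` ball (qrV (qtail c)) e.
Proof.
move=> e0; apply/seteqP; split=> -[x v] /=.
  move=> -[_ h]; split.
    by have := h ord0 ord0; rewrite cons_rV0 !mxE.
  split => // i j; rewrite (ord1 i).
  by have := h ord0 (lift ord0 j); rewrite cons_rVS !mxE.
move=> [hx [_ hv]]; split => // i j; rewrite (ord1 i).
case: (unliftP ord0 j) => [k ->|->].
  by rewrite cons_rVS; have := hv ord0 k; rewrite !mxE.
by rewrite cons_rV0 mxE.
Qed.

Let ball_dense m (x : 'rV[R]_m) (e : R) : 0 < e ->
  exists c : 'rV[rat]_m, ball (qrV c) e x.
Proof.
move=> e0.
have h i : exists q : rat, ball (x ord0 i) e (ratr q : R).
  have : x ord0 i < x ord0 i + e by rewrite ltrDl.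
  move=> /rat_in_itvoo[q]; rewrite in_itv/= => /andP[q1 q2].
  exists q; rewrite /ball/= ltr0_norm ?subr_lt0// opprB ltrBlDl.
  by rewrite addrC in q2 *.
exists (\row_i projT1 (cid (h i))); split => // i j.
rewrite (ord1 i) !mxE; case: cid => q /= hq; exact: ball_sym.
Qed.

Lemma measurable_cons_rV : measurable_fun [set: R * 'rV[R]_n] cons_rV.
Proof.
apply: (@measurability _ _ _ _ _ _ (@open 'rV[R]_n.+1)) => //.
move=> _ [U oU <-]; rewrite setTI.
pose D := [set ck : 'rV[rat]_n.+1 * nat | ball (qrV ck.1) ck.2.+1%:R^-1 `<=` U].
have -> : cons_rV @^-1` U = \bigcup_(ck in D)
    (cons_rV @^-1` ball (qrV ck.1) ck.2.+1%:R^-1).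
  apply/seteqP; split=> [xv /= Uxv|xv [ck Dck /=]]; last exact: Dck.
  have /nbhs_ballP[e /= e0 eU] : nbhs (cons_rV xv) U by exact: open_nbhs_nbhs.
  have e20 : 0 < e / 2 by rewrite divr_gt0.
  have [k _ hk] := near_infty_natSinv_lt (PosNum e20).
  have k0 : 0 < k.+1%:R^-1 :> R by rewrite invr_gt0.
  have {}hk : k.+1%:R^-1 < e / 2 by exact: (hk k (leqnn k)).
  have [c hc] := ball_dense (cons_rV xv) k0.
  exists (c, k) => //=; rewrite /D/= => y hy; apply: eU.
  rewrite [e]splitr; apply: (@ball_triangle _ _ (qrV c)).
    by apply: ball_sym; apply: le_ball hc; exact: ltW.
  by apply: le_ball hy; exact: ltW.
rewrite bigcup_mkcond; apply: countable_bigcupT_measurable => // ck.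
case: ifP => // _; rewrite ball_cons ?invr_gt0//; apply: measurableX.
  by apply: open_measurable; exact: ball_open.
by apply: open_measurable_rV; exact: ball_open.
Qed.

End cons_rV.

Section lebesgue_measure_rV.
Context {R : realType}.

(* Lebesgue measure on R^n as the n-fold product of the one on R, restricted to
   Borel sets; lebesgue_rV_box shows that it gives boxes their volume. *)
Section step.
Context {n : nat} (m : {measure set 'rV[R]_n -> \bar R}).

Definition lebesgue_rV_step : set 'rV[R]_n.+1 -> \bar R :=
  pushforward (@lebesgue_measure R \x^ m)%E cons_rV.

Let step0 : lebesgue_rV_step set0 = 0%E.
Proof. by rewrite /lebesgue_rV_step /pushforward preimage_set0 measure0. Qed.

Let step_ge0 A : (0 <= lebesgue_rV_step A)%E.
Proof. by rewrite /lebesgue_rV_step /pushforward; exact: measure_ge0. Qed.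

Let step_sigma_additive : semi_sigma_additive lebesgue_rV_step.
Proof.
have mf A : measurable A -> measurable (@cons_rV R n @^-1` A).
  by rewrite -[X in _ -> measurable X]setTI; exact: measurable_cons_rV.
move=> F mF tF mUF; rewrite /lebesgue_rV_step /pushforward preimage_bigcup.
apply: measure_semi_sigma_additive => [k||]; first exact: mf.
- apply/trivIsetP => /= i j _ _ ij; rewrite -preimage_setI.
  by move/trivIsetP : tF => /(_ _ _ _ _ ij) ->//; rewrite preimage_set0.
- by rewrite -preimage_bigcup; exact: mf.
Qed.

HB.instance Definition _ := isMeasure.Build _ _ _ lebesgue_rV_step
  step0 step_ge0 step_sigma_additive.

End step.

Fixpoint lebesgue_rV n : {measure set 'rV[R]_n -> \bar R} :=
  match n with
  | 0 => dirac (0 : 'rV[R]_0)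
  | n'.+1 => lebesgue_rV_step (lebesgue_rV n')
  end.

Lemma lebesgue_rV_box n (A : 'I_n -> set R) :
  (forall i, measurable (A i)) ->
  lebesgue_rV n [set x | forall i, A i (x ord0 i)] =
  (\prod_(i < n) lebesgue_measure (A i))%E.
Proof.
elim: n A => [|n IHn] A mA.
  rewrite big_ord0 /= diracE mem_set//= => -[].
  by [].
rewrite big_ord_recl/= -IHn// /lebesgue_rV_step /pushforward.
rewrite -product_measure2E//.
  congr (_ _); apply/seteqP; split=> -[x v] /=.
    by move=> h; split=> [|i]; [have := h ord0|have := h (lift ord0 i)];
      rewrite ?cons_rV0 ?cons_rVS.
  move=> [hx hv] i; case: (unliftP ord0 i) => [j|] ->.
    by rewrite cons_rVS; exact: hv.
  by rewrite cons_rV0.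
- exact: mA.
- exact: (measurable_box_rV (fun i : 'I_n => mA (lift ord0 i))).
Qed.

End lebesgue_measure_rV.

Section function_spaces.
Context {R : realType} {d : nat}.
Notation mu := (@lebesgue_rV R d).
Implicit Types (Omega : set 'rV[R]_d) (u f phi : 'rV[R]_d -> R).

(* The library norm on 'rV[R]_d is the sup norm; it is used only for the
   topology and for derivatives. *)
Definition enorm (x : 'rV[R]_d) : R := Num.sqrt (\sum_i x ord0 i ^+ 2).

Definition eball (r : R) : set 'rV[R]_d := [set x | enorm x < r].

Definition punctured : set 'rV[R]_d := [set x | x != 0].

(* Elements of Lp_loc are represented by Borel functions; every a.e.-class of
   Lebesgue measurable functions contains one. *)
Definition Lp_loc Omega (p : R) f : Prop :=
  measurable_fun Omega f /\
  forall K, compact K -> K `<=` Omega ->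
    (\int[mu]_(x in K) (`|f x| `^ p)%:E < +oo)%E.

Definition radial u : Prop :=
  exists w : R -> R, {ae mu, forall x, u x = w (enorm x)}.

(* Complement of the largest open set on which u vanishes a.e. *)
Definition ess_supp u : set 'rV[R]_d :=
  [set x | forall V, nbhs x V -> ~ {ae mu, forall y, V y -> u y = 0}].

Definition partial (i : 'I_d) f : 'rV[R]_d -> R :=
  fun x => 'D_(delta_mx ord0 i) f x.

Definition smooth f : Prop :=
  forall s : seq 'I_d,
    continuous (foldr partial f s) /\
    forall i x, derivable (foldr partial f s) x (delta_mx ord0 i).

Definition test_function Omega phi : Prop :=
  smooth phi /\
  exists K, [/\ compact K, K `<=` Omega & forall x, ~ K x -> phi x = 0].

Definition distr_gradient Omega u (g : 'rV[R]_d -> 'rV[R]_d) : Prop :=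
  forall i : 'I_d,
    Lp_loc Omega 1 (fun x => g x ord0 i) /\
    forall phi, test_function Omega phi ->
      (\int[mu]_(x in Omega) (u x * partial i phi x)%:E =
       - \int[mu]_(x in Omega) (g x ord0 i * phi x)%:E)%E.

Definition Lp_loc_gradient Omega (p : R) u (g : 'rV[R]_d -> 'rV[R]_d) : Prop :=
  distr_gradient Omega u g /\ forall i, Lp_loc Omega p (fun x => g x ord0 i).

Definition weighted_norm (beta q : R) u : \bar R :=
  'N[mu]_q%:E[(fun x => (enorm x `^ beta * u x)%:E)]%E.

(* The gradient is unique up to a null set, so the choice of g does not affect
   the value. *)
Definition weighted_gradient_norm (alpha p : R) u : \bar R :=
  match pselect (exists g, Lp_loc_gradient punctured p u g) with
  | left ex_g =>
      'N[mu]_p%:E[(fun x => (enorm x `^ alpha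
                             * enorm (projT1 (cid ex_g) x))%:E)
                  \_ punctured]%E
  | right _ => +oo%E
  end.

Definition log_weighted_integral (l : 'rV[R]_d -> R) (gamma tau m : R) u
    : \bar R :=
  (\int[mu]_x (if u x == 0 then 0 else
     enorm x `^ (gamma * tau) / (ln (l x)) `^ m * `|u x| `^ tau)%:E)%E.

End function_spaces.

(* Main.v *)
(** Put s = |x|^n.  In this variable Lebesgue measure of R^n becomes a multiple of
   Lebesgue measure of (0, oo), and a radial u is a.e. v(|x|^n) for a Borel v.
   Testing the distributional gradient against the fields x |x|^-n psi(|x|^n), whose
   divergence is n psi'(|x|^n), bounds |v s1 - v s2| by the integral of
   |grad u| |x|^(1-n) over the shell between s1 and s2.  By Hoelder's inequality v is
   then (1 - 1/p)-Hoelder continuous on each dyadic interval A_k, which yields a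
   Gagliardo-Nirenberg inequality on A_k around a point value c_k of v, with an
   L^q-controlled height.  In the critical case all powers of s_k cancel, so that
   with X_k and Y_k the parts of the two energies carried by A_k one has
   |c_k - c_(k+1)| <= C (X_k + X_(k+1))^(a/p) (Y_k + Y_(k+1))^((1-a)/q).  The support
   condition gives c_0 = 0, and the exponent e = a/p + (1-a)/q lies in (1/tau, 1], so
   summing gives |c_k| <= C k^(1-e) X^(a/p) Y^((1-a)/q).  On A_k the logarithm is at
   least of order k, and sum_k k^(-mu + tau (1-e)) converges because
   mu - tau (1-e) >= tau e > 1. *)

(* The hypothesis on alpha - sigma acts through 1/tau = e + a (alpha - sigma - 1) / d. Its upper
   bound puts e above 1/tau, so that the final series converges. Its lower bound amounts to a (1/p -
   1) + (1 - a)/q <= 1/tau, which is what interpolation on one interval needs between a (1 -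
   1/p)-Hoelder bound and an L^q bound. With A = 1/p + (alpha - 1)/d and B = 1/q + beta/d, the
   critical case reads a A + (1 - a) B = 0: the powers of the scale cancel in the weighted product
   of the two bounds. The obstacle is that every dyadic scale then counts equally and the values of
   v may drift from one interval to the next; the logarithm pays for this drift. Point values are
   followed because a step between neighbours is bounded both by the gradient and by the height at
   the two points, and the powers a and 1 - a of these bounds combine. All constants depend only on
   the exponents and d. The chain works with positive upper bounds X and Y for the energies;
   vanishing and infinite norms are settled separately. *)
From HB Require Import structures.
Require Import Defs.
From mathcomp Require Import all_boot all_order all_algebra.
From mathcomp Require Import all_classical all_reals all_analysis.
From mathcomp Require Import measurable_realfun.
From mathcomp Require Import ring lra.
Set Implicit Arguments.
Unset Strict Implicit.
Unset Printing Implicit Defensive.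
Import Order.TTheory GRing.Theory Num.Theory.
Import numFieldNormedType.Exports.
Local Open Scope classical_set_scope.
Local Open Scope ring_scope.

(** * Polar coordinates *)

(* Gives the pushforward its measure structure, which inference does not find
   without the measurability proof. *)
Definition mpushforward d d' (T1 : measurableType d) (T2 : measurableType d')
    (R : realType) (m : {measure set T1 -> \bar R}) (f : T1 -> T2)
    (mf : measurable_fun setT f) : {measure set T2 -> \bar R} :=
  measure_function_pushforward__canonical__measure_function_Measure m mf.

Section scaling.
Context {R : realType}.
Notation leb := (@lebesgue_measure R).

Lemma lebesgue_measure_scale (c : R) (A : set R) : 0 < c -> measurable A ->
  leb ((fun x => c * x) @^-1` A) = (c^-1%:E * leb A)%E.
Proof.
move=> c0 mA.
have mc : measurable_fun setT
    ((fun x => c * x) : measurableTypeR R -> measurableTypeR R).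
  by apply: measurable_funM => //; exact: measurable_id.
pose m' : {measure set (measurableTypeR R) -> \bar R} :=
  mscale (NngNum (ltW c0)) (mpushforward leb mc).
have E : leb A = m' A.
  apply: lebesgue_measure_unique => // _ [[a b]/= _ <-].
  rewrite /m' /mscale/= /pushforward.
  have -> : (fun x : R => c * x) @^-1` `]a, b]%classic = `](a / c), (b / c)]%classic.
    apply/seteqP; split => x /=; rewrite !in_itv/= ltr_pdivrMr// ler_pdivlMr//;
    by rewrite ![x * c]mulrC.
  rewrite !lebesgue_measure_itv/= !lte_fin ltr_pM2r ?invr_gt0//.
  case: ifP => _; last by rewrite mule0.
  by rewrite -!EFinB -EFinM -mulrBl mulrCA mulfV ?mulr1// gt_eqF.
by rewrite E /m' /mscale/= /pushforward muleA -EFinM mulVf ?mul1e// gt_eqF.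
Qed.

Lemma continuous_scale_rV n (c : R) : continuous (fun x : 'rV[R]_n => c *: x).
Proof. exact: scaler_continuous. Qed.

Lemma measurable_scale_rV n (c : R) :
  measurable_fun setT (fun x : 'rV[R]_n => c *: x).
Proof.
apply: (@measurability _ _ _ _ _ _ (@open 'rV[R]_n)) => //.
move=> _ [U oU <-]; rewrite setTI; apply: open_measurable_rV.
by apply: open_comp => // x _; exact: continuous_scale_rV.
Qed.

Lemma scale_cons_rV n (c x : R) (v : 'rV[R]_n) :
  c *: cons_rV (x, v) = cons_rV (c * x, c *: v).
Proof.
apply/rowP => i; rewrite !mxE; case: unliftP => [j|] _ //=; by rewrite mxE.
Qed.

(** Induction along [cons_rV]: the one-dimensional slices of the preimage scale by c^-1, and the
    induction hypothesis, read as a change of measure under the integral over the remaining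
    coordinates, supplies c^-n. *)
Lemma lebesgue_rV_scale n (c : R) (A : set 'rV[R]_n) : 0 < c -> measurable A ->
  lebesgue_rV n ((fun x => c *: x) @^-1` A) =
  ((c ^- n)%:E * lebesgue_rV n A)%E.
Proof.
move=> c0; elim: n A => [|n IHn] A mA.
  rewrite expr0 invr1 mul1e; congr (lebesgue_rV 0 _).
  have E (x : 'rV[R]_0) : c *: x = x by apply/rowP => -[].
  by apply/seteqP; split => x /=; rewrite E.
rewrite /= /lebesgue_rV_step /pushforward.
set B := cons_rV @^-1` A.
have mB : measurable B.
  by rewrite -[X in measurable X]setTI; exact: measurable_cons_rV.
have -> : cons_rV @^-1` ((fun x : 'rV[R]_n.+1 => c *: x) @^-1` A) =
    (fun xv : R * 'rV[R]_n => (c * xv.1, c *: xv.2)) @^-1` B.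
  by apply/seteqP; split => -[x v]; rewrite /B/= scale_cons_rV.
have mFB : measurable_fun setT (fun v => leb (ysection B v)).
  exact: (measurable_fun_ysection leb).
rewrite /product_measure2.
transitivity (\int[lebesgue_rV n]_v
   (c^-1%:E * leb (ysection B (c *: v))))%E.
  apply: eq_integral => v _ /=.
  rewrite -lebesgue_measure_scale//; last exact: measurable_ysection.
rewrite ge0_integralZl//; last 2 first.
- by apply: (measurableT_comp mFB); exact: measurable_scale_rV.
- by rewrite lee_fin invr_ge0 ltW.
rewrite exprS invfM EFinM -muleA; congr (_ * _)%E.
have K0 : 0 <= c ^- n by rewrite invr_ge0 exprn_ge0// ltW.
transitivity (\int[mscale (NngNum K0) (lebesgue_rV n)]_v
    leb (ysection B v))%E; last first.
  by rewrite ge0_integral_mscale.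
rewrite -[LHS](ge0_integral_pushforward (@measurable_scale_rV n c)
  (lebesgue_rV n) measurableT mFB)//.
apply: eq_measure_integral => [|h D mD _]; [exact: measurable_scale_rV|exact: (IHn D mD)].
Qed.

End scaling.

Section enorm.
Context {R : realType}.
Notation leb := (@lebesgue_measure R).

Lemma enorm_ge0 n (x : 'rV[R]_n) : 0 <= enorm x.
Proof. exact: sqrtr_ge0. Qed.

Lemma enorm_sqr n (x : 'rV[R]_n) : enorm x ^+ 2 = \sum_i x ord0 i ^+ 2.
Proof. by rewrite sqr_sqrtr// sumr_ge0// => i _; exact: sqr_ge0. Qed.

Lemma enorm_scale n (c : R) (x : 'rV[R]_n) : enorm (c *: x) = `|c| * enorm x.
Proof.
rewrite /enorm -sqrtr_sqr -sqrtrM ?sqr_ge0// mulr_sumr; congr Num.sqrt.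
by apply: eq_bigr => i _; rewrite mxE exprMn.
Qed.

Lemma coord_le_enorm n (x : 'rV[R]_n) i : `|x ord0 i| <= enorm x.
Proof.
rewrite -sqrtr_sqr /enorm ler_sqrt ?sumr_ge0//; last by move=> j _; exact: sqr_ge0.
by rewrite (bigD1 i)//= lerDl sumr_ge0// => j _; exact: sqr_ge0.
Qed.

Lemma enorm_eq0 n (x : 'rV[R]_n) : (enorm x == 0) = (x == 0).
Proof.
apply/idP/idP => [/eqP x0|/eqP ->].
  apply/eqP/rowP => i; rewrite mxE; apply/eqP; rewrite -normr_eq0 eq_le normr_ge0.
  by rewrite andbT -x0 coord_le_enorm.
by rewrite /enorm big1 ?sqrtr0// => i _; rewrite mxE expr0n.
Qed.

Lemma enorm_gt0 n (x : 'rV[R]_n) : (0 < enorm x) = (x != 0).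
Proof. by rewrite lt_def enorm_eq0 enorm_ge0 andbT. Qed.

Lemma continuous_sumsq n : continuous (fun x : 'rV[R]_n => \sum_i x ord0 i ^+ 2).
Proof.
apply: (continuous_big (op := +%R)) => [|i _].
  exact: add_continuous.
move=> x; apply: (@continuous_comp _ _ _ (fun y : 'rV[R]_n => y ord0 i) (fun t : R => t ^+ 2)).
  exact: coord_continuous.
exact: exprn_continuous.
Qed.

Lemma continuous_enorm n : continuous (@enorm R n).
Proof.
move=> x; apply: continuous_comp; first exact: continuous_sumsq.
exact: sqrt_continuous.
Qed.

Lemma continuous_measurable_rV n (f : 'rV[R]_n -> R) : continuous f ->
  measurable_fun setT f.
Proof.
move=> cf; apply: (@measurability _ _ _ _ _ _ (@RGenOpens.G R)).
  exact: RGenOpens.measurableE.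
move=> _ [_ [a [b ->]] <-]; rewrite setTI; apply: open_measurable_rV.
by apply: open_comp => [x _|]; [exact: cf|exact: interval_open].
Qed.

Lemma measurable_enorm n : measurable_fun setT (@enorm R n).
Proof. exact: continuous_measurable_rV (@continuous_enorm n). Qed.

(* With |x|^n instead of |x| the polar change of variables has no Jacobian. *)
Definition enormX n (x : 'rV[R]_n) : R := enorm x ^+ n.

Lemma measurable_enormX n : measurable_fun setT (@enormX n).
Proof. exact: measurable_funX (@measurable_enorm n). Qed.

Lemma enormX_ge0 n (x : 'rV[R]_n) : 0 <= enormX x.
Proof. by rewrite exprn_ge0// enorm_ge0. Qed.

Lemma enormX_scale n c (x : 'rV[R]_n) : enormX (c *: x) = `|c| ^+ n * enormX x.
Proof. by rewrite /enormX enorm_scale exprMn. Qed.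

Lemma lebesgue_rV_sigma_finite n : sigma_finite setT (@lebesgue_rV R n).
Proof.
exists (fun k => [set x : 'rV[R]_n | forall i, `]- k%:R, k%:R[%classic (x ord0 i)]).
  apply/esym; rewrite -subTset => x _; exists (Num.truncn (enorm x)).+1 => // i; rewrite /= in_itv/= -ltr_norml.
  apply: le_lt_trans (coord_le_enorm _ _) _; exact: truncnS_gt.
move=> k; pose I := `]- k%:R, k%:R[%classic : set R.
split; first by apply: (@measurable_box_rV _ _ (fun=> I)) => i; exact: measurable_itv.
rewrite (@lebesgue_rV_box _ _ (fun=> I))//; last by move=> i; exact: measurable_itv.
rewrite -ge0_fin_numE; last by apply: prode_ge0 => i _; exact: measure_ge0.
apply: prode_fin_num => i _.
by rewrite lebesgue_measure_itv/=; case: ifP.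
Qed.

(* An alias carrying the sigma-finiteness instance needed by Tonelli's theorem. *)
Definition lebesgue_rV_sf n : set 'rV[R]_n -> \bar R := lebesgue_rV n.

HB.instance Definition _ n := isMeasure.Build _ _ _ (@lebesgue_rV_sf n)
  (measure0 (lebesgue_rV n)) (measure_ge0 (lebesgue_rV n))
  (@measure_semi_sigma_additive _ _ _ (lebesgue_rV n)).

HB.instance Definition _ n := Measure_isSigmaFinite.Build _ _ _
  (@lebesgue_rV_sf n) (lebesgue_rV_sigma_finite n).

Definition ball_vol n : R := fine (lebesgue_rV n [set x : 'rV[R]_n | enormX x <= 1]).

Lemma measurable_enormX_le n (s : R) :
  measurable [set x : 'rV[R]_n | enormX x <= s].
Proof.
rewrite -[X in measurable X]setTI.
have -> : [set x : 'rV[R]_n | enormX x <= s] = (@enormX n) @^-1` `]-oo, s]%classic.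
  by apply/seteqP; split => x /=; rewrite in_itv.
exact: measurable_enormX.
Qed.

Lemma enormX_le1 n (x : 'rV[R]_n) : (0 < n)%N -> (enormX x <= 1) = (enorm x <= 1).
Proof. by move=> n0; rewrite /enormX expr_le1// enorm_ge0. Qed.

Lemma ball_vol_fin n : (0 < n)%N ->
  lebesgue_rV n [set x : 'rV[R]_n | enormX x <= 1] = (ball_vol n)%:E.
Proof.
move=> n0; rewrite /ball_vol fineK//.
rewrite ge0_fin_numE ?measure_ge0//.
pose I := `[-1, 1]%classic : set R.
apply: (@le_lt_trans _ _ (lebesgue_rV n [set x : 'rV[R]_n | forall i, I (x ord0 i)])).
  apply: le_measure; rewrite ?inE.
  - exact: measurable_enormX_le.
  - by apply: (@measurable_box_rV _ _ (fun=> I)) => i; exact: measurable_itv.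
  - move=> x /=; rewrite enormX_le1// => x1 i; rewrite /I/= in_itv/= -ler_norml.
    exact: le_trans (coord_le_enorm _ _) x1.
rewrite (@lebesgue_rV_box _ _ (fun=> I))//; last by move=> i; exact: measurable_itv.
rewrite -ge0_fin_numE; last by apply: prode_ge0 => i _; exact: measure_ge0.
apply: prode_fin_num => i _.
by rewrite lebesgue_measure_itv/=; case: ifP.
Qed.

(** The cube [0, 1/n]^n lies in the unit ball: each squared coordinate is at most 1/n, so |x|^2 <=
    1. *)
Lemma ball_vol_gt0 n : (0 < n)%N -> 0 < ball_vol n.
Proof.
move=> n0; rewrite -lte_fin -ball_vol_fin//.
pose e : R := n%:R^-1.
have e0 : 0 < e by rewrite invr_gt0 ltr0n.
pose I := `[0, e]%classic : set R.
apply: (@lt_le_trans _ _ (lebesgue_rV n [set x : 'rV[R]_n | forall i, I (x ord0 i)])).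
  rewrite (@lebesgue_rV_box _ _ (fun=> I))//; last by move=> i; exact: measurable_itv.
  rewrite (eq_bigr (fun=> e%:E)); last first.
    by move=> i _; rewrite lebesgue_measure_itv/= lte_fin e0 -EFinD subr0.
  by rewrite prodEFin lte_fin prodr_gt0.
apply: le_measure; rewrite ?inE.
- by apply: (@measurable_box_rV _ _ (fun=> I)) => i; exact: measurable_itv.
- exact: measurable_enormX_le.
- move=> x /= xI; rewrite enormX_le1//.
  rewrite -(@expr_le1 _ 2) ?enorm_ge0// enorm_sqr.
  apply: (@le_trans _ _ (\sum_(i < n) e)).
    apply: ler_sum => i _; have := xI i; rewrite /I/= in_itv/= => /andP[x0 xe].
    apply: (@le_trans _ _ (x ord0 i)) => //.
    rewrite expr2 ler_piMr//; apply: le_trans xe _.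
    by rewrite /e invf_le1 ?ltr0n// ler1n.
  by rewrite sumr_const card_ord -mulr_natr mulVf// pnatr_eq0 -lt0n.
Qed.

(** For s > 0 the set is the unit ball dilated by s^(1/n). The level s = 0 is squeezed by positive
    levels, and negative levels are empty, hence the maximum. *)
Lemma enormX_le_measure n (s : R) : (0 < n)%N ->
  lebesgue_rV n [set x : 'rV[R]_n | enormX x <= s] =
  (ball_vol n * Num.max s 0)%:E.
Proof.
move=> n0.
have main (t : R) : 0 < t -> lebesgue_rV n [set x : 'rV[R]_n | enormX x <= t] =
    (ball_vol n * t)%:E.
  move=> t0; pose c := t `^ n%:R^-1.
  have c0 : 0 < c by rewrite powR_gt0.
  have cn : c ^+ n = t.
    by rewrite -powR_mulrn ?ltW// -powRrM mulVf ?powRr1 ?ltW// pnatr_eq0 -lt0n.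
  have -> : [set x : 'rV[R]_n | enormX x <= t] =
      (fun x => c^-1 *: x) @^-1` [set x : 'rV[R]_n | enormX x <= 1].
    apply/seteqP; split => x /=; rewrite enormX_scale gtr0_norm ?invr_gt0//;
    by rewrite exprVn cn mulrC ler_pdivrMr// mul1r.
  rewrite lebesgue_rV_scale ?invr_gt0//; last exact: measurable_enormX_le.
  by rewrite exprVn invrK cn ball_vol_fin// -EFinM mulrC.
have [s0|s0|<-] := ltgtP 0 s.
- by rewrite main// max_l// ltW.
- rewrite ?max_r ?ltW// mulr0.
  rewrite [X in lebesgue_rV n X](_ : _ = set0) ?measure0//.
  apply/seteqP; split => x //=; rewrite leNgt => /negP[].
  exact: lt_le_trans s0 (enormX_ge0 _).
- rewrite ?maxxx mulr0; apply/eqP; rewrite eq_le measure_ge0 andbT.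
  apply/lee_addgt0Pr => e e0; rewrite add0e.
  have e'0 : 0 < e / ball_vol n by rewrite divr_gt0// ball_vol_gt0.
  have := main _ e'0; have -> : ball_vol n * (e / ball_vol n) = e.
    by rewrite mulrC divfK// gt_eqF// ball_vol_gt0.
  move=> <-.
  apply: le_measure; rewrite ?inE; [exact: measurable_enormX_le..|].
  by move=> x /= x0; apply: le_trans x0 (ltW e'0).
Qed.

Definition pos : set R := [set s | 0 < s].

Lemma measurable_pos : measurable pos.
Proof.
have -> : pos = `]0, +oo[%classic by apply/seteqP; split => x /=; rewrite in_itv/= andbT.
exact: measurable_itv.
Qed.

Lemma ball_vol_ge0 n : 0 <= ball_vol n.
Proof. exact: fine_ge0 (measure_ge0 _ _). Qed.

(** Both sides are measures in A, finite on bounded intervals, and [enormX_le_measure] makes them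
    agree on half-open intervals. *)
Lemma polar_measure n (A : set R) : (0 < n)%N -> measurable A ->
  lebesgue_rV n ((@enormX n) @^-1` A) = ((ball_vol n)%:E * leb (A `&` pos))%E.
Proof.
move=> n0 mA.
have mX : measurable_fun setT (@enormX n : _ -> measurableTypeR R).
  exact: measurable_enormX.
pose m1 : {measure set (measurableTypeR R) -> \bar R} :=
  mpushforward (lebesgue_rV n) mX.
pose m2 : {measure set (measurableTypeR R) -> \bar R} :=
  mscale (NngNum (ball_vol_ge0 n)) (mrestr leb measurable_pos).
have E (a b : R) : m1 `]a, b]%classic = m2 `]a, b]%classic.
  rewrite /m1 /m2 /mpushforward/= /mscale/= /mrestr /pushforward.
  have [ba|ab] := leP b a.
    by rewrite set_itv_ge ?preimage_set0 ?set0I ?measure0 ?mule0// bnd_simp -leNgt.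
  have -> : `]a, b] `&` pos = `](Num.max a 0), (Num.max b 0)]%classic.
    apply/seteqP; split => x /=; rewrite /pos/= !in_itv/= gt_max le_max.
      by move=> [/andP[-> ->] ->].
    move=> /andP[/andP[-> x0] /orP[->//|]]; by rewrite leNgt x0.
  rewrite lebesgue_measure_itv/= lte_fin.
  have -> : (@enormX n) @^-1` `]a, b]%classic =
     [set x | enormX x <= b] `\` [set x | enormX x <= a].
    apply/seteqP; split => x /=; rewrite in_itv/=.
      by move=> /andP[h ->]; split => //; rewrite leNgt h.
    by move=> [-> /negP]; rewrite -ltNge => ->.
  have -> : lebesgue_rV n ([set x | enormX x <= b] `\` [set x | enormX x <= a]) =
     (lebesgue_rV n [set x | (enormX x <= b)%R] - lebesgue_rV n
      ([set x | (enormX x <= b)%R] `&` [set x | (enormX x <= a)%R]))%E.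
    apply: measureD; [exact: measurable_enormX_le..|].
    by have := enormX_le_measure b n0 => /= ->; rewrite ltry.
  rewrite (_ : _ `&` _ = [set x | enormX x <= a]); last first.
    by apply/setIidr => x /= xa; apply: le_trans xa (ltW ab).
  rewrite !enormX_le_measure// -EFinB -mulrBr EFinM; congr (_ * _)%E.
  case: ifPn => [//|]; rewrite -leNgt => h.
  apply/eqP; rewrite eqe subr_eq0 eq_le h /=.
  by rewrite le_max2// ltW.
rewrite -[LHS]/(m1 A) -[RHS]/(m2 A).
apply: (@measure_unique _ _ (measurableTypeR R) (@ocitv R)
  (fun k => `]- k%:R, k%:R]%classic)) => //.
- exact: ocitvI.
- by move=> k; exists (- k%:R, k%:R).
- apply/seteqP; split => // x _; exists (Num.truncn `|x : R|).+1 => //=.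
  rewrite in_itv/=; have := truncnS_gt `|x : R|; rewrite ltr_norml => /andP[-> /ltW].
  done.
- by move=> _ [[a b] _ <-]; exact: E.
- move=> k; rewrite /m1 /mpushforward/= /pushforward.
  apply: (@le_lt_trans _ _ (lebesgue_rV n [set x | enormX x <= k%:R])).
    apply: le_measure; rewrite ?inE.
    + by rewrite -[X in measurable X]setTI; exact: measurable_enormX.
    + exact: measurable_enormX_le.
    + by move=> x /=; rewrite in_itv/= => /andP[].
  by rewrite enormX_le_measure// ltry.
Qed.

Lemma polar_integral n (f : R -> \bar R) : (0 < n)%N -> measurable_fun setT f ->
  (forall s, 0 <= f s)%E ->
  (\int[lebesgue_rV n]_x f (enormX x) =
   (ball_vol n)%:E * \int[leb]_(s in pos) f s)%E.
Proof.
move=> n0 mf f0.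
have mX : measurable_fun setT (@enormX n : _ -> measurableTypeR R).
  exact: measurable_enormX.
transitivity (\int[mpushforward (lebesgue_rV n) mX]_s f s)%E.
  by rewrite (ge0_integral_pushforward mX (lebesgue_rV n) measurableT mf).
transitivity (\int[mscale (NngNum (ball_vol_ge0 n)) (mrestr leb measurable_pos)]_s f s)%E.
  apply: eq_measure_integral => A mA _; exact: polar_measure.
rewrite ge0_integral_mscale//; congr (_ * _)%E.
set m := mrestr leb measurable_pos.
rewrite -(setUv pos) ge0_integral_setU//; last 4 first.
- exact: measurable_pos.
- by apply: measurableC; exact: measurable_pos.
- by rewrite setUv.
- by apply/disj_setPS; rewrite setICr.
rewrite [X in (_ + X)%E](_ : _ = 0%E) ?adde0.
  by apply: eq_measure_integral => A mA Ap; rewrite /m/= /mrestr setIidl.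
rewrite -(@integral_measure_zero _ (measurableTypeR R) R (~` pos) f).
apply: (@eq_measure_integral _ (measurableTypeR R)) => A mA Ap; rewrite /m/= /mrestr.
rewrite [X in leb X](_ : _ = set0) ?measure0//.
by apply/seteqP; split => x //= [/Ap].
Qed.

End enorm.

(** * Radial functions as functions of |x|^n *)

Section radial_profile.
Context {R : realType}.
Notation leb := (@lebesgue_measure R).

(** The sigma-algebra on row vectors is generated by the open sets and not by the coordinates, so
    the vector is rebuilt one coordinate at a time with the Borel map [cons_rV]. *)
Lemma measurable_fun_rV d (T : measurableType d) n (f : T -> 'rV[R]_n) :
  (forall i, measurable_fun setT (fun t => f t ord0 i)) -> measurable_fun setT f.
Proof.
elim: n f => [|n IHn] f mf.
  move=> _ B mB; rewrite setTI.
  have [B0|B0] := pselect (B 0).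
    rewrite (_ : f @^-1` B = setT)//; apply/seteqP; split => // t _ /=.
    by rewrite (_ : f t = 0)//; apply/rowP => -[].
  rewrite (_ : f @^-1` B = set0)//; apply/seteqP; split => // t /=.
  by rewrite (_ : f t = 0)//; apply/rowP => -[].
have -> : f = @cons_rV R n \o (fun t => (f t ord0 ord0, \row_j f t ord0 (lift ord0 j))).
  apply/funext => t /=; apply/rowP => i; rewrite mxE.
  by case: unliftP => [j|] -> /=; rewrite ?mxE.
apply: measurableT_comp; first exact: measurable_cons_rV.
apply: measurable_fun_pair; first exact: mf.
by apply: IHn => i; under eq_fun do rewrite mxE; exact: mf.
Qed.

Lemma open_punctured n : open (@punctured R n).
Proof.
rewrite (_ : punctured = (@enorm R n) @^-1` [set x | 0 < x]); last first.
  by apply/seteqP; split => x /=; rewrite /punctured/= enorm_gt0.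
apply: open_comp; last exact: open_gt.
by move=> x _; exact: continuous_enorm.
Qed.

Lemma measurable_punctured n : measurable (@punctured R n).
Proof. exact: open_measurable_rV (@open_punctured n). Qed.

Lemma enormX_gt0 n (x : 'rV[R]_n) : (0 < n)%N -> (0 < enormX x) = (x != 0).
Proof. by move=> n0; rewrite /enormX lt_def expf_eq0 n0 exprn_ge0 ?enorm_ge0// enorm_eq0 andbT. Qed.

Lemma puncturedC_null n : (0 < n)%N -> lebesgue_rV n (~` (@punctured R n)) = 0%E.
Proof.
move=> n0; rewrite (_ : ~` _ = [set x | enormX x <= 0]).
  by rewrite enormX_le_measure// maxxx mulr0.
apply/seteqP; split => x /=; rewrite /punctured/= -enormX_gt0//.
  by move=> /negP; rewrite -leNgt.
by move=> h; apply/negP; rewrite -leNgt.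
Qed.

(* By Tonelli, for almost every y the function t |-> u(t^(1/n) y) agrees a.e. with
   the given profile; one such ray yields v. *)
Lemma radial_profile n (u : 'rV[R]_n -> R) : (0 < n)%N ->
  measurable_fun punctured u -> radial u ->
  exists2 v : R -> R, measurable_fun setT v &
    {ae lebesgue_rV n, forall x, u x = v (enormX x)}.
Proof.
move=> n0 mu [w [N0 [mN0 N00 uw]]].
pose u' := u \_ punctured.
have mu' : measurable_fun setT u'.
  exact: (measurable_restrictT u (@measurable_punctured n)).1.
pose sc (ty : R * 'rV[R]_n) := ty.1 `^ n%:R^-1 *: ty.2.
have msc : measurable_fun setT sc.
  apply: measurable_fun_rV => i; under eq_fun do rewrite mxE.
  apply: measurable_funM.
    by apply: (measurableT_comp (measurable_powR _)); exact: measurable_fst.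
  apply: (measurableT_comp (measurable_coord_rV i)); exact: measurable_snd.
pose N := sc @^-1` N0 `&` (pos `*` setT).
have mN : measurable N.
  apply: measurableI; first by rewrite -[X in measurable X]setTI; exact: msc.
  by apply: measurableX => //; exact: measurable_pos.
(* Each section of [N] at t > 0 is a dilate of the null set [N0]. *)
have N_null : (leb \x lebesgue_rV_sf (n:=n))%E N = 0%E.
  rewrite /product_measure1 integral0_eq// => t _ /=.
  have [t0|t0] := ltP 0 t; last first.
    rewrite (_ : xsection N t = set0) ?measure0//; apply/seteqP; split => // y.
    by rewrite /xsection/= inE => -[_ []] /=; rewrite /pos/= ltNge t0.
  rewrite (_ : xsection N t = (fun y => t `^ n%:R^-1 *: y) @^-1` N0).
    have := lebesgue_rV_scale (powR_gt0 n%:R^-1 t0) mN0.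
    by rewrite N00 mule0.
  by apply/seteqP; split => y; rewrite /xsection/= inE; [case|move=> h; split].
(* Agreement of the two product measures exchanges the order of integration: for almost every y the
   section along the ray through y is null. *)
have {N_null} : (leb \x^ lebesgue_rV_sf (n:=n))%E N = 0%E.
  rewrite -N_null; apply/esym/product_measure_unique => // A B mA mB.
  exact: product_measure2E.
rewrite /product_measure2 => N_null.
have mYN : measurable_fun setT (fun y => leb (ysection N y)).
  exact: (measurable_fun_ysection leb).
have : (\int[lebesgue_rV_sf (n:=n)]_y `|leb (ysection N y)| = 0)%E.
  by rewrite -[RHS]N_null; apply: eq_integral => y _ /=; rewrite gee0_abs.
move=> /(ae_eq_integral_abs _ measurableT mYN) [M [mM M0 MN]].
have [y [yM y0]] : exists y : 'rV[R]_n, ~ M y /\ y != 0.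
  apply: contrapT => h.
  have : (lebesgue_rV n [set x : 'rV[R]_n | (enormX x <= 1)%R] <=
          lebesgue_rV n (M `|` ~` (@punctured R n)))%E.
    apply: le_measure; rewrite ?inE.
    - exact: measurable_enormX_le.
    - by apply: measurableU => //; apply: measurableC; exact: measurable_punctured.
    - move=> y _ /=; have [|My] := pselect (M y); first by left.
      right => py; apply: h; exists y; split => //.
  rewrite leNgt => /negP; apply.
  apply: (@le_lt_trans _ _ 0%E).
    have -> : lebesgue_rV n (M `|` ~` (@punctured R n)) = 0%E; last by [].
    apply/eqP; rewrite -measure_le0 -[X in (_ <= X)%E]adde0.
    apply: le_trans (measureU2 _ _ _) _ => //.
      by apply: measurableC; exact: measurable_punctured.
    by rewrite [X in (_ + X)%E]puncturedC_null// [X in (X + _)%E]M0 adde0.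
  by rewrite enormX_le_measure// max_l// mulr1 lte_fin ball_vol_gt0.
have Ny : leb (ysection N y) = 0%E.
  by apply: contrapT => h; apply: yM; apply: MN => /= /(_ I).
pose la := enormX y.
have la0 : 0 < la by rewrite /la enormX_gt0.
(* For s > 0, the point of the ray through y at which |z s|^n = s. *)
pose z s := (s / la) `^ n%:R^-1 *: y.
exists (u' \o z).
  apply: measurableT_comp => //; apply: measurable_fun_rV => i.
  under eq_fun do rewrite /z mxE; apply: measurable_funM => //.
  apply: (measurableT_comp (measurable_powR _)); exact: mulrr_measurable.
pose Z := (fun s => la^-1 * s) @^-1` (ysection N y).
have mZ : measurable Z.
  rewrite -[X in measurable X]setTI; apply: mulrl_measurable => //.
  exact: measurable_ysection.
have Z0 : leb Z = 0%E.
  rewrite lebesgue_measure_scale ?invr_gt0//; last exact: measurable_ysection.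
  by rewrite [X in (_ * X)%E]Ny mule0.
have mXZ : measurable ((@enormX R n) @^-1` Z).
  by rewrite -[X in measurable X]setTI; exact: measurable_enormX.
(* Three exceptional sets: where u differs from w, the origin, and the x whose value |x|^n is
   exceptional on the chosen ray. *)
exists (N0 `|` ~` (@punctured R n) `|` (@enormX R n) @^-1` Z); split.
- apply: measurableU => //; apply: measurableU => //.
  by apply: measurableC; exact: measurable_punctured.
- apply/eqP; rewrite -measure_le0.
  have mP : measurable (~` (@punctured R n)) by apply: measurableC; exact: measurable_punctured.
  apply: le_trans (measureU2 _ _ _) _ => //; first exact: measurableU.
  rewrite [X in (_ + X)%E](_ : _ = 0%E) ?adde0; last first.
    rewrite [LHS]polar_measure//; apply/eqP; rewrite mule_eq0; apply/orP; right.
    rewrite -measure_le0 -Z0; apply: le_measure; rewrite ?inE//.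
    by apply: measurableI => //; exact: measurable_pos.
  apply: le_trans (measureU2 _ _ _) _ => //.
  by rewrite [X in (_ + X)%E]puncturedC_null// [X in (X + _)%E]N00 adde0.
- move=> x /=; apply: contra_notP => /not_orP[/not_orP[N0x]].
  rewrite notK => /[dup] px; rewrite /punctured/= -enormX_gt0// => x0 Zx.
  have ux : u x = w (enorm x) by apply: contrapT => h; apply: N0x; exact: uw.
  have zx0 : 0 < enormX x / la by rewrite divr_gt0.
  have zE : enorm (z (enormX x)) = enorm x.
    apply/eqP; rewrite -(@eqrXn2 _ n)// ?enorm_ge0//; apply/eqP.
    rewrite -/(enormX _) /z enormX_scale ger0_norm ?powR_ge0//.
    rewrite -powR_mulrn ?powR_ge0// -powRrM mulVf ?pnatr_eq0 -?lt0n//.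
    by rewrite powRr1 ?ltW// -/la divfK// gt_eqF.
  have pz : punctured (z (enormX x)).
    by rewrite /punctured/= -enorm_gt0 zE enorm_gt0.
  rewrite /u' patchE mem_set//.
  have -> : u (z (enormX x)) = w (enorm (z (enormX x))).
    apply: contrapT => h; apply: Zx; rewrite /Z /ysection/= inE; split => /=.
      by rewrite mulrC; exact: uw.
    by split => //; rewrite /pos/= mulrC.
  by rewrite zE.
Qed.

End radial_profile.

(** * Radial test fields *)

Section smooth_bump.
Context {R : realType}.

(** Gives the derivative of [flat p] at the gluing point 0, where no formula is available. *)
Lemma is_derive_quadratic (f : R -> R) (x C : R) :
  (forall h, `|h| <= 1 -> `|f (x + h) - f x| <= C * h ^+ 2) ->
  is_derive x 1 f 0.
Proof.
move=> fC.
have C0 : 0 <= C.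
  have := fC 1; rewrite normr1 lexx expr1n mulr1 => /(_ isT); exact: le_trans.
have L : (fun h => h^-1 *: ((f \o shift x) (h *: (1 : R)) - f x)) @ 0^' --> (0 : R).
  apply/cvgrPdist_le => e e0; near=> h.
  have h0 : h != 0 by near: h; exact: nbhs_dnbhs_neq.
  rewrite sub0r normrN /= normrZ normfV ler_pdivrMl ?normr_gt0//.
  have -> : h *: (1 : R) + x = x + h by rewrite addrC [_ *: _]mulr1.
  have h1 : `|h| <= 1.
    by near: h; apply: dnbhs0_le.
  apply: le_trans (fC _ h1) _.
  rewrite -[h ^+ 2]ger0_norm ?sqr_ge0// normrX expr2 mulrCA ler_wpM2l//.
  have : `|h| <= e / (C + 1).
    by near: h; apply: dnbhs0_le; rewrite divr_gt0// ltr_wpDl.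
  move=> he; apply: (@le_trans _ _ ((C + 1) * `|h|)).
    by rewrite ler_wpM2r// lerDl.
  by rewrite mulrC -ler_pdivlMr// ltr_wpDl.
apply: DeriveDef; last exact: cvg_lim L.
by apply/cvg_ex; exists 0.
Unshelve. all: by end_near. Qed.

Lemma is_derive_affine (a b t : R) : is_derive t 1 (fun t => a * t + b) a.
Proof.
have h : is_derive t 1 ((a \*: (id : R -> R)) + cst b) (a *: 1 + 0).
  by apply: is_deriveD.
by rewrite addr0 [_ *: _]mulr1 in h.
Qed.

Lemma is_derive_near0 (V : normedModType R) (f : V -> R) (x v : V) :
  (\forall y \near x, f y = 0) -> is_derive x v f 0.
Proof.
move=> f0; apply: (near_eq_is_derive _ (is_derive_cst (0 : R) x v)).
by apply: filterS f0 => y ->.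
Qed.

(** The classical flat function exp(-1/t), with a polynomial factor in 1/t so that the family is
    closed under derivation: p becomes X^2 (p - p'). *)
Definition flat (p : {poly R}) (t : R) : R :=
  if 0 < t then p.[t^-1] * expR (- t^-1) else 0.

Lemma horner_bound (p : {poly R}) : exists2 M : R, 0 <= M &
  forall y, 1 <= y -> `|p.[y]| <= M * y ^+ size p.
Proof.
exists (\sum_(i < size p) `|p`_i|); first by apply: sumr_ge0.
move=> y y1; have y0 : 0 <= y by apply: le_trans y1.
rewrite horner_coef (le_trans (ler_norm_sum _ _ _))// mulr_suml.
apply: ler_sum => i _; rewrite normrM ler_wpM2l// normrX ger0_norm//.
by apply: ler_weXn2l => //; exact: ltnW.
Qed.

Lemma flat_quadratic p : exists C : R,
  forall h, `|h| <= 1 -> `|flat p h| <= C * h ^+ 2.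
Proof.
have [M M0 hM] := horner_bound p.
(* With y = 1/h, p(y) is at most M y^n while exp(y) >= y^(n+2) / (n+2)!; the two spare powers of y
   give h^2. *)
pose n := size p; exists (M * (n.+2)`!%:R) => h h1.
rewrite /flat; case: ifPn => h0; last first.
  by rewrite normr0 mulr_ge0 ?sqr_ge0// mulr_ge0.
have y1 : 1 <= h^-1 by rewrite invf_ge1//; apply: le_trans h1; exact: ler_norm.
have y0 : 0 < h^-1 by rewrite invr_gt0.
rewrite normrM [X in _ * X]ger0_norm ?expR_ge0// expRN.
apply: (@le_trans _ _ (M * h^-1 ^+ n * (n.+2`!%:R / h^-1 ^+ n.+2))).
  apply: ler_pM => //; first exact: hM.
  rewrite -[leRHS]invrK lef_pV2 ?posrE ?expR_gt0 ?invr_gt0 ?divr_gt0 ?exprn_gt0//.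
  rewrite invf_div; apply: le_trans (expR_ge1Dxn n.+1 (ltW y0)).
  by rewrite lerDr.
rewrite -!mulrA ler_wpM2l// mulrCA ler_wpM2l// -addn2 exprD invfM.
have yn : h^-1 ^+ n != 0 by rewrite expf_neq0// gt_eqF.
by rewrite mulrA (mulfV yn) mul1r exprVn invrK.
Qed.

Lemma is_derive_flat p (t : R) :
  is_derive t 1 (flat p) (flat ('X^2 * (p - p^`())) t).
Proof.
have [t0|t0|->] := ltgtP t 0.
- rewrite [flat _ t]/flat ltNge ltW//=.
  apply: is_derive_near0; near=> s; rewrite /flat ltNge ltW//=.
  by near: s; exact: lt_nbhsl.
- have H : is_derive t 1 (fun s => p.[s^-1] * expR (- s^-1))
     (flat ('X^2 * (p - p^`())) t).
    have t00 : t != 0 by rewrite gt_eqF.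
    have dV : is_derive t 1 (fun s : R => s^-1) (- t ^- 2).
      have := @is_deriveV R id t 1 1 t00 (is_derive_id _ _).
      by rewrite [_ *: _]mulr1.
    have dp : is_derive t 1 (fun s : R => p.[s^-1]) (p^`().[t^-1] * - t ^- 2).
      apply: (@is_derive1_comp _ (horner p) (fun s => s^-1)).
    have de : is_derive t 1 (fun s : R => expR (- s^-1)) (expR (- t^-1) * (t ^- 2)).
      apply: (@is_derive1_comp _ expR (fun s => - s^-1)).
      rewrite -[X in is_derive _ _ _ X]opprK; exact: is_deriveN.
    have dM : is_derive t 1 (fun s => p.[s^-1] * expR (- s^-1)) _ := is_deriveM dp de.
    apply: (is_derive_eq dM).
    rewrite /flat t0 !hornerE /GRing.scale/= -exprVn; ring.
  apply: near_eq_is_derive H; near=> s; rewrite /flat.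
  have -> // : 0 < s by near: s; exact: lt_nbhsr.
- rewrite [flat _ 0]/flat ltxx; have [C hC] := flat_quadratic p.
  apply: (is_derive_quadratic (C := C)) => h h1.
  by rewrite add0r [flat p 0]/flat ltxx subr0; exact: hC.
Unshelve. all: by end_near. Qed.

(* Membership is preserved by derivation, so that smoothness of all orders follows
   by structural induction. *)
Inductive csmooth : (R -> R) -> Prop :=
| csmooth_flat p (a b : R) : csmooth (fun t => flat p (a * t + b))
| csmoothD f g : csmooth f -> csmooth g -> csmooth (fun t => f t + g t)
| csmoothM f g : csmooth f -> csmooth g -> csmooth (fun t => f t * g t)
| csmoothZ (k : R) f : csmooth f -> csmooth (fun t => k * f t)
| csmooth_prim f f' : csmooth f' -> (forall t : R, is_derive t 1 f (f' t)) -> csmooth f.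

Lemma csmooth_derive f : csmooth f ->
  exists2 f', csmooth f' & forall t : R, is_derive t 1 f (f' t).
Proof.
elim=> [p a b|{}f g _ [f' cf df] _ [g' cg dg]|{}f g hf [f' cf df] hg [g' cg dg]
  |k {}f _ [f' cf df]|{}f f' cf' _ df]; last by exists f'.
- exists (fun t => a * flat ('X^2 * (p - p^`())) (a * t + b)).
    exact/csmoothZ/csmooth_flat.
  move=> t; have da : is_derive t 1 (fun t : R => a * t + b) a := is_derive_affine a b t.
  rewrite mulrC.
  exact: (@is_derive1_comp _ (flat p) (fun t => a * t + b) t _ _ (is_derive_flat _ _) da).
- exists (fun t => f' t + g' t); first exact: csmoothD.
  by move=> t; exact: is_deriveD.
- exists (fun t => f t * g' t + g t * f' t).
    by apply: csmoothD; exact: csmoothM.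
  by move=> t; exact: is_deriveM.
- exists (fun t => k * f' t); first exact: csmoothZ.
  by move=> t; exact: is_deriveZ.
Qed.

Lemma csmooth_continuous f : csmooth f -> continuous f.
Proof.
move=> /csmooth_derive[f' _ df] t.
by apply: differentiable_continuous; apply/derivable1_diffP; case: (df t).
Qed.

Lemma is_derive_uniq (f : R -> R) (t a b : R) :
  is_derive t 1 f a -> is_derive t 1 f b -> a = b.
Proof. by move=> [_ <-] [_ <-]. Qed.

Lemma derive_near_cst (f f' : R -> R) (e : R) :
  (forall t : R, is_derive t 1 f (f' t)) ->
  (forall t, t < e -> f t = 0) -> forall t, t < e -> f' t = 0.
Proof.
move=> df f0 t te; apply: (is_derive_uniq (df t)).
by apply: is_derive_near0; near=> s; rewrite f0//; near: s; exact: lt_nbhsl.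
Unshelve. all: by end_near. Qed.

End smooth_bump.

Section radial_test.
Context {R : realType} {n : nat}.
Hypothesis n0 : (0 < n)%N.
Implicit Types x v : 'rV[R]_n.

(** Restricts directional derivatives to a line, where the one-variable chain rule applies. *)
Lemma is_derive_dir (V W : normedModType R) (f : V -> W) (x v : V) df :
  is_derive x v f df <-> is_derive (0 : R) 1 (fun h => f (h *: v + x)) df.
Proof.
have E : (fun h => h^-1 *: ((f \o shift x) (h *: v) - f x)) =
  (fun h : R => h^-1 *: (((fun h => f (h *: v + x)) \o shift 0) (h *: (1 : R)) - f (0 *: v + x))).
  by apply/funext => h /=; rewrite addr0 scale0r add0r [_ *: 1]mulr1.
by split=> -[H1 H2]; apply: DeriveDef;
  [rewrite /derivable -E|rewrite /derive -E|rewrite /derivable E|rewrite /derive E].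
Qed.

Lemma is_derive_comp_dir (V : normedModType R) (f : R -> R) (g : V -> R) (x v : V) a b :
  is_derive (g x) 1 f a -> is_derive x v g b -> is_derive x v (f \o g) (a * b).
Proof.
move=> df /is_derive_dir dg; apply/is_derive_dir.
apply: (@is_derive1_comp _ f (fun h => g (h *: v + x))) => //.
by rewrite scale0r add0r.
Qed.

(** |x|^2 is a polynomial, unlike |x|; radial expressions are written with its real powers, and
    |x|^n is the power b = n/2. *)
Definition sqn x : R := \sum_i x ord0 i ^+ 2.

Lemma is_derive_coord (i : 'I_n) x v : is_derive x v (fun x => x ord0 i) (v ord0 i).
Proof.
apply/is_derive_dir.
have h : is_derive (0 : R) 1 ((v ord0 i \*: (id : R -> R)) + cst (x ord0 i)) (v ord0 i *: 1 + 0).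
  exact: is_deriveD.
rewrite addr0 [_ *: 1]mulr1 in h.
rewrite (_ : (fun h => _) = v ord0 i \*: id + cst (x ord0 i))//.
by apply/funext => t; rewrite !mxE [RHS]/(_ * _ + _) mulrC.
Qed.

Lemma is_derive_sqn (j : 'I_n) x :
  is_derive x (delta_mx ord0 j) sqn (2 * x ord0 j).
Proof.
have -> : sqn = \sum_(i < n) (fun x => x ord0 i) ^+ 2.
  by apply/funext => y; rewrite fct_sumE.
apply: is_derive_eq.
  apply: is_derive_sum => i; apply: is_deriveX; exact: is_derive_coord.
rewrite (bigD1 j)//= big1 ?addr0 => [|i ij].
  by rewrite mxE !eqxx expr1 [_ *: _]mulr1.
by rewrite mxE (negbTE ij) andbF [_ *: _]mulr0.
Qed.

Lemma sqn_ge0 x : 0 <= sqn x.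
Proof. by apply: sumr_ge0 => i _; exact: sqr_ge0. Qed.

Lemma sqnE x : sqn x = enorm x ^+ 2.
Proof. by rewrite enorm_sqr. Qed.

Lemma sqn_gt0 x : (0 < sqn x) = (x != 0).
Proof. by rewrite sqnE exprn_even_gt0//= enorm_eq0. Qed.

Let b : R := n%:R / 2.

Let b0 : 0 < b. Proof. by rewrite divr_gt0// ltr0n. Qed.

Lemma sqn_powR x (k : nat) : sqn x `^ (k%:R / 2) = enorm x ^+ k.
Proof.
rewrite mulrC powRrM powR12_sqrt ?sqn_ge0// powR_mulrn ?sqrtr_ge0//.
Qed.

(* Closed under partial derivatives; the powers of |x|^2 in rsmooth_rad are harmless
   at the origin because F vanishes near 0. *)
Inductive rsmooth : ('rV[R]_n -> R) -> Prop :=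
| rsmooth_cst (k : R) : rsmooth (fun=> k)
| rsmooth_coord i : rsmooth (fun x => x ord0 i)
| rsmoothD f g : rsmooth f -> rsmooth g -> rsmooth (fun x => f x + g x)
| rsmoothM f g : rsmooth f -> rsmooth g -> rsmooth (fun x => f x * g x)
| rsmooth_rad (c : R) F (e : R) : 0 < e -> csmooth F -> (forall t, t < e -> F t = 0) ->
    rsmooth (fun x => sqn x `^ c * F (sqn x `^ b)).

Lemma near0_rad (c : R) F (e : R) : 0 < e -> (forall t, t < e -> F t = 0) ->
  \forall x \near (0 : 'rV[R]_n), sqn x `^ c * F (sqn x `^ b) = 0.
Proof.
move=> e0 F0.
have : (@enorm R n) x @[x --> (0 : 'rV[R]_n)] --> enorm (0 : 'rV[R]_n) by exact: continuous_enorm.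
have -> : enorm (0 : 'rV[R]_n) = 0 by apply/eqP; rewrite enorm_eq0.
(* For |x| < 1 and n > 0 one has |x|^n <= |x|, so |x| < e brings |x|^n below the threshold of F. *)
pose m := Num.min 1 e.
have m0 : 0 < m by rewrite lt_min ltr01.
move=> /cvgrPdist_lt /(_ m m0); apply: filterS => x.
rewrite sub0r normrN ger0_norm ?enorm_ge0// => xm.
rewrite sqn_powR F0 ?mulr0//.
move: xm; rewrite lt_min => /andP[x1]; apply: le_lt_trans.
by case: (n) n0 x x1 => // k _ x x1; rewrite exprS ler_piMr ?enorm_ge0// exprn_ile1 ?enorm_ge0// ltW.
Qed.

Lemma is_derive_rad (c : R) F F' (e : R) (i : 'I_n) x : 0 < e ->
  (forall t : R, is_derive t 1 F (F' t)) -> (forall t, t < e -> F t = 0) ->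
  is_derive x (delta_mx ord0 i) (fun x => sqn x `^ c * F (sqn x `^ b))
   (2 * x ord0 i * (c * (sqn x `^ (c - 1) * F (sqn x `^ b)) +
       b * (sqn x `^ (c + b - 1) * F' (sqn x `^ b)))).
Proof.
move=> e0 dF F0; have F'0 := derive_near_cst dF F0.
have [->|x0] := eqVneq x 0.
  rewrite mxE mulr0 mul0r.
  exact: is_derive_near0 (near0_rad c e0 F0).
have s0 : 0 < sqn x by rewrite sqn_gt0.
pose G t : R := t `^ c * F (t `^ b).
have dG : is_derive (sqn x) 1 G (c * (sqn x `^ (c - 1) * F (sqn x `^ b)) +
       b * (sqn x `^ (c + b - 1) * F' (sqn x `^ b))).
  have d1 := is_derive1_powR c s0.
  have d2 := is_derive1_powR b s0.
  have d3 := @is_derive1_comp _ F (@powR R ^~ b) _ _ _ (dF _) d2.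
  have dM : is_derive (sqn x) 1 G _ := is_deriveM d1 d3.
  apply: (is_derive_eq dM).
  have -> : sqn x `^ (c + b - 1) = sqn x `^ c * sqn x `^ (b - 1).
    by rewrite -powRD ?addrA// (gt_eqF s0) implybT.
  rewrite /GRing.scale/=; ring.
rewrite [X in is_derive _ _ _ X]mulrC.
exact: (is_derive_comp_dir dG (is_derive_sqn i x)).
Qed.

Lemma rsmooth_partial f (i : 'I_n) : rsmooth f ->
  exists2 f', rsmooth f' & forall x, is_derive x (delta_mx ord0 i) f (f' x).
Proof.
elim=> [k|j|{}f g _ [f' cf df] _ [g' cg dg]|{}f g hf [f' cf df] hg [g' cg dg]
  |c F e e0 cF F0].
- exists (fun=> 0); first exact: rsmooth_cst.
  by move=> x; exact: is_derive_cst.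
- exists (fun=> (delta_mx ord0 i : 'rV[R]_n) ord0 j); first exact: rsmooth_cst.
  by move=> x; exact: is_derive_coord.
- exists (fun x => f' x + g' x); first exact: rsmoothD.
  by move=> x; exact: is_deriveD.
- exists (fun x => f x * g' x + g x * f' x); first by apply: rsmoothD; exact: rsmoothM.
  by move=> x; exact: is_deriveM.
- have [F' cF' dF] := csmooth_derive cF.
  have F'0 := derive_near_cst dF F0.
  exists (fun x => 2 * x ord0 i * (c * (sqn x `^ (c - 1) * F (sqn x `^ b)) +
       b * (sqn x `^ (c + b - 1) * F' (sqn x `^ b)))).
    apply: rsmoothM; first by apply: rsmoothM; [exact: rsmooth_cst|exact: rsmooth_coord].
    by apply: rsmoothD; (apply: rsmoothM; first exact: rsmooth_cst); exact: (rsmooth_rad _ e0).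
  by move=> x; exact: (is_derive_rad _ _ _ e0).
Qed.

Lemma rsmooth_continuous f : rsmooth f -> continuous f.
Proof.
elim=> [k|j|{}f g _ cf _ cg|{}f g _ cf _ cg|c F e e0 cF F0] x.
- exact: cst_continuous.
- exact: coord_continuous.
- exact: (cvgD (cf x) (cg x)).
- exact: (cvgM (cf x) (cg x)).
- have [->|x0] := eqVneq x 0.
    have h := near0_rad c e0 F0.
    exact: (near_cst_continuous 0).
  have s0 : 0 < sqn x by rewrite sqn_gt0.
  have cp (k : R) : {for sqn x, continuous (@powR R ^~ k)}.
    apply: differentiable_continuous; apply/derivable1_diffP.
    by case: (is_derive1_powR k s0).
  have cs : {for x, continuous sqn} by exact: continuous_sumsq.
  have ck (k : R) : {for x, continuous (fun x => sqn x `^ k)}.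
    by apply: (@continuous_comp _ _ _ sqn (@powR R ^~ k)); [exact: cs|exact: cp].
  have cG : {for x, continuous (fun x => F (sqn x `^ b))}.
    apply: (@continuous_comp _ _ _ (fun x => sqn x `^ b) F); first exact: ck.
    exact: csmooth_continuous.
  exact: (cvgM (ck c) cG).
Qed.

Lemma rsmooth_smooth f : rsmooth f -> smooth f.
Proof.
move=> rf s.
have H : rsmooth (foldr partial f s).
  elim: s => //= i s IH; have [f' rf' df] := rsmooth_partial i IH.
  rewrite (_ : partial i _ = f')//; apply/funext => x; rewrite /partial.
  by case: (df x).
split; first exact: rsmooth_continuous.
by move=> i x; have [f' _ df] := rsmooth_partial i H; case: (df x).
Qed.

End radial_test.

(** * Smoothed steps and their kernels *)

Section kernel.
Context {R : realType}.
Notation leb := (@lebesgue_measure R).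

Lemma flat1 (t : R) : 0 < t -> flat 1 t = expR (- t^-1).
Proof. by move=> t0; rewrite /flat t0 hornerE mul1r. Qed.

Lemma flat1_le0 (t : R) : t <= 0 -> flat 1 t = 0.
Proof. by move=> t0; rewrite /flat ltNge t0. Qed.

Lemma flat1_ge0 (t : R) : 0 <= flat 1 t.
Proof.
by have [t0|t0] := ltP 0 t; [rewrite flat1// expR_ge0|rewrite flat1_le0].
Qed.

Lemma flat1_le1 (t : R) : flat 1 t <= 1.
Proof.
have [t0|t0] := ltP 0 t; last by rewrite flat1_le0.
by rewrite flat1// expR_le1 oppr_le0 invr_ge0 ltW.
Qed.

Let bump (t : R) : R := flat 1 (1 * t + 1) * flat 1 (-1 * t + 1).

Let bump_csmooth : csmooth bump.
Proof. by apply: csmoothM; exact: csmooth_flat. Qed.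

Let bump_ge0 t : 0 <= bump t. Proof. by rewrite mulr_ge0 ?flat1_ge0. Qed.

Let bump_le1 t : bump t <= 1.
Proof. by rewrite mulr_ile1 ?flat1_ge0 ?flat1_le1. Qed.

Let bump_l (t : R) : t <= -1 -> bump t = 0.
Proof. by move=> t1; rewrite /bump flat1_le0 ?mul0r//; lra. Qed.

Let bump_r t : 1 <= t -> bump t = 0.
Proof. by move=> t1; rewrite /bump [X in _ * X]flat1_le0 ?mulr0//; lra. Qed.

Let bump_int : leb.-integrable setT (EFin \o bump).
Proof.
have E : bump = bump \_ (`[-1, 1]%classic : set R).
  apply/funext => t; rewrite patchE; case: ifPn => //.
  rewrite notin_setE/= in_itv/= => /negP; rewrite negb_and -!ltNge => /orP[t1|t1].
    by rewrite bump_l// ltW.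
  by rewrite bump_r// ltW.
rewrite E -restrict_EFin;
apply: (integrable_restrict leb (measurable_itv `[-1, 1]) measurableT (EFin \o bump)).1.
rewrite setTI; apply: continuous_compact_integrable; first exact: segment_compact.
by apply: continuous_subspaceT; exact: csmooth_continuous.
Qed.

Let P (t : R) : R := (\int[leb]_(x in `]-oo, t]) bump x)%R.

Let P_derive (t : R) : is_derive t 1 P (bump t).
Proof.
have h u : leb.-integrable `]-oo, u] (EFin \o bump).
  by apply: integrableS bump_int => //; exact: measurable_itv.
have [] := @continuous_FTC1 _ bump -oo%O t (t + 1) _ (h _) _ (@csmooth_continuous _ _ bump_csmooth t).
- by rewrite ltrDl.
- by rewrite ltNyr.
by move=> d1 d2; apply: DeriveDef; [exact: d1|rewrite -derive1E; exact: d2].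
Qed.

Let P_B (s t : R) : s <= t -> P t - P s = (\int[leb]_(x in `]s, t]) bump x)%R.
Proof.
move=> st; rewrite /P Rintegral_itvB//.
by apply: integrableS bump_int => //; exact: measurable_itv.
Qed.

Let P_nd (s t : R) : s <= t -> P s <= P t.
Proof.
by move=> st; rewrite -subr_ge0 P_B// Rintegral_ge0.
Qed.

Let P_l (t : R) : t <= -1 -> P t = 0.
Proof.
move=> t1; rewrite /P /Rintegral integral0_eq// => x /=; rewrite in_itv/= => xt.
by rewrite bump_l// (le_trans xt).
Qed.

Let P_r t : 1 <= t -> P t = P 1.
Proof.
move=> t1; apply/eqP; rewrite -subr_eq0 P_B//; apply/eqP.
rewrite /Rintegral integral0_eq// => x /=; rewrite in_itv/= => /andP[/ltW x1 _].
by rewrite bump_r.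
Qed.

(** If P 1 were 0, the monotone P would vanish identically, against P' = [bump] and the positive
    value of [bump] at 0. *)
Let P_gt0 : 0 < P 1.
Proof.
have P1_ge0 : 0 <= P 1 by rewrite -(@P_l (-1))// P_nd//; lra.
rewrite lt_def P1_ge0 andbT; apply/eqP => P10.
have P0 t : P t = 0.
  apply/eqP; rewrite eq_le; apply/andP; split.
    have [t1|/ltW t1] := leP 1 t; first by rewrite P_r// P10.
    by rewrite -P10 P_nd.
  have [t1|/ltW t1] := leP t (-1); first by rewrite P_l.
  by rewrite -(@P_l (-1))// P_nd.
have : is_derive (0 : R) 1 P 0.
  by rewrite (_ : P = cst (0 : R)); [exact: is_derive_cst|exact/funext].
move=> /(is_derive_uniq (P_derive 0)) /eqP; rewrite /bump !mulr0 !add0r flat1//.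
by rewrite mulf_eq0 expR_eq0.
Qed.

Lemma csmooth_affine (f : R -> R) (a b : R) : csmooth f -> csmooth (fun t => f (a * t + b)).
Proof.
elim=> [p a' b'|{}f g _ cf _ cg|{}f g _ cf _ cg|k {}f _ cf|{}f f' _ cf' df].
- rewrite (_ : (fun t => _) = (fun t => flat p ((a' * a) * t + (a' * b + b')))).
    exact: csmooth_flat.
  by apply/funext => t; congr flat; ring.
- exact: csmoothD.
- exact: csmoothM.
- exact: csmoothZ.
- apply: (csmooth_prim (csmoothZ a cf')) => t.
  have da : is_derive t 1 (fun t : R => a * t + b) a := is_derive_affine a b t.
  rewrite mulrC.
  exact: (@is_derive1_comp _ f (fun t => a * t + b) t _ _ (df _) da).
Qed.

(** Q is the normalized primitive of the bump rescaled to width e about s, and k is its derivative,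
    a kernel of mass 1 in the ball of radius e. That one L bounds k by L / e for all s and e lets
    Lebesgue points turn averages against k into point values. *)
Lemma smooth_step : exists L : R, forall s e : R, 0 < e ->
  exists Q k : R -> R,
  [/\ csmooth Q, csmooth k, forall t : R, is_derive t 1 Q (k t),
      forall t, 0 <= k t <= L / e &
   [/\ forall t : R, t <= s - e -> Q t = 0,
      forall t : R, s + e <= t -> Q t = 1,
      forall t, 0 <= Q t <= 1,
      forall t : R, ~ ball s e t -> k t = 0 &
      0 < s - e -> (\int[leb]_(t in pos) (k t)%:E = 1)%E]].
Proof.
exists ((P 1)^-1) => s e e0.
pose a := e^-1; pose b := - (s / e).
have abE t : a * t + b = (t - s) / e by rewrite /a /b; ring.
have cP : csmooth P := csmooth_prim bump_csmooth P_derive.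
pose Q t := (P 1)^-1 * P (a * t + b).
pose k t := (P 1)^-1 * (a * bump (a * t + b)).
have dQ (t : R) : is_derive t 1 Q (k t).
  apply: is_deriveZ.
  have da : is_derive t 1 (fun t : R => a * t + b) a := is_derive_affine a b t.
  rewrite mulrC.
  exact: (@is_derive1_comp _ P (fun t => a * t + b) t _ _ (P_derive _) da).
have ck : csmooth k by apply: csmoothZ; apply: csmoothZ; exact: csmooth_affine.
have kb (t : R) : ~ ball s e t -> k t = 0.
  rewrite /ball/= => /negP; rewrite -leNgt => h.
  suff b0 : bump (a * t + b) = 0 by rewrite /k b0 !mulr0.
  rewrite abE; have [st|/ltW ts] := leP s t.
    by rewrite bump_r// ler_pdivlMr// mul1r; rewrite distrC ger0_norm ?subr_ge0 in h.
  rewrite bump_l// ler_pdivrMr// mulN1r lerNr opprB.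
  by rewrite ger0_norm ?subr_ge0 in h.
have Ql (t : R) : t <= s - e -> Q t = 0.
  by move=> te; rewrite /Q (@P_l (a * t + b)) ?mulr0// abE ler_pdivrMr//; lra.
have Qr (t : R) : s + e <= t -> Q t = 1.
  by move=> te; rewrite /Q (@P_r (a * t + b)) ?mulVf ?gt_eqF// abE ler_pdivlMr//; lra.
exists Q, k; split => //; last split => //.
- by apply: csmoothZ; exact: csmooth_affine.
- move=> t; rewrite /k; apply/andP; split.
    by apply: mulr_ge0; [rewrite invr_ge0 ltW|apply: mulr_ge0; [rewrite invr_ge0 ltW|exact: bump_ge0]].
  apply: ler_wpM2l; first by rewrite invr_ge0 ltW.
  rewrite -[leRHS]mulr1; apply: ler_wpM2l; first by rewrite invr_ge0 ltW.
  exact: bump_le1.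
- move=> t; rewrite /Q mulr_ge0 ?invr_ge0 ?(ltW P_gt0)//=.
    rewrite mulrC ler_pdivrMr// mul1r.
    have [t1|/ltW t1] := leP 1 (a * t + b); first by rewrite (@P_r (a * t + b)).
    exact: P_nd.
  have [t1|/ltW t1] := leP (a * t + b) (-1); first by rewrite P_l.
  by rewrite -(@P_l (-1))// P_nd.
- move=> se.
  have -> : (\int[leb]_(t in pos) (k t)%:E = \int[leb]_(t in `[(s - e)%R, (s + e)%R]) (k t)%:E)%E.
    rewrite integral_mkcond [RHS]integral_mkcond; apply: eq_integral => t _.
    rewrite !patchE; have [tI|tI] := boolP (t \in (`[(s - e), (s + e)]%classic : set R)).
      rewrite mem_set//; move: tI; rewrite inE/= in_itv/= => /andP[h _].
      exact: lt_le_trans se h.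
    case: ifP => // _; congr EFin; apply: kb; rewrite /ball/= => h.
    move: tI => /negP; apply; rewrite inE/= in_itv/= -ler_distlC distrC.
    by rewrite distrC ltW// distrC.
  rewrite (@continuous_FTC2 _ k Q)//.
  + by rewrite (Ql (s - e))// (Qr (s + e))// -EFinB subr0.
  + lra.
  + apply: continuous_subspaceT; exact: csmooth_continuous.
  + have cQ : continuous Q.
      by apply: csmooth_continuous; apply: csmoothZ; exact: csmooth_affine.
    split; first by move=> t _; case: (dQ t).
      apply: cvg_at_right_filter; exact: cQ.
    apply: cvg_at_left_filter; exact: cQ.
  + by move=> t _; rewrite derive1E; case: (dQ t).
Qed.

End kernel.

Lemma measurable_patch d (T : measurableType d) (R : realType) (D : set T)
  (f : T -> \bar R) : measurable D -> measurable_fun D f ->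
  measurable_fun setT (f \_ D).
Proof. by move=> mD; exact: (measurable_restrictT f mD).1. Qed.

Section annulus.
Context {R : realType} {n : nat}.
Hypothesis n0 : (0 < n)%N.
Notation leb := (@lebesgue_measure R).
Notation mu := (@lebesgue_rV R n).

Definition annulus (a b : R) : set 'rV[R]_n := [set x | a <= enormX x <= b].

Lemma continuous_enormX : continuous (@enormX R n).
Proof.
move=> x; apply: (@continuous_comp _ _ _ (@enorm R n) (fun t : R => t ^+ n)).
  exact: continuous_enorm.
exact: exprn_continuous.
Qed.

Lemma closed_annulus a b : closed (annulus a b).
Proof.
rewrite (_ : annulus a b = (@enormX R n) @^-1` `[a, b]%classic); last first.
  by apply/seteqP; split => x /=; rewrite in_itv.
apply: closed_comp; last exact: interval_closed.
by move=> x _; exact: continuous_enormX.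
Qed.

Lemma measurable_annulus a b : measurable (annulus a b).
Proof.
rewrite (_ : annulus a b = setT `&` (@enormX R n) @^-1` `[a, b]%classic); last first.
  by apply/seteqP; split => x /=; rewrite in_itv //= => -[].
exact: measurable_enormX.
Qed.

Lemma compact_annulus a b : compact (annulus a b).
Proof.
pose M := Num.max 1 b.
pose I := `[- M, M]%classic : set R.
apply: (@subclosed_compact _ _ [set x : 'rV[R]_n | forall i, I (x ord0 i)]).
- exact: closed_annulus.
- by apply: (@rV_compact _ _ (fun=> I)) => _; exact: segment_compact.
- move=> x /andP[_ xb] i; rewrite /I/= in_itv/= -ler_norml.
  apply: le_trans (coord_le_enorm _ _) _; rewrite /M le_max.
  have [//|/ltW x1] := leP (enorm x) 1.
  rewrite (le_trans _ xb)// /enormX; case: (n) n0 x x1 {xb i} => // k _ x x1.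
  by rewrite exprS ler_peMr ?enorm_ge0// exprn_ege1.
Qed.

Lemma annulus_punctured a b : 0 < a -> annulus a b `<=` punctured.
Proof.
move=> a0 x /andP[ax _]; rewrite /punctured/= -enormX_gt0//.
exact: lt_le_trans ax.
Qed.

Lemma Lp_loc1_integrable (f : 'rV[R]_n -> R) a b : 0 < a -> Lp_loc punctured 1 f ->
  mu.-integrable (annulus a b) (EFin \o f).
Proof.
move=> a0 [mf hf]; apply/integrableP; split.
  apply/measurable_EFinP; apply: measurable_funS mf; first exact: measurable_punctured.
  exact: annulus_punctured.
have := hf _ (@compact_annulus a b) (annulus_punctured a0).
by under eq_integral do rewrite powRr1//.
Qed.

(** h is bounded on the compact annulus that carries it, so the product is dominated by a multiple
    of f restricted there. *)
Lemma integrable_loc_mul (f h : 'rV[R]_n -> R) a b : 0 < a ->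
  Lp_loc punctured 1 f -> continuous h -> (forall x, ~ annulus a b x -> h x = 0) ->
  mu.-integrable punctured (EFin \o (fun x => f x * h x)).
Proof.
move=> a0 lf ch h0.
have mP : measurable (@punctured R n) by exact: measurable_punctured.
have fi := Lp_loc1_integrable b a0 lf.
have [M hM] : exists M, forall x, annulus a b x -> `|h x| <= M.
  have : bounded_set (h @` annulus a b).
    apply: compact_bounded; apply: continuous_compact; last exact: compact_annulus.
    exact: continuous_subspaceT.
  move=> [M [_ hM]]; exists (M + 1) => x ax; apply: (hM (M + 1)); last by exists x.
  by rewrite ltrDl.
have fi2 : mu.-integrable punctured (fun x => M%:E * ((EFin \o f) \_ (annulus a b)) x)%E.
  apply: integrableZl => //.
  apply: (integrable_restrict mu (measurable_annulus a b) mP (EFin \o f)).1.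
  rewrite setIidr//; exact: annulus_punctured.
apply: le_integrable fi2 => //.
  apply/measurable_EFinP; apply: measurable_funM; first by case: lf.
  by apply: measurable_funTS; exact: continuous_measurable_rV.
move=> x px /=; rewrite patchE; case: ifPn => [|ax].
  rewrite inE => ax; rewrite lee_fin !normrM mulrC ler_wpM2r//.
  exact: le_trans (hM _ ax) (ler_norm _).
rewrite h0 ?mulr0 ?mule0 ?abse0 ?normr0//.
by move=> /mem_set; rewrite (negbTE ax).
Qed.

End annulus.

Section key.
Context {R : realType} {n : nat}.
Hypothesis n0 : (0 < n)%N.
Notation leb := (@lebesgue_measure R).
Notation mu := (@lebesgue_rV R n).

Let b : R := n%:R / 2.

Lemma enormXE (x : 'rV[R]_n) : enormX x = sqn x `^ b.
Proof. by rewrite /b sqn_powR. Qed.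

(* x |x|^-n psi(|x|^n), whose divergence is n psi'(|x|^n). *)
Definition test_field (psi : R -> R) (i : 'I_n) (x : 'rV[R]_n) : R :=
  x ord0 i * (sqn x `^ (- b) * psi (sqn x `^ b)).

Lemma test_field_norm psi i x : `|psi (enormX x)| <= 1 ->
  `|test_field psi i x| <= enorm x / enormX x.
Proof.
move=> p1; rewrite /test_field normrM powRN -enormXE.
apply: ler_pM => //; first exact: coord_le_enorm.
by rewrite normrM ger0_norm ?invr_ge0 ?enormX_ge0// ler_piMr ?invr_ge0 ?enormX_ge0.
Qed.

Lemma test_field_test (psi : R -> R) (a c : R) i : 0 < a -> csmooth psi ->
  (forall t, t < a -> psi t = 0) -> (forall t, c < t -> psi t = 0) ->
  [/\ test_function punctured (test_field psi i),
      continuous (test_field psi i),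
      continuous (partial i (test_field psi i)) &
      (forall x, ~ annulus a c x -> test_field psi i x = 0) /\
      (forall x, ~ annulus a c x -> partial i (test_field psi i) x = 0)].
Proof.
move=> a0 cpsi psi_l psi_r.
have rs : rsmooth (test_field psi i).
  by apply: rsmoothM; [exact: rsmooth_coord|exact: (rsmooth_rad _ a0)].
have sm := rsmooth_smooth n0 rs.
have z x : ~ annulus a c x -> test_field psi i x = 0.
  rewrite /annulus/= => /negP; rewrite negb_and -!ltNge enormXE => /orP[h|h].
    by rewrite /test_field psi_l// !mulr0.
  by rewrite /test_field psi_r// !mulr0.
split => //.
- split => //; exists (annulus a c); split => //.
    exact: compact_annulus.
  exact: annulus_punctured.
- by have [] := sm [::].
- by have [] := sm [:: i].
- split => // x nx.
  suff : is_derive x (delta_mx ord0 i) (test_field psi i) 0 by case.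
  apply: is_derive_near0.
  have : open (~` (annulus a c : set 'rV[R]_n)) by rewrite openC; exact: closed_annulus.
  by move=> oA; apply: (filterS z); exact: open_nbhs_nbhs.
Qed.

(** The field x |x|^-n is divergence-free off the origin: with b = n/2, the n terms |x|^-n psi
    cancel against -2 b |x|^-n psi, and only the derivative of psi survives. *)
Lemma test_field_div (psi psi' : R -> R) (a : R) x : 0 < a -> x != 0 ->
  (forall t : R, is_derive t 1 psi (psi' t)) -> (forall t, t < a -> psi t = 0) ->
  \sum_i partial i (test_field psi i) x = n%:R * psi' (enormX x).
Proof.
move=> a0 x0 dpsi psi_l.
have s0 : 0 < sqn x by rewrite sqn_gt0.
have S1 : sqn x `^ (- b) = sqn x * sqn x `^ (- b - 1).
  rewrite powRB ?(gt_eqF s0) ?implybT// powRr1 ?ltW// mulrCA mulfV ?mulr1//.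
  by rewrite gt_eqF.
have S2 : 1 = sqn x * sqn x `^ (- b + b - 1).
  by rewrite addNr sub0r powR_inv1 ?ltW// mulfV// gt_eqF.
rewrite (eq_bigr (fun i => sqn x `^ (- b) * psi (enormX x) + x ord0 i ^+ 2 *
   (2 * (- b * (sqn x `^ (- b - 1) * psi (enormX x)) +
       b * (sqn x `^ (- b + b - 1) * psi' (enormX x)))))).
  rewrite big_split/= -[X in _ + X]mulr_suml -/(sqn x) sumr_const card_ord.
  rewrite -[X in X + _]mulr_natl.
  have b2 : n%:R = 2 * b by rewrite /b mulrCA mulfV ?mulr1.
  rewrite b2 S1; transitivity (2 * b * ((sqn x * sqn x `^ (- b + b - 1)) * psi' (enormX x))).
    ring.
  by rewrite -S2 mul1r.
move=> i _; rewrite /partial.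
have h1 := is_derive_rad n0 (- b) i x a0 dpsi psi_l.
have h2 : is_derive x (delta_mx ord0 i) (test_field psi i) _ :=
  is_deriveM (is_derive_coord i x _) h1.
case: h2 => _ ->; rewrite /GRing.scale/= mxE !eqxx mulr1 -/b -enormXE; ring.
Qed.

Variables (u : 'rV[R]_n -> R) (g : 'rV[R]_n -> 'rV[R]_n).
Hypothesis lu : Lp_loc punctured 1 u.
Hypothesis dg : distr_gradient punctured u g.

(** The distributional identity is summed over the n components of the field. The factor n of the
    divergence cancels against the n pointwise bounds |g_i| |x_i| |x|^-n <= |g| |x|^(1-n). *)
Lemma test_radial (psi psi' : R -> R) (a c : R) : 0 < a -> csmooth psi ->
  (forall t : R, is_derive t 1 psi (psi' t)) -> csmooth psi' ->
  (forall t, t < a -> psi t = 0) -> (forall t, c < t -> psi t = 0) ->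
  (forall t, `|psi t| <= 1) ->
  (`| \int[mu]_(x in punctured) (u x * psi' (enormX x))%:E | <=
     \int[mu]_(x in annulus a c) (enorm (g x) * (enorm x / enormX x))%:E)%E.
Proof.
move=> a0 cpsi dpsi cpsi' psi_l psi_r psi1.
have mP : measurable (@punctured R n) by exact: measurable_punctured.
have T i := test_field_test i a0 cpsi psi_l psi_r.
pose F i x := (u x * partial i (test_field psi i) x)%:E.
pose G i x := (g x ord0 i * test_field psi i x)%:E.
have Fi i : mu.-integrable punctured (F i).
  have [_ _ cp [_ h]] := T i; exact: (integrable_loc_mul n0 a0 lu cp h).
have Gi i : mu.-integrable punctured (G i).
  have [_ cp _ [h _]] := T i; have [lg _] := dg i.
  exact: (integrable_loc_mul n0 a0 lg cp h).
have E : (\int[mu]_(x in punctured) (\sum_i F i x) =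
          - \int[mu]_(x in punctured) (\sum_i G i x))%E.
  rewrite integral_sum// integral_sum// -sumeN; last first.
    by move=> i j _ _; apply: fin_num_adde_defr; exact: integrable_fin_num.
  by apply: eq_bigr => i _; have [_ ->//] := dg i; case: (T i).
have nn0 : (0 < n%:R :> R) by rewrite ltr0n.
have E1 : (\int[mu]_(x in punctured) (\sum_i F i x) =
   n%:R%:E * \int[mu]_(x in punctured) (u x * psi' (enormX x))%:E)%E.
  rewrite -integralZl//.
    apply: eq_integral => x; rewrite inE => px.
    by rewrite /F sumEFin -mulr_sumr (test_field_div a0 px dpsi psi_l) -EFinM mulrCA.
  have cp : continuous (fun x => psi' (@enormX R n x)).
    move=> x; apply: (@continuous_comp _ _ _ (@enormX R n) psi').
      exact: continuous_enormX.
    exact: csmooth_continuous.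
  apply: (integrable_loc_mul n0 a0 lu cp (b := c)) => x.
  rewrite /annulus/= => /negP; rewrite negb_and -!ltNge => /orP[h|h].
    exact: (derive_near_cst dpsi psi_l).
  apply: (is_derive_uniq (dpsi _)); apply: is_derive_near0.
  by near=> t; apply: psi_r; near: t; exact: lt_nbhsr.
have mg i : measurable_fun punctured (fun x => g x ord0 i) by case: (dg i) => -[].
have men : measurable_fun punctured (fun x => enorm (g x)).
  apply: (measurableT_comp (continuous_measurable_fun (@sqrt_continuous R))).
  by apply: measurable_sum => i; exact: measurable_funX.
have mK : measurable_fun punctured
    (fun x => (enorm (g x) * (enorm x / enormX x))%:E).
  apply/measurable_EFinP; apply: measurable_funM => //.
  apply: measurable_funTS; apply: measurable_funM; first exact: measurable_enorm.
  under eq_fun do rewrite -powR_inv1 ?enormX_ge0//.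
  by apply: (measurableT_comp (measurable_powR _)); exact: measurable_enormX.
have mG : measurable_fun punctured (fun x => (\sum_i G i x)%E).
  by apply: (@measurable_int _ _ _ mu); apply: integrable_sum.
have : (`| \int[mu]_(x in punctured) (\sum_i G i x) | <=
  n%:R%:E * \int[mu]_(x in annulus a c) (enorm (g x) * (enorm x / enormX x))%:E)%E.
  apply: le_trans (le_abse_integral _ mP mG) _.
  rewrite -ge0_integralZl//; last 3 first.
  - exact: measurable_annulus.
  - by apply: measurable_funS mK => //; exact: annulus_punctured.
  - by move=> x _; rewrite lee_fin mulr_ge0 ?enorm_ge0// divr_ge0 ?enorm_ge0 ?enormX_ge0.
  rewrite integral_mkcond [leRHS]integral_mkcond.
  apply: ge0_le_integral => //.
  - by move=> x _; rewrite patchE; case: ifP.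
  - apply: measurable_patch => //; exact: measurableT_comp mG.
  - apply: measurable_patch; first exact: measurable_annulus.
    apply: measurable_funeM; apply: measurable_funS mK => //; exact: annulus_punctured.
  - move=> x _; rewrite !patchE; case: ifPn => [px|].
      case: ifPn => [_|ax]; last first.
        rewrite /G big1 ?abse0// => i _.
        have [_ _ _ [-> ]] := T i; first by rewrite mulr0.
        by move=> /mem_set; rewrite (negbTE ax).
      rewrite /G sumEFin -EFinM abse_EFin lee_fin (le_trans (ler_norm_sum _ _ _))//.
      rewrite -[X in X%:R * _]card_ord mulr_natl -sumr_const; apply: ler_sum => i _.
      rewrite normrM; apply: ler_pM => //; first exact: coord_le_enorm.
      exact: test_field_norm.
    move=> px; case: ifPn => // _.
    by rewrite -EFinM lee_fin mulr_ge0// mulr_ge0 ?enorm_ge0// divr_ge0 ?enorm_ge0 ?enormX_ge0.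
have -> : (\int[mu]_(x in punctured) (\sum_i G i x) = - \int[mu]_(x in punctured) (\sum_i F i x))%E.
  by rewrite E oppeK.
rewrite abseN E1 abseM gee0_abs ?lee_fin//.
by rewrite lee_pmul2l// lte_fin.
Unshelve. all: by end_near. Qed.

End key.

(** * Oscillation of the profile *)

Section lebesgue_points.
Context {R : realType}.
Notation leb := (@lebesgue_measure R).

(** v is integrable only away from 0 and infinity, so the differentiation theorem is applied to its
    truncations to [1/(k+1), k+1], and the countably many exceptional sets are united. *)
Lemma lebesgue_points_pos (v : R -> R) :
  (forall a b : R, 0 < a -> leb.-integrable `[a, b] (EFin \o v)) ->
  exists2 Z : set R, leb.-negligible Z &
    forall s, 0 < s -> ~ Z s -> forall eps, 0 < eps ->
    \forall e \near 0^'+,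
      (\int[leb]_(t in ball s e) (`|v t - v s|)%:E <= (eps * e)%:E)%E.
Proof.
move=> vi.
pose I k := `[k.+1%:R^-1, k.+1%:R]%classic : set R.
pose vk k := v \_ (I k).
have Lk k : {ae leb, forall x, lebesgue_pt (vk k) x}.
  apply: lebesgue_differentiation; apply: open_integrable_locally => //.
    exact: openT.
  rewrite /vk -restrict_EFin.
  apply: (integrable_restrict leb (measurable_itv _) measurableT (EFin \o v)).1.
  by rewrite setTI; apply: vi; rewrite invr_gt0.
exists (\bigcup_k ~` [set x | lebesgue_pt (vk k) x]).
  by apply: negligible_bigcup => k; exact: Lk.
move=> s s0 Zs eps eps0.
pose k := Num.truncn (Num.max s s^-1).
have hk : Num.max s s^-1 < k.+1%:R by exact: truncnS_gt.
move: hk; rewrite gt_max => /andP[sk1 sk2].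
have sk3 : k.+1%:R^-1 < s by rewrite -[s]invrK ltf_pV2 ?posrE ?invr_gt0 ?ltr0n.
have Lp : lebesgue_pt (vk k) s.
  by apply: contrapT => h; apply: Zs; exists k.
pose d := Num.min (s - k.+1%:R^-1) (k.+1%:R - s).
have d0 : 0 < d by rewrite lt_min !subr_gt0 sk3.
(* Half of eps, because the ball of radius e has length 2 e. *)
have e20 : 0 < eps / 2 by rewrite divr_gt0.
have H : \forall e \near 0^'+, (davg (vk k) s e < (eps / 2)%:E)%E.
  have /fine_cvgP[fin /cvgrPdist_lt /(_ _ e20) hlt] := Lp.
  apply: filterS2 fin hlt => e fe; rewrite sub0r normrN => h.
  by rewrite -(fineK fe) lte_fin; exact: le_lt_trans (ler_norm _) h.
near=> e.
have e0 : 0 < e by [].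
have ed : e < d by near: e; exact: nbhs_right_lt.
have He : (davg (vk k) s e < (eps / 2)%:E)%E by near: e.
have bI t : ball s e t -> vk k t = v t.
  rewrite /ball/= => st; rewrite /vk patchE mem_set// /I/= in_itv/=.
  have := lt_trans st ed; rewrite distrC lt_min !ltr_distl subKr subrKC.
  by move=> /andP[/andP[/ltW -> _] /andP[_ /ltW ->]].
move: He; rewrite /davg /iavg (lebesgue_measure_ball _ (ltW e0)).
have -> : (\int[leb]_(y in ball s e) `|((center (vk k s) \o vk k) y)%:E| =
    \int[leb]_(t in ball s e) (`|v t - v s|)%:E)%E.
  apply: eq_integral => t; rewrite inE => st /=.
  by rewrite (bI t st) (bI s (ballxx _ e0)).
move=> /ltW; set J := integral _ _ _.
have J0 : (0 <= J)%E by apply: integral_ge0.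
have e2 : (0 < e *+ 2) by rewrite mulrn_wgt0.
rewrite inver gt_eqF// lee_pdivrMl// => h.
have -> : eps * e = (e *+ 2) * (eps / 2) by rewrite -mulr_natl; field.
by rewrite EFinM.
Unshelve. all: by end_near. Qed.

End lebesgue_points.

Section key_estimate.
Context {R : realType} {n : nat}.
Hypothesis n0 : (0 < n)%N.
Notation leb := (@lebesgue_measure R).
Notation mu := (@lebesgue_rV R n).
Variables (u : 'rV[R]_n -> R) (g : 'rV[R]_n -> 'rV[R]_n) (v : R -> R).
Hypothesis lu : Lp_loc punctured 1 u.
Hypothesis mv : measurable_fun setT v.
Hypothesis uv : {ae mu, forall x, u x = v (enormX x)}.
Let mP : measurable (@punctured R n). Proof. exact: measurable_punctured. Qed.

Lemma polar_integral_punctured (f : R -> \bar R) : measurable_fun setT f ->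
  (forall s, 0 <= f s)%E -> f 0 = 0%E ->
  (\int[mu]_(x in punctured) f (enormX x) =
   (ball_vol n)%:E * \int[leb]_(s in pos) f s)%E.
Proof.
move=> mf f0 f00; rewrite -polar_integral// integral_mkcond.
apply: eq_integral => x _; rewrite patchE; case: ifPn => // h.
have -> : enormX x = 0; last by [].
apply/eqP; rewrite eq_le enormX_ge0 andbT leNgt enormX_gt0//.
by move: h; apply: contra => h; rewrite inE.
Qed.

Lemma profile_integrable a b : 0 < a -> leb.-integrable `[a, b] (EFin \o v).
Proof.
move=> a0; apply/integrableP; split.
  by apply/measurable_EFinP; exact: measurable_funTS.
have /integrableP[mu_ ] := Lp_loc1_integrable n0 b a0 lu.
pose f := (fun s => `|v s|%:E) \_ (`[a, b]%classic : set R).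
have mf : measurable_fun setT f.
  apply: measurable_patch => //.
  by apply: measurable_funTS; apply/measurable_EFinP; exact: measurableT_comp.
have f0 s : (0 <= f s)%E by rewrite /f patchE; case: ifP.
have f00 : f 0 = 0%E.
  rewrite /f patchE; case: ifPn => //; rewrite inE/= in_itv/= => /andP[].
  by rewrite leNgt a0.
have -> : (\int[mu]_(x in annulus a b) `|(EFin \o u) x| =
    (ball_vol n)%:E * \int[leb]_(s in pos) f s)%E.
  rewrite -polar_integral// integral_mkcond; apply: ae_eq_integral => //.
  - apply: measurable_patch; first exact: measurable_annulus.
    exact: measurableT_comp mu_.
  - apply: (measurableT_comp mf); exact: measurable_enormX.
  - apply: filterS uv => x ux _; rewrite /f !patchE.
    have -> : (x \in annulus a b) = (enormX x \in (`[a, b]%classic : set R)).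
      by apply/idP/idP; rewrite !inE/= ?in_itv.
    by case: ifP => //= _; rewrite ux.
have -> : (\int[leb]_(s in pos) f s = \int[leb]_(x in `[a, b]) `|(EFin \o v) x|)%E.
  rewrite integral_mkcond [RHS]integral_mkcond; apply: eq_integral => s _.
  rewrite /f !patchE; case: ifPn => [//|]; case: ifPn => //.
  rewrite inE/= in_itv/= => /andP[h _] /negP; rewrite inE; case.
  exact: lt_le_trans h.
move=> h; rewrite ltNge leye_eq; apply/negP => /eqP E.
by move: h; rewrite E gt0_muley ?lte_fin ?ball_vol_gt0.
Qed.

(** In polar coordinates the integral of u against k(|x|^n) is [ball_vol n] times the k-average of
    v. As k has mass 1, subtracting v s leaves an error of at most sup k times the integral of |v -
    v s| over the ball. *)
Lemma kernel_average (s e L : R) (k : R -> R) : 0 < s - e -> csmooth k ->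
  (forall t, 0 <= k t <= L / e) -> (forall t : R, ~ ball s e t -> k t = 0) ->
  (\int[leb]_(t in pos) (k t)%:E = 1)%E ->
  mu.-integrable punctured (EFin \o (fun x => u x * k (enormX x))) /\
  ((`| (\int[mu]_(x in punctured) (u x * k (enormX x)))%R - ball_vol n * v s |)%:E <=
   (ball_vol n * (L / e))%:E * \int[leb]_(t in ball s e) (`|v t - v s|)%:E)%E.
Proof.
move=> se ck kL kb k1.
have k0 t : 0 <= k t by case/andP: (kL t).
have mk : measurable_fun setT k by exact: continuous_measurable_fun (csmooth_continuous ck).
have ckX : continuous (fun x => k (@enormX R n x)).
  move=> x; apply: (@continuous_comp _ _ _ (@enormX R n) k).
    exact: continuous_enormX.
  exact: csmooth_continuous.
have nb t : ~ (s - e <= t <= s + e) -> k t = 0.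
  move=> h; apply: kb => /ltW; rewrite distrC ler_distl => h'; exact: h.
have kz : k 0 = 0.
  by apply: nb => /andP[]; rewrite leNgt se.
have I1 : mu.-integrable punctured (EFin \o (fun x => u x * k (enormX x))).
  by apply: (integrable_loc_mul n0 se lu ckX (b := s + e)) => x; exact: nb.
split => //.
have E2 : (\int[mu]_(x in punctured) (k (enormX x))%:E = (ball_vol n)%:E)%E.
  rewrite (polar_integral_punctured (f := EFin \o k))//= ?k1 ?mule1 ?kz//.
  exact/measurable_EFinP.
have mkX : measurable_fun punctured (fun x => k (@enormX R n x)).
  by apply: measurable_funTS; exact: continuous_measurable_rV.
have I2 : mu.-integrable punctured (EFin \o (fun x => k (enormX x))).
  apply/integrableP; split; first exact/measurable_EFinP.
  under eq_integral do rewrite /= ger0_norm//.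
  by rewrite E2 ltry.
have I3 : mu.-integrable punctured (EFin \o (fun x => v s * k (enormX x))).
  exact: (integrableZl mP (v s) I2).
have -> : ball_vol n * v s = (\int[mu]_(x in punctured) (v s * k (enormX x)))%R.
  by rewrite RintegralZl// /Rintegral E2 mulrC.
rewrite -RintegralB//.
have I4 := integrableB mP I1 I3.
apply: (@le_trans _ _ (\int[mu]_(x in punctured) (`|u x * k (enormX x) - v s * k (enormX x)|)%:E)%E).
  have := @le_normr_Rintegral _ _ _ mu punctured (fun x => u x * k (enormX x) - v s * k (enormX x)) mP.
  move=> /(_ I4); rewrite -lee_fin => h; apply: le_trans h _.
  rewrite /Rintegral fineK//; apply: integrable_fin_num => //.
  exact: (integrable_norm I4).
pose F t := (`|v t - v s| * k t)%:E.
have mF : measurable_fun setT F.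
  apply/measurable_EFinP; apply: measurable_funM => //.
  by apply: measurableT_comp => //; exact: measurable_funB.
have -> : (\int[mu]_(x in punctured) (`|u x * k (enormX x) - v s * k (enormX x)|)%:E =
    \int[mu]_(x in punctured) (F (enormX x)))%E.
  apply: ae_eq_integral => //.
- by case/integrableP: (integrable_norm I4).
- by apply: measurable_funTS; apply: (measurableT_comp mF); exact: measurable_enormX.
- apply: filterS uv => x ux _ /=.
  by rewrite /F ux -mulrBl normrM [X in _ * X]ger0_norm.
rewrite (polar_integral_punctured (f := F))//; last 2 first.
- by move=> t; rewrite lee_fin mulr_ge0.
- by rewrite /F kz mulr0.
rewrite EFinM -muleA lee_pmul2l ?lte_fin ?ball_vol_gt0//.
have Le : 0 <= L / e by case/andP: (kL 0) => /le_trans h /h.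
rewrite -ge0_integralZl//; last 2 first.
- exact: measurable_ball.
- by apply: measurable_funTS; apply/measurable_EFinP; apply: measurableT_comp => //; exact: measurable_funB.
rewrite [leLHS]integral_mkcond [leRHS]integral_mkcond.
apply: (@ge0_le_integral _ _ R leb setT measurableT).
- by move=> t _; rewrite patchE; case: ifP => // _; rewrite lee_fin mulr_ge0.
- by apply: measurable_patch; [exact: measurable_pos|exact: measurable_funTS].
- apply: measurable_patch; first exact: measurable_ball.
  apply: measurable_funTS; apply: measurable_funeM; apply/measurable_EFinP.
  by apply: measurableT_comp => //; exact: measurable_funB.
- move=> t _; rewrite !patchE; case: ifP => _; case: ifPn => tb //.
  + by rewrite /F -EFinM lee_fin mulrC ler_wpM2r//; case/andP: (kL t).
  + rewrite /F kb ?mulr0// => /mem_set; by rewrite (negbTE tb).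
  + by rewrite -EFinM lee_fin mulr_ge0.
Qed.

Hypothesis dg : distr_gradient punctured u g.

(* psi is the difference of smoothed steps at s1 and s2, so that psi' tests u against
   approximations of the point masses at s1 and s2. *)
Lemma key_estimate : exists2 Z : set R, leb.-negligible Z &
  forall s1 s2 d : R, ~ Z s1 -> ~ Z s2 -> s1 < s2 -> 0 < d < s1 ->
  ((ball_vol n * `|v s1 - v s2|)%:E <=
   \int[mu]_(x in annulus (s1 - d) (s2 + d)) (enorm (g x) * (enorm x / enormX x))%:E)%E.
Proof.
have [Z Z0 hZ] := lebesgue_points_pos profile_integrable.
have [L hL] := @smooth_step R.
have L0 : 0 <= L.
  have [Q [k [_ _ _ kL _]]] := hL 0 1 ltr01.
  by case/andP: (kL 0); rewrite divr1; exact: le_trans.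
exists Z => // s1 s2 d Zs1 Zs2 s12 /andP[d0 ds1].
have s10 : 0 < s1 by exact: lt_trans ds1.
have s20 : 0 < s2 by exact: lt_trans s12.
set J := integral _ _ _.
apply/lee_addgt0Pr => eps eps0.
have w0 := ball_vol_gt0 (R := R) n0.
(* Makes each of the two errors [ball_vol n] (L / e) (ep e) at most eps / 2; L + 1 in place of L
   keeps the denominator positive. *)
pose ep := eps / (2 * (ball_vol n * (L + 1))).
have L1 : 0 < L + 1 by rewrite ltr_wpDl.
have D0 : 0 < 2 * (ball_vol n * (L + 1)) by rewrite mulr_gt0// mulr_gt0.
have ep0 : 0 < ep by rewrite divr_gt0.
have [e [e0 ed h1 h2]] : exists e : R, [/\ 0 < e, e < d,
   (\int[leb]_(t in ball s1 e) (`|v t - v s1|)%:E <= (ep * e)%:E)%E &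
   (\int[leb]_(t in ball s2 e) (`|v t - v s2|)%:E <= (ep * e)%:E)%E].
  have n1 := hZ _ s10 Zs1 _ ep0; have n2 := hZ _ s20 Zs2 _ ep0.
  near (0 : R)^'+ => e; exists e; split => //.
  - by near: e.
  - by near: e.
have [Q1 [k1 [cQ1 ck1 dQ1 kL1 [Ql1 Qr1 Qb1 kb1 ki1]]]] := hL s1 e e0.
have [Q2 [k2 [cQ2 ck2 dQ2 kL2 [Ql2 Qr2 Qb2 kb2 ki2]]]] := hL s2 e e0.
have se1 : 0 < s1 - e by lra.
have se2 : 0 < s2 - e by lra.
have [I1 A1] := kernel_average se1 ck1 kL1 kb1 (ki1 se1).
have [I2 A2] := kernel_average se2 ck2 kL2 kb2 (ki2 se2).
pose psi t := Q1 t + (-1) * Q2 t.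
pose psi' t := k1 t + (-1) * k2 t.
have dpsi (t : R) : is_derive t 1 psi (psi' t).
  by apply: is_deriveD; exact: is_deriveZ.
have cpsi : csmooth psi by apply: csmoothD => //; exact: csmoothZ.
have cpsi' : csmooth psi' by apply: csmoothD => //; exact: csmoothZ.
have sd : 0 < s1 - d by lra.
have psi_l (t : R) : t < s1 - d -> psi t = 0.
  move=> td; have t1 : t <= s1 - e by lra.
  have t2 : t <= s2 - e by lra.
  by rewrite /psi (Ql1 _ t1) (Ql2 _ t2) mulr0 addr0.
have psi_r (t : R) : s2 + d < t -> psi t = 0.
  move=> td; have t1 : s1 + e <= t by lra.
  have t2 : s2 + e <= t by lra.
  by rewrite /psi (Qr1 _ t1) (Qr2 _ t2) mulr1 subrr.
have psi1 (t : R) : `|psi t| <= 1.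
  by have := Qb1 t; have := Qb2 t; rewrite /psi ler_norml; lra.
have := test_radial n0 lu dg sd cpsi dpsi cpsi' psi_l psi_r psi1; rewrite -/J.
have -> : (\int[mu]_(x in punctured) (u x * psi' (enormX x))%:E =
   ((\int[mu]_(x in punctured) (u x * k1 (enormX x)))%R -
    (\int[mu]_(x in punctured) (u x * k2 (enormX x)))%R)%:E)%E.
  rewrite -RintegralB// /Rintegral fineK; last first.
    exact: (integrable_fin_num mP (integrableB mP I1 I2)).
  by apply: eq_integral => x _; rewrite /psi' mulN1r mulrBr.
move: A1 A2; set a1 := (\int[mu]_(x in _) _)%R; set a2 := (\int[mu]_(x in _) _)%R.
move=> A1 A2 A3.
have B (i : R) (J1 : \bar R) : (i%:E <= (ball_vol n * (L / e))%:E * J1 -> J1 <= (ep * e)%:E -> i%:E <= (eps / 2)%:E)%E.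
  move=> h h'; apply: le_trans h _.
  apply: (@le_trans _ _ ((ball_vol n * (L / e))%:E * (ep * e)%:E)%E).
    apply: lee_wpmul2l => //; rewrite lee_fin; apply: mulr_ge0; first exact: ltW.
    by apply: divr_ge0 => //; exact: ltW.
  rewrite -EFinM lee_fin.
  have -> : ball_vol n * (L / e) * (ep * e) = ball_vol n * L * ep.
    by field; rewrite gt_eqF.
  apply: (@le_trans _ _ (ball_vol n * (L + 1) * ep)).
    by rewrite ler_pM2r// ler_pM2l// lerDl.
  rewrite /ep; have w1 := lt0r_neq0 w0.
  have w2 := lt0r_neq0 L1.
  rewrite le_eqVlt; apply/orP; left; apply/eqP; field; by rewrite w1 w2.
have {}A1 := B _ _ A1 h1; have {}A2 := B _ _ A2 h2.
case: (J) A3 => [j||]; last 2 first.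
- by move=> _; rewrite addye// leey.
- by rewrite leeNy_eq.
move: A1 A2 => + + A3; move: A3; rewrite -EFinD abse_EFin !lee_fin => A3 A1 A2.
rewrite -[X in X * `|_|]gtr0_norm// -normrM mulrBr.
have -> : ball_vol n * v s1 - ball_vol n * v s2 =
  (a1 - a2) - (a1 - ball_vol n * v s1) + (a2 - ball_vol n * v s2) by ring.
apply: le_trans (ler_normD _ _) _; apply: le_trans (lerD (ler_normB _ _) (lexx _)) _.
lra.
Unshelve. all: by end_near. Qed.

End key_estimate.

(** * Hoelder continuity from the local energy *)

Section hoelder.
Context {R : realType} {n : nat}.
Hypothesis n0 : (0 < n)%N.
Notation leb := (@lebesgue_measure R).
Notation mu := (@lebesgue_rV R n).

(** Half-open, unlike [annulus], so that consecutive dyadic shells are disjoint and their energies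
    add. *)
Definition shell (a b : R) : set 'rV[R]_n := [set x | a <= enormX x < b].

Lemma measurable_shell a b : measurable (shell a b).
Proof.
rewrite (_ : shell a b = setT `&` (@enormX R n) @^-1` `[a, b[%classic); last first.
  by apply/seteqP; split => x /=; rewrite in_itv //= => -[].
exact: measurable_enormX.
Qed.

Lemma measure_annulus a b : 0 < a -> a <= b ->
  (mu (annulus a b) <= (ball_vol n * (b - a))%:E)%E.
Proof.
move=> a0 ab.
rewrite (_ : annulus a b = (@enormX R n) @^-1` `[a, b]%classic); last first.
  by apply/seteqP; split => x /=; rewrite in_itv.
rewrite [leLHS](polar_measure n0 (measurable_itv _)).
rewrite EFinM lee_pmul2l// ?lte_fin ?ball_vol_gt0//.
apply: (@le_trans _ _ (leb `[a, b]%classic)).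
  apply: le_measure; rewrite ?inE; [|exact: measurable_itv|by move=> t []].
  by apply: measurableI; [exact: measurable_itv|exact: measurable_pos].
by rewrite lebesgue_measure_itv/= lte_fin; case: ifPn => // _; rewrite lee_fin subr_ge0.
Qed.

Variables (g : 'rV[R]_n -> 'rV[R]_n) (p al : R).
Hypothesis p1 : 1 <= p.
Hypothesis mg : forall i, measurable_fun punctured (fun x => g x ord0 i).

Let y x := enorm x `^ al * enorm (g x).

Definition energy (a b : R) : \bar R := (\int[mu]_(x in shell a b) (y x `^ p)%:E)%E.

Lemma measurable_enorm_grad : measurable_fun punctured (fun x => enorm (g x)).
Proof.
apply: (measurableT_comp (continuous_measurable_fun (@sqrt_continuous R))).
by apply: measurable_sum => i; exact: measurable_funX.
Qed.

Lemma measurable_weighted_grad : measurable_fun punctured y.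
Proof.
apply: measurable_funM; last exact: measurable_enorm_grad.
apply: measurable_funTS.
by apply: (measurableT_comp (measurable_powR _)); exact: measurable_enorm.
Qed.

Lemma y_ge0 x : 0 <= y x.
Proof. by rewrite mulr_ge0 ?powR_ge0 ?enorm_ge0. Qed.

(** A pointwise substitute for Hoelder's inequality, to be integrated and then optimized in t: if z
    > 1/t then (t z)^(p-1) >= 1 and the first term suffices, otherwise the second does. *)
Lemma young_scaled (z t : R) : 0 <= z -> 0 < t -> z <= t `^ (p - 1) * z `^ p + t^-1.
Proof.
move=> z0 t0; have [zt|zt] := leP z t^-1.
  by apply: le_trans zt _; rewrite lerDr mulr_ge0 ?powR_ge0.
have z1 : 0 < z by apply: lt_trans zt; rewrite invr_gt0.
have tz : 1 <= t * z by rewrite -ler_pdivrMl// mulr1 ltW.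
have -> : z `^ p = z * z `^ (p - 1).
  by rewrite mulr_powRB1// (lt_le_trans _ p1).
have -> : t `^ (p - 1) * (z * z `^ (p - 1)) = z * (t * z) `^ (p - 1).
  by rewrite powRM ?ltW// mulrCA.
apply: (@le_trans _ _ (z * (t * z) `^ (p - 1))).
  rewrite ler_peMr// -[leLHS](powRr0 (t * z)).
  by apply: ler_powR => //; rewrite subr_ge0.
by rewrite lerDl invr_ge0 ltW.
Qed.

Lemma shell_hoelder (a b M X : R) (N : set 'rV[R]_n) : 0 < a -> 0 < M -> 0 < X ->
  measurable N -> N `<=` shell a b -> (mu N <= M%:E)%E -> (energy a b <= X%:E)%E ->
  (\int[mu]_(x in N) (y x)%:E <= (2 * (M `^ (1 - p^-1) * X `^ p^-1))%:E)%E.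
Proof.
move=> a0 M0 X0 mN Nab NM EX.
have p0 : 0 < p by exact: lt_le_trans p1.
have sp : shell a b `<=` punctured.
  by move=> x /andP[ax _]; rewrite /punctured/= -enormX_gt0//; exact: lt_le_trans ax.
have my := measurable_weighted_grad.
have myN : measurable_fun N y.
  by apply: measurable_funS my; [exact: measurable_punctured|exact: subset_trans sp].
(* This t makes t^(p-1) X and M / t both equal to M^(1-1/p) X^(1/p), whence the factor 2; p = 1 is
   included. *)
pose t := (M / X) `^ p^-1.
have t0 : 0 < t by rewrite powR_gt0// divr_gt0.
have myp : measurable_fun N (fun x => y x `^ p).
  exact: (measurableT_comp (measurable_powR _)).
apply: (@le_trans _ _ (\int[mu]_(x in N) ((t `^ (p - 1))%:E * (y x `^ p)%:E + (t^-1)%:E))%E).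
  apply: ge0_le_integral => //.
  - by move=> x _; rewrite lee_fin y_ge0.
  - exact/measurable_EFinP.
  - apply/measurable_EFinP; apply: measurable_funD => //.
    exact: measurable_funM.
  - by move=> x _; rewrite -EFinM -EFinD lee_fin young_scaled// y_ge0.
rewrite ge0_integralD//; last 3 first.
- by move=> x _; rewrite -EFinM lee_fin mulr_ge0 ?powR_ge0.
- by apply/measurable_EFinP; exact: measurable_funM.
- by move=> x _; rewrite lee_fin invr_ge0 ltW.
rewrite ge0_integralZl//; last 3 first.
- exact/measurable_EFinP.
- by move=> x _; rewrite lee_fin powR_ge0.
- by rewrite lee_fin powR_ge0.
rewrite integral_cst//.
have H1 : t `^ (p - 1) * X = M `^ (1 - p^-1) * X `^ p^-1.
  rewrite /t -powRrM mulrBr mulr1 mulVf ?gt_eqF// powRM ?ltW ?invr_gt0//.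
  rewrite -mulrA; congr (_ * _); rewrite -powR_inv1 ?ltW// -powRrM.
  rewrite -[X in _ * X = _]powRr1 ?ltW// -powRD; last by rewrite (gt_eqF X0) implybT.
  by congr powR; rewrite mulN1r opprB addrC subrKC.
have H2 : t^-1 * M = M `^ (1 - p^-1) * X `^ p^-1.
  rewrite /t -powRN powRM ?ltW ?invr_gt0//.
  rewrite mulrAC; congr (_ * _); last by rewrite -powR_inv1 ?ltW// -powRrM mulN1r opprK.
  rewrite -[X in _ * X = _]powRr1 ?ltW// -powRD; last by rewrite (gt_eqF M0) implybT.
  by rewrite addrC.
rewrite mulr_natl mulr2n EFinD; apply: leeD.
  rewrite -H1 EFinM; apply: lee_wpmul2l; first by rewrite lee_fin powR_ge0.
  apply: (@le_trans _ _ (energy a b)) => //; rewrite /energy.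
  apply: ge0_subset_integral => //.
  - exact: measurable_shell.
  - apply/measurable_EFinP; apply: (measurableT_comp (measurable_powR _)).
    by apply: measurable_funS my => //; exact: measurable_punctured.
  - by move=> x _; rewrite lee_fin powR_ge0.
by rewrite -H2 EFinM lee_pmul2l// lte_fin invr_gt0.
Qed.

Variables (v : R -> R) (Z : set R).
Hypothesis key : forall s1 s2 d : R, ~ Z s1 -> ~ Z s2 -> s1 < s2 -> 0 < d < s1 ->
  ((ball_vol n * `|v s1 - v s2|)%:E <=
   \int[mu]_(x in annulus (s1 - d) (s2 + d)) (enorm (g x) * (enorm x / enormX x))%:E)%E.

(** th is the exponent with |x|^(1-n) = |x|^al (|x|^n)^th, and - A = th + (1 - 1/p) is the power of
    the scale m left after the length s2 - s1 is measured in units of m. *)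
Let A : R := p^-1 + (al - 1) / n%:R.
Let th : R := (1 - n%:R - al) / n%:R.

(** The 2 comes from [shell_hoelder], K^|th| from comparing (|x|^n)^th with m^th on the shell from m
    to K m, 3 from the widening of the annulus, and the division from the left-hand side of
    [key]. *)
Definition hoelder_const (K : R) : R :=
  2 * K `^ `|th| * (3 * ball_vol n) `^ (1 - p^-1) / ball_vol n.

Lemma powR_ratio_le (K t c : R) : 1 <= t <= K -> t `^ c <= K `^ `|c|.
Proof.
move=> /andP[t1 tK]; have t0 : 0 <= t by apply: le_trans t1.
apply: (@le_trans _ _ (t `^ `|c|)); first by rewrite ler_powR// ler_norm.
by rewrite ge0_ler_powR// nnegrE//; apply: le_trans tK.
Qed.

Lemma hoelder_estimate (K m X s1 s2 : R) : 0 < m -> 0 < X ->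
  (energy m (K * m) <= X%:E)%E -> m < s1 -> s1 < s2 -> s2 < K * m ->
  ~ Z s1 -> ~ Z s2 ->
  `|v s1 - v s2| <= hoelder_const K * (m `^ (- A) * X `^ p^-1) *
    ((s2 - s1) / m) `^ (1 - p^-1).
Proof.
move=> m0 X0 EX ms1 s12 s2K Zs1 Zs2.
have w0 := ball_vol_gt0 (R := R) n0.
(* Small enough that the widened annulus stays in the shell and has length at most 3 (s2 - s1). *)
pose d := Num.min (s2 - s1) (Num.min (s1 - m) (K * m - s2)) / 2.
have h0 : 0 < Num.min (s2 - s1) (Num.min (s1 - m) (K * m - s2)).
  by rewrite !lt_min !subr_gt0 s12 ms1.
have d0 : 0 < d by rewrite divr_gt0.
have d2 : 2 * d = Num.min (s2 - s1) (Num.min (s1 - m) (K * m - s2)).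
  by rewrite /d mulrC divfK.
have [d3 d4 d5] : [/\ 2 * d <= s2 - s1, 2 * d <= s1 - m & 2 * d <= K * m - s2].
  by rewrite d2; split; rewrite !ge_min ?lexx ?orbT.
have ds : 0 < d < s1 by apply/andP; split => //; lra.
have := key Zs1 Zs2 s12 ds.
set N := annulus _ _ => HN.
have sub : N `<=` shell m (K * m).
  move=> x /andP[x1 x2]; apply/andP; split; lra.
have mN : measurable N by exact: measurable_annulus.
pose M := ball_vol n * (3 * (s2 - s1)).
have M0 : 0 < M by rewrite !mulr_gt0// subr_gt0.
have NM : (mu N <= M%:E)%E.
  apply: le_trans (measure_annulus _ _) _; [lra|lra|].
  by rewrite lee_fin /M ler_pM2l//; lra.
have c0 : 0 <= K `^ `|th| * m `^ th by rewrite mulr_ge0 ?powR_ge0.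
have my : measurable_fun N y.
  apply: measurable_funS measurable_weighted_grad; first exact: measurable_punctured.
  by apply: annulus_punctured => //; lra.
have HI := shell_hoelder m0 M0 X0 mN sub NM EX.
have : (\int[mu]_(x in N) (enorm (g x) * (enorm x / enormX x))%:E <=
   (K `^ `|th| * m `^ th)%:E * \int[mu]_(x in N) (y x)%:E)%E.
  rewrite -ge0_integralZl//; last 2 first.
  - exact/measurable_EFinP.
  - by move=> x _; rewrite lee_fin y_ge0.
  apply: ge0_le_integral => //.
  - by move=> x _; rewrite lee_fin mulr_ge0 ?enorm_ge0// divr_ge0 ?enorm_ge0 ?enormX_ge0.
  - apply/measurable_EFinP; apply: measurable_funM.
      apply: measurable_funS measurable_enorm_grad; first exact: measurable_punctured.
      by apply: annulus_punctured => //; lra.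
    apply: measurable_funTS; apply: measurable_funM; first exact: measurable_enorm.
    under eq_fun do rewrite -powR_inv1 ?enormX_ge0//.
    by apply: (measurableT_comp (measurable_powR _)); exact: measurable_enormX.
  - by apply/measurable_EFinP; apply: measurable_funM.
  - move=> x Nx; rewrite -EFinM lee_fin.
    have /andP[x1 x2] := sub _ Nx.
    have X1 : 0 < enormX x by exact: lt_le_trans x1.
    have e0 : 0 < enorm x by rewrite enorm_gt0 -enormX_gt0.
    have Ee : enorm x / enormX x = enorm x `^ al * enormX x `^ th.
      rewrite /enormX -!powR_mulrn ?ltW// -powRN -[X in X * _](powRr1 (ltW e0)).
      rewrite -powRD; last by rewrite (gt_eqF e0) implybT.
      rewrite -powRrM -powRD; last by rewrite (gt_eqF e0) implybT.
      congr powR; rewrite /th; field; by rewrite pnatr_eq0 -lt0n.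
    rewrite Ee mulrA [X in X * _]mulrC -/(y x) mulrC ler_wpM2r ?y_ge0//.
    have -> : enormX x = (enormX x / m) * m by rewrite divfK// gt_eqF.
    rewrite powRM; [|by rewrite divr_ge0// ltW|exact: ltW].
    apply: ler_wpM2r; first exact: powR_ge0.
    apply: powR_ratio_le.
    by rewrite ler_pdivlMr// mul1r x1 ler_pdivrMr// ltW.
move=> HJ; have {HN HJ} := le_trans HN HJ => HN.
have := le_trans HN (lee_wpmul2l _ HI); rewrite lee_fin => /(_ c0).
rewrite -EFinM lee_fin -ler_pdivlMl// => /le_trans; apply.
rewrite le_eqVlt; apply/orP; left; apply/eqP.
have E1 : M `^ (1 - p^-1) = (3 * ball_vol n) `^ (1 - p^-1) *
    (m `^ (1 - p^-1) * ((s2 - s1) / m) `^ (1 - p^-1)).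
  have r0 : 0 <= (s2 - s1) / m by rewrite divr_ge0 ?ltW ?subr_gt0.
  have -> : M = 3 * ball_vol n * (m * ((s2 - s1) / m)).
    by rewrite /M; field; rewrite (gt_eqF m0).
  rewrite (@powRM _ (3 * ball_vol n)); last 2 first.
  - by apply: mulr_ge0 => //; exact: ltW.
  - by apply: mulr_ge0 => //; exact: ltW.
  by rewrite (powRM _ (ltW m0) r0).
have E2 : m `^ (- A) = m `^ th * m `^ (1 - p^-1).
  rewrite -powRD; last by rewrite (gt_eqF m0) implybT.
  congr powR; rewrite /A /th; field; rewrite pnatr_eq0 -lt0n n0 gt_eqF//.
  exact: lt_le_trans p1.
rewrite E1 E2 /hoelder_const; ring.
Qed.

End hoelder.

(** * Local interpolation *)

Section local_interpolation.
Context {R : realType}.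
Notation leb := (@lebesgue_measure R).

Lemma powR_add_le (x y q : R) : 0 <= x -> 0 <= y -> 0 <= q ->
  (x + y) `^ q <= 2 `^ q * (x `^ q + y `^ q).
Proof.
move=> x0 y0 q0.
wlog xy : x y x0 y0 / x <= y.
  move=> h; have [xy|/ltW yx] := leP x y; first exact: h.
  by rewrite addrC [X in _ * X]addrC; exact: h.
apply: (@le_trans _ _ ((2 * y) `^ q)).
  rewrite ge0_ler_powR// ?nnegrE ?addr_ge0 ?mulr_ge0//.
  by rewrite mulrDl mul1r lerD2r.
rewrite powRM// ler_wpM2l ?powR_ge0// lerDr powR_ge0 //.
Qed.

Lemma powR_le1D (z t : R) : 0 <= z -> 0 <= t <= 1 -> z `^ t <= 1 + z.
Proof.
move=> z0 /andP[t0 t1]; have [z1|z1] := leP z 1.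
  apply: (@le_trans _ _ 1); last by rewrite lerDl.
  apply: (@le_trans _ _ (1 `^ t)); last by rewrite powR1.
  by rewrite ge0_ler_powR ?nnegrE.
by apply: (@le_trans _ _ z); [exact: ler1_powR (ltW z1) t1|rewrite lerDr].
Qed.

(** Chebyshev's inequality: if |v|^q exceeded b on the interval off Z, its integral would be at
    least m b. *)
Lemma good_point (v : R -> R) (Z : set R) (m q b : R) : 0 < m ->
  measurable_fun setT v -> leb.-negligible Z ->
  (\int[leb]_(s in `]m, (2 * m)%R[) (`|v s| `^ q)%:E < (m * b)%:E)%E ->
  exists s, [/\ m < s, s < 2 * m, ~ Z s & `|v s| `^ q <= b].
Proof.
move=> m0 mv [N [mN N0 ZN]] I.
apply: contrapT => h; move: I; rewrite ltNge => /negP; apply.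
have mI : measurable (`]m, (2 * m)[%classic : set R) by exact: measurable_itv.
have mf : measurable_fun setT (fun s => (`|v s| `^ q)%:E).
  apply/measurable_EFinP; apply: (measurableT_comp (measurable_powR _)).
  exact: measurableT_comp.
have lI : leb `]m, (2 * m)[%classic = m%:E.
  have m2 : m < 2 * m by rewrite ltr_pMl// ltr1n.
  by rewrite lebesgue_measure_itv/= lte_fin m2 -EFinB; congr EFin; ring.
have B s : m < s -> s < 2 * m -> ~ Z s -> b < `|v s| `^ q.
  move=> s1 s2 Zs; rewrite ltNge; apply/negP => hb; apply: h; by exists s.
have [b0|b0] := leP b 0.
  apply: (@le_trans _ _ 0%E); first by rewrite lee_fin mulr_ge0_le0// ltW.
  by apply: integral_ge0 => s _; rewrite lee_fin powR_ge0.
have -> : ((m * b)%:E = \int[leb]_(s in `]m, (2 * m)%R[) b%:E)%E.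
  by rewrite integral_cst// [X in (_ * X)%E]lI -EFinM mulrC.
apply: ae_ge0_le_integral => //.
- by move=> s _; rewrite lee_fin ltW.
- exact: (measurable_funTS mf).
- exists N; split => //; apply: subset_trans ZN => s /= hs; apply: contrapT => Zs.
  apply: hs; rewrite in_itv/= => /andP[s1 s2]; rewrite lee_fin ltW//.
  exact: B.
Qed.

Lemma avoid_negligible (Z : set R) (m : R) : 0 < m -> leb.-negligible Z ->
  exists t : R, [/\ m < t, t < 2 * m & ~ Z t].
Proof.
move=> m0 nZ.
have mc : measurable_fun setT (fun _ : R => 0 : R) by exact: measurable_cst.
have [|t [h1 h2 h3 _]] := @good_point (fun=> 0) Z m 1 1 m0 mc nZ; last by exists t.
under eq_integral do rewrite normr0 powR0 ?oner_neq0//.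
by rewrite integral0 lte_fin mulr1.
Qed.

Variables (p q tau a : R).
Hypotheses (p1 : 1 <= p) (q1 : 1 <= q) (tau1 : 1 <= tau) (a01 : 0 < a <= 1).
Hypothesis cond : a * (p^-1 - 1) + (1 - a) * q^-1 <= tau^-1.

Let h : R := 1 - p^-1.

Let h0 : 0 <= h.
Proof. by rewrite subr_ge0 invf_le1// (lt_le_trans _ p1). Qed.

(* Controls the pointwise size of the oscillation in the supercritical range. *)
Let pointwise_const : R :=
  (2 `^ (q + 1) * 2 `^ q * 2 `^ h^-1) `^ (((1 - a) * tau - q) / q).

(** With k = ((1 - a) tau - q) / q, N^tau is split as N^r (N^q N^(1/h))^k N^q. The height bound
    controls the middle factor, N <= G the first, and the last is left for integration. That r = a
    tau - k / h is nonnegative is a restatement of [cond]. *)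
Lemma pointwise_interpolation (N G b : R) : q < (1 - a) * tau -> 0 <= N -> N <= G -> 0 < b ->
  N `^ q * N `^ h^-1 <= (2 `^ (q + 1) * 2 `^ q * 2 `^ h^-1) * b * G `^ h^-1 ->
  N `^ tau <= pointwise_const * G `^ (a * tau) * b `^ (((1 - a) * tau - q) / q) * N `^ q.
Proof.
move=> k0 N0 NG b0 H.
have q0 : 0 < q by exact: lt_le_trans q1.
have t0 : 0 < tau by exact: lt_le_trans tau1.
have [a0 a1] := andP a01.
have [N00|Nn0] := eqVneq N 0.
  by rewrite N00 !powR0 ?gt_eqF// mulr0.
have {}N0 : 0 < N by rewrite lt_def Nn0.
have G0 : 0 < G by exact: lt_le_trans NG.
set k := ((1 - a) * tau - q) / q.
have kp : 0 < k by rewrite divr_gt0// subr_gt0.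
have kq : k * q = (1 - a) * tau - q by rewrite /k divfK// gt_eqF.
have cond' : (1 - a) * tau - q <= a * tau * h * q.
  have := cond; rewrite -(ler_pM2r (mulr_gt0 t0 q0)).
  have -> : tau^-1 * (tau * q) = q by rewrite mulrA mulVf ?mul1r// gt_eqF.
  have -> : (a * (p^-1 - 1) + (1 - a) / q) * (tau * q) = - (a * tau * h * q) + (1 - a) * tau.
    by rewrite /h; field; rewrite (gt_eqF q0) gt_eqF// (lt_le_trans _ p1).
  by lra.
have hp : 0 < h.
  rewrite lt_def h0 andbT; apply/eqP => hE; move: cond'; rewrite hE mulr0 mul0r.
  by rewrite leNgt subr_gt0 k0.
have K0 : 0 <= 2 `^ (q + 1) * 2 `^ q * 2 `^ h^-1 :> R by rewrite !mulr_ge0 ?powR_ge0.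
have H2 : (N `^ q * N `^ h^-1) `^ k <= pointwise_const * b `^ k * G `^ (h^-1 * k).
  apply: (@le_trans _ _ ((2 `^ (q + 1) * 2 `^ q * 2 `^ h^-1 * b * G `^ h^-1) `^ k)).
    rewrite ge0_ler_powR ?nnegrE ?(ltW kp)// ?mulr_ge0 ?powR_ge0//.
    exact: ltW.
  rewrite powRM ?mulr_ge0 ?powR_ge0 ?(ltW b0)// powRM ?(ltW b0)// -powRrM.
  by rewrite /pointwise_const -/k.
pose r := a * tau - h^-1 * k.
have r0 : 0 <= r.
  rewrite subr_ge0 mulrC -ler_pdivlMr ?invr_gt0// invrK /k ler_pdivrMr//.
have E : N `^ tau = N `^ r * (N `^ q * N `^ h^-1) `^ k * N `^ q.
  rewrite powRM ?powR_ge0// -!powRrM -!powRD ?(negbTE Nn0) ?implybT//.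
  by congr powR; rewrite /r mulrC [q * k]mulrC kq; ring.
have Hr : N `^ r <= G `^ r by rewrite ge0_ler_powR ?nnegrE// ltW.
rewrite E; apply: ler_wpM2r; first exact: powR_ge0.
apply: (@le_trans _ _ (G `^ r * (pointwise_const * b `^ k * G `^ (h^-1 * k)))).
  by apply: ler_pM; rewrite ?powR_ge0.
have -> : G `^ (a * tau) = G `^ r * G `^ (h^-1 * k).
  by rewrite -powRD ?(gt_eqF G0) ?implybT// /r subrK.
by rewrite le_eqVlt; apply/orP; left; apply/eqP; ring.
Qed.

(** One summand for each case of [local_interpolation]: a = 1, then (1 - a) tau <= q, then (1 - a)
    tau > q. *)
Definition local_const : R :=
  1 + (1 + 2 `^ (q + 1)) + pointwise_const * 2 `^ (q + 1).

Variables (v : R -> R) (Z : set R) (m G b s0 : R).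
Hypotheses (m0 : 0 < m) (G0 : 0 < G) (b0 : 0 < b).
Hypotheses (mv : measurable_fun setT v) (nZ : leb.-negligible Z).
Hypothesis osc : forall s1 s2, m < s1 -> s1 < s2 -> s2 < 2 * m -> ~ Z s1 -> ~ Z s2 ->
  `|v s1 - v s2| <= G * ((s2 - s1) / m) `^ h.
(** Asked only for a < 1: when a = 1 the L^q norm has exponent 0 and may be infinite. *)
Hypothesis vb : a < 1 ->
  (\int[leb]_(s in `]m, (2 * m)%R[) (`|v s| `^ q)%:E <= (m * b)%:E)%E.
Hypotheses (ms0 : m < s0) (s0m : s0 < 2 * m) (Zs0 : ~ Z s0).
Hypothesis vs0 : a < 1 -> `|v s0| `^ q <= b.

Notation J := (`]m, (2 * m)%R[%classic : set R).

Let osc' s1 s2 : J s1 -> J s2 -> ~ Z s1 -> ~ Z s2 ->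
  `|v s1 - v s2| <= G * (`|s2 - s1| / m) `^ h.
Proof.
rewrite /= !in_itv/= => /andP[h1 h2] /andP[h3 h4] Z1 Z2.
have [s12|s12|->] := ltgtP s1 s2.
- by rewrite (@gtr0_norm _ (s2 - s1)) ?subr_gt0//; exact: osc.
- by rewrite distrC (@ltr0_norm _ (s2 - s1)) ?subr_lt0// opprB; exact: osc.
- by rewrite subrr normr0 mulr_ge0 ?powR_ge0// ltW.
Qed.

Let oscG s : J s -> ~ Z s -> `|v s - v s0| <= G.
Proof.
move=> Js Zs; apply: le_trans (osc' Js _ Zs Zs0) _.
  by rewrite /= in_itv/= ms0.
rewrite -[leRHS]mulr1 ler_wpM2l ?(ltW G0)//.
apply: (@le_trans _ _ (1 `^ h)); last by rewrite powR1.
rewrite ge0_ler_powR ?nnegrE ?divr_ge0 ?(ltW m0)//.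
rewrite ler_pdivrMr// mul1r ler_norml.
by move: Js ms0 s0m; rewrite /= in_itv/=; lra.
Qed.

Let mJ : measurable J. Proof. exact: measurable_itv. Qed.

Let lJ : leb J = m%:E.
Proof.
have m2 : m < 2 * m by rewrite ltr_pMl// ltr1n.
by rewrite lebesgue_measure_itv/= lte_fin m2 -EFinB; congr EFin; ring.
Qed.

Let mosc r : measurable_fun setT (fun s => (`|v s - v s0| `^ r)%:E).
Proof.
apply/measurable_EFinP; apply: (measurableT_comp (measurable_powR _)).
by apply: measurableT_comp => //; exact: measurable_funB.
Qed.

Let osc_q : a < 1 ->
  (\int[leb]_(s in J) (`|v s - v s0| `^ q)%:E <= (2 `^ (q + 1) * (m * b))%:E)%E.
Proof.
move=> a1; have q0 : 0 <= q by apply: le_trans q1.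
have mvq : measurable_fun setT (fun s => `|v s| `^ q).
  by apply: (measurableT_comp (measurable_powR _)); exact: measurableT_comp.
apply: (@le_trans _ _ (\int[leb]_(s in J) ((2 `^ q)%:E * ((`|v s| `^ q)%:E + b%:E)))%E).
  apply: ge0_le_integral => //.
  - exact: (measurable_funTS (mosc q)).
  - apply: measurable_funTS; apply/measurable_EFinP; apply: measurable_funM => //.
    exact: measurable_funD.
  - move=> s _; rewrite -EFinD -EFinM lee_fin.
    apply: (@le_trans _ _ ((`|v s| + `|v s0|) `^ q)).
      by rewrite ge0_ler_powR ?nnegrE ?addr_ge0// ler_normB.
    apply: le_trans (powR_add_le _ _ _) _ => //.
    by rewrite ler_wpM2l ?powR_ge0// lerD2l vs0.
rewrite ge0_integralZl//; last 2 first.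
- by apply: measurable_funTS; apply/measurable_EFinP; exact: measurable_funD.
- by move=> s _; rewrite -EFinD lee_fin addr_ge0 ?powR_ge0// ltW.
rewrite ge0_integralD//; last 2 first.
- by apply: measurable_funTS; exact/measurable_EFinP.
- by move=> s _; rewrite lee_fin ltW.
rewrite integral_cst// [X in (_ + _ * X)%E]lJ.
have -> : (2 `^ (q + 1) * (m * b))%:E = ((2 `^ q)%:E * ((m * b)%:E + b%:E * m%:E))%E.
  rewrite -[in RHS](EFinM b) -EFinD -EFinM powRD ?powRr1// ?pnatr_eq0 ?implybT//.
  by congr EFin; ring.
by apply: lee_wpmul2l; [rewrite lee_fin powR_ge0|apply: leeD => //; exact: vb].
Qed.

Let ae_le (f : R -> R) : measurable_fun setT f -> (forall s, 0 <= f s) ->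
  (forall s, J s -> ~ Z s -> `|v s - v s0| `^ tau <= f s) ->
  (\int[leb]_(s in J) (`|v s - v s0| `^ tau)%:E <= \int[leb]_(s in J) (f s)%:E)%E.
Proof.
move=> mf f0 hf; apply: ae_ge0_le_integral => //.
- exact: (measurable_funTS (mosc tau)).
- by move=> s _; rewrite lee_fin.
- by apply: measurable_funTS; exact/measurable_EFinP.
- have [N [mN N0 ZN]] := nZ; exists N; split => //.
  apply: subset_trans ZN => s /= hs; apply: contrapT => Zs.
  by apply: hs => Js; rewrite lee_fin; exact: hf.
Qed.

(* Hoelder continuity keeps the oscillation above half its value on an interval of
   controlled length, which bounds its height by its L^q norm. *)
Let height s : 0 < h -> a < 1 -> J s -> ~ Z s ->
  `|v s - v s0| `^ q * `|v s - v s0| `^ h^-1 <=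
  (2 `^ (q + 1) * 2 `^ q * 2 `^ h^-1) * b * G `^ h^-1.
Proof.
move=> hp a1 Js Zs; set N := `|v s - v s0|.
have q0 : 0 < q by exact: lt_le_trans q1.
have NG : N <= G by exact: oscG.
have [N0|Nn0] := eqVneq N 0.
  rewrite N0 !powR0 ?gt_eqF ?invr_gt0// mul0r !mulr_ge0 ?powR_ge0//.
  exact: ltW.
have Np : 0 < N by rewrite lt_def Nn0 normr_ge0.
(* l solves G l^h = N / 2, so v moves by at most N / 2 within distance l m of s. *)
pose l := (N / (2 * G)) `^ h^-1.
have l0 : 0 < l by rewrite powR_gt0// divr_gt0// mulr_gt0.
have r2 : N / (2 * G) <= 2^-1.
  by rewrite ler_pdivrMr ?mulr_gt0// mulrA mulVf ?mul1r.
have l2 : l <= 2^-1.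
  apply: le_trans (r2); rewrite /l -[leRHS]powRr1 ?divr_ge0 ?mulr_ge0 ?(ltW G0) ?(ltW Np)//.
  apply: ger_powR.
    rewrite divr_gt0 ?mulr_gt0//=; apply: le_trans r2 _.
    by rewrite invf_le1// ler1n.
  by rewrite -[leLHS]invr1 lef_pV2 ?posrE// /h gerBl invr_ge0 (le_trans _ p1).
have lh : l `^ h = N / (2 * G).
  by rewrite /l -powRrM mulVf ?gt_eqF// powRr1// divr_ge0 ?mulr_ge0 ?(ltW G0) ?(ltW Np).
(* The interval of length l m lies to the right of s in the left half of ]m, 2 m[ and to its left
   otherwise; l <= 1/2 keeps it inside. *)
pose lo := if s <= 3 / 2 * m then s else s - l * m.
have lm0 : 0 < l * m by rewrite mulr_gt0.
have lm2 : l * m <= 2^-1 * m by rewrite ler_pM2r.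
have Js' : m < s < 2 * m by move: Js; rewrite /= in_itv.
pose I := (`]lo, (lo + l * m)[%classic : set R).
have mI : measurable I by exact: measurable_itv.
have IJ : I `<=` J.
  move=> t; rewrite /I/= !in_itv/= /lo; case: ifPn; rewrite -?ltNge; lra.
have Id t : I t -> `|t - s| <= l * m.
  by rewrite /I/= in_itv/= /lo ler_norml; case: ifPn => _; lra.
have low t : I t -> ~ Z t -> N / 2 <= `|v t - v s0|.
  move=> It Zt; have := osc' Js (IJ _ It) Zs Zt.
  have le1 : G * (`|t - s| / m) `^ h <= N / 2.
    apply: (@le_trans _ _ (G * l `^ h)).
      rewrite ler_pM2l// ge0_ler_powR ?nnegrE ?divr_ge0 ?(ltW m0) ?(ltW l0)//.
      by rewrite ler_pdivrMr//; exact: Id.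
    rewrite lh le_eqVlt; apply/orP; left; apply/eqP; field; by rewrite gt_eqF.
  move=> /le_trans /(_ le1) h1.
  have : N <= `|v s - v t| + `|v t - v s0|.
    by rewrite /N -[v s - v s0](subrKA (v t)) ler_normD.
  by lra.
have : (((N / 2) `^ q * (l * m))%:E <= \int[leb]_(t in I) (`|v t - v s0| `^ q)%:E)%E.
  have -> : (((N / 2) `^ q * (l * m))%:E = \int[leb]_(t in I) ((N / 2) `^ q)%:E)%E.
    have lI : leb I = (l * m)%:E.
      rewrite /I lebesgue_measure_itv/= lte_fin ltrDl lm0 -EFinB.
      by congr EFin; ring.
    by rewrite integral_cst// [X in (_ * X)%E]lI EFinM.
  apply: ae_ge0_le_integral => //.
  - by move=> t _; rewrite lee_fin powR_ge0.
  - exact: (measurable_funTS (mosc q)).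
  - have [K [mK K0 ZK]] := nZ; exists K; split => //.
    apply: subset_trans ZK => t /= ht; apply: contrapT => Zt.
    apply: ht => It; rewrite lee_fin ge0_ler_powR ?nnegrE ?(ltW q0) ?divr_ge0 ?(ltW Np)//.
    exact: low.
move=> H1.
have H2 : (\int[leb]_(t in I) (`|v t - v s0| `^ q)%:E <=
  \int[leb]_(t in J) (`|v t - v s0| `^ q)%:E)%E.
  by apply: ge0_subset_integral => //; exact: (measurable_funTS (mosc q)).
have := le_trans H1 (le_trans H2 (osc_q a1)); rewrite lee_fin.
have -> : 2 `^ (q + 1) * (m * b) = (2 `^ (q + 1) * b) * m by ring.
rewrite mulrA ler_pM2r// => H3.
have -> : 2 `^ (q + 1) * 2 `^ q * 2 `^ h^-1 * b * G `^ h^-1 =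
   (2 `^ (q + 1) * b) * (2 `^ q * (2 * G) `^ h^-1).
  rewrite powRM ?(ltW G0)//; ring.
have -> : N `^ q * N `^ h^-1 = ((N / 2) `^ q * l) * (2 `^ q * (2 * G) `^ h^-1).
  rewrite mulrACA; congr (_ * _).
    by rewrite -powRM ?divr_ge0 ?(ltW Np)// divfK.
  by rewrite /l -powRM ?divr_ge0 ?mulr_ge0 ?(ltW G0) ?(ltW Np)// divfK// gt_eqF// mulr_gt0.
apply: ler_wpM2r => //; by rewrite mulr_ge0 ?powR_ge0.
Qed.

(** For a = 1 the oscillation is at most G. If (1 - a) tau <= q, the power a tau of the oscillation
    is bounded by that of G, and the remaining power is a power of exponent at most 1 of its q-th
    power, hence linearly bounded. Otherwise only q of the exponent is integrated and the excess is
    bounded pointwise through [height]. *)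
Lemma local_interpolation :
  (\int[leb]_(s in `]m, (2 * m)%R[) (`|v s - v s0| `^ tau)%:E <=
   (local_const * m * (G `^ a * b `^ ((1 - a) / q)) `^ tau)%:E)%E.
Proof.
have q0 : 0 < q by exact: lt_le_trans q1.
have t0 : 0 < tau by exact: lt_le_trans tau1.
have [a0 a1] := andP a01.
have pc0 : 0 <= pointwise_const by exact: powR_ge0.
have D0 : 0 <= (G `^ a * b `^ ((1 - a) / q)) `^ tau by exact: powR_ge0.
have DE : (G `^ a * b `^ ((1 - a) / q)) `^ tau = G `^ (a * tau) * b `^ ((1 - a) * tau / q).
  rewrite powRM ?powR_ge0// -!powRrM; congr (_ * _ `^ _); ring.
have [a_1|an1] := eqVneq a 1.
  apply: le_trans (ae_le (f := fun=> G `^ tau) _ _ _) _ => //.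
  - by move=> s; exact: powR_ge0.
  - move=> s Js Zs; rewrite ge0_ler_powR ?nnegrE ?(ltW t0) ?(ltW G0)//; exact: oscG.
  rewrite integral_cst// [X in (_ * X)%E]lJ -EFinM lee_fin DE a_1 subrr !mul0r powRr0.
  rewrite mul1r mulr1 mulrC ler_wpM2r ?powR_ge0// ler_peMl ?(ltW m0)//.
  by rewrite /local_const -!addrA lerDl !addr_ge0 ?mulr_ge0 ?powR_ge0.
have {an1}a1' : a < 1 by rewrite lt_neqAle an1.
have Oq := osc_q a1'.
have mq : measurable_fun setT (fun s => `|v s - v s0| `^ q).
  by have /measurable_EFinP := mosc q.
have [c1|c2] := leP ((1 - a) * tau) q.
  pose th := (1 - a) * tau / q.
  have th01 : 0 <= th <= 1.
    rewrite divr_ge0 ?mulr_ge0 ?subr_ge0 ?(ltW t0) ?(ltW q0)//=.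
    by rewrite ler_pdivrMr// mul1r.
  pose K := G `^ (a * tau) * b `^ th.
  have K0 : 0 <= K by rewrite mulr_ge0 ?powR_ge0.
  apply: le_trans (ae_le (f := fun s => K * (1 + b^-1 * `|v s - v s0| `^ q)) _ _ _) _.
  - by apply: measurable_funM => //; apply: measurable_funD => //; apply: measurable_funM.
  - by move=> s; rewrite mulr_ge0// addr_ge0// mulr_ge0 ?powR_ge0// invr_ge0 ltW.
  - move=> s Js Zs; set N := `|v s - v s0|.
    have N0 : 0 <= N by exact: normr_ge0.
    have -> : N `^ tau = N `^ (a * tau) * N `^ (q * th).
      have -> : q * th = (1 - a) * tau by rewrite mulrC divfK// gt_eqF.
      have [->|Nn0] := eqVneq N 0.
        by rewrite [in LHS]powR0 ?gt_eqF// powR0 ?mul0r// gt_eqF// mulr_gt0.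
      rewrite -powRD ?(negbTE Nn0) ?implybT//; congr powR; ring.
    rewrite -mulrA; apply: ler_pM; rewrite ?powR_ge0//.
      rewrite ge0_ler_powR ?nnegrE ?(ltW G0) ?mulr_ge0 ?(ltW a0) ?(ltW t0)//.
      exact: oscG.
    have -> : N `^ (q * th) = b `^ th * (b^-1 * N `^ q) `^ th.
      rewrite powRrM -powRM ?(ltW b0) ?mulr_ge0 ?powR_ge0 ?invr_ge0 ?(ltW b0)//.
      by rewrite mulrA mulfV ?mul1r// gt_eqF.
    rewrite ler_wpM2l ?powR_ge0// powR_le1D// mulr_ge0 ?powR_ge0// invr_ge0 ltW//.
  under eq_integral do rewrite EFinM.
  rewrite ge0_integralZl//; last 2 first.
  - by apply: measurable_funTS; apply/measurable_EFinP; apply: measurable_funD => //; apply: measurable_funM.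
  - by move=> s _; rewrite lee_fin addr_ge0// mulr_ge0 ?powR_ge0// invr_ge0 ltW.
  under eq_integral do rewrite EFinD EFinM.
  rewrite ge0_integralD//; last 2 first.
  - by move=> s _; rewrite -EFinM lee_fin mulr_ge0 ?powR_ge0// invr_ge0 ltW.
  - by apply: measurable_funTS; apply/measurable_EFinP; apply: measurable_funM.
  rewrite integral_cst// mul1e [X in (_ * (X + _))%E]lJ ge0_integralZl//; last 2 first.
  - exact: (measurable_funTS (mosc q)).
  - by rewrite lee_fin invr_ge0 ltW.
  apply: (@le_trans _ _ (K%:E * (m%:E + (b^-1)%:E * (2 `^ (q + 1) * (m * b))%:E))%E).
    apply: lee_wpmul2l; first by rewrite lee_fin.
    by apply: leeD => //; apply: lee_wpmul2l => //; rewrite lee_fin invr_ge0 ltW.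
  rewrite -[X in (_ * (_ + X))%E]EFinM -EFinD -EFinM lee_fin DE -/th -/K mulrC ler_wpM2r//.
  have -> : m + b^-1 * (2 `^ (q + 1) * (m * b)) = (1 + 2 `^ (q + 1)) * m.
    by field; rewrite gt_eqF.
  rewrite ler_pM2r// /local_const addrAC lerDr addr_ge0// mulr_ge0 ?powR_ge0//.
(* Here p > 1: with h = 0, [cond] would give (1 - a) tau <= q. *)
have hp : 0 < h.
  rewrite lt_def h0 andbT; apply/eqP => hE; move: cond.
  have -> : p^-1 - 1 = - h by rewrite /h opprB.
  rewrite hE oppr0 mulr0 add0r leNgt => /negP; apply.
  by rewrite ltr_pdivlMr// mulrC ltr_pdivrMr.
pose K := pointwise_const * G `^ (a * tau) * b `^ (((1 - a) * tau - q) / q).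
have K0 : 0 <= K by rewrite !mulr_ge0 ?powR_ge0.
apply: le_trans (ae_le (f := fun s => K * `|v s - v s0| `^ q) _ _ _) _.
- exact: measurable_funM.
- by move=> s; rewrite mulr_ge0// powR_ge0.
- move=> s Js Zs; apply: pointwise_interpolation => //; first exact: oscG.
  exact: height.
under eq_integral do rewrite EFinM.
rewrite ge0_integralZl//; last exact: (measurable_funTS (mosc q)).
apply: (@le_trans _ _ (K%:E * (2 `^ (q + 1) * (m * b))%:E)%E).
  by apply: lee_wpmul2l.
rewrite -EFinM lee_fin DE.
have -> : b `^ ((1 - a) * tau / q) = b `^ (((1 - a) * tau - q) / q) * b.
  rewrite -[X in _ = _ * X](powRr1 (ltW b0)) -powRD ?(gt_eqF b0) ?implybT//.
  by congr powR; field; rewrite gt_eqF.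
have -> : K * (2 `^ (q + 1) * (m * b)) = (pointwise_const * 2 `^ (q + 1)) *
  (m * (G `^ (a * tau) * (b `^ (((1 - a) * tau - q) / q) * b))) by rewrite /K; ring.
rewrite -(mulrA _ m); apply: ler_wpM2r.
  by rewrite !mulr_ge0 ?powR_ge0 ?(ltW m0) ?(ltW b0).
by rewrite /local_const lerDr !addr_ge0 ?powR_ge0.
Qed.

End local_interpolation.

(** * Summation over dyadic intervals *)

Section chain.
Context {R : realType}.
Notation leb := (@lebesgue_measure R).

(** Comparison with the telescoping differences of k^-D / D, D = kap - 1, which are the integrals of
    t^-kap over unit intervals; the step follows from exp y >= 1 + y and ln (1 - 1/(k+1)) <=
    -1/(k+1). *)
Lemma powR_sum_le (kap : R) : 1 < kap -> forall N : nat,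
  \sum_(k < N) k.+1%:R `^ (- kap) <= 1 + (kap - 1)^-1.
Proof.
move=> k1; set D := kap - 1; have D0 : 0 < D by rewrite subr_gt0.
have step (k : nat) : (0 < k)%N ->
    k.+1%:R `^ (- kap) <= D^-1 * (k%:R `^ (- D) - k.+1%:R `^ (- D)) :> R.
  move=> k0; rewrite ler_pdivlMl//.
  have kp : 0 < k%:R :> R by rewrite ltr0n.
  have Kp : 0 < k.+1%:R :> R by rewrite ltr0n.
  have -> : k.+1%:R `^ (- kap) = k.+1%:R `^ (- D) * k.+1%:R^-1 :> R.
    rewrite -powR_inv1 ?ltW// -powRD ?(gt_eqF Kp) ?implybT//.
    by congr powR; rewrite /D; ring.
  rewrite lerBrDr.
  have -> : k%:R `^ (- D) = k.+1%:R `^ (- D) * (k%:R / k.+1%:R) `^ (- D) :> R.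
    rewrite -powRM ?divr_ge0 ?ler0n//; congr powR.
    by rewrite mulrC divfK// gt_eqF.
  have -> : D * (k.+1%:R `^ (- D) / k.+1%:R) + k.+1%:R `^ (- D) =
    k.+1%:R `^ (- D) * (1 + D / k.+1%:R) :> R by ring.
  rewrite ler_wpM2l ?powR_ge0//.
  have tp : 0 < k%:R / k.+1%:R :> R by rewrite divr_gt0.
  rewrite /powR (gt_eqF tp); apply: le_trans (expR_ge1Dx _) _; rewrite ler_expR.
  rewrite mulNr -mulrN ler_pM2l// lerNr.
  have -> : k%:R / k.+1%:R = 1 + (- k.+1%:R^-1) :> R.
    by rewrite -natr1; field; rewrite natr1 gt_eqF.
  by apply: le_ln1Dx; rewrite ltrN2 invf_lt1// ltr1n.
have S (N : nat) : \sum_(k < N.+1) k.+1%:R `^ (- kap) <= 1 + D^-1 - D^-1 * N.+1%:R `^ (- D).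
  elim: N => [|N IH].
    by rewrite big_ord1 !powR1 mulr1 addrK.
  rewrite big_ord_recr/=; apply: le_trans (lerD IH (step N.+1 _)) _ => //.
  by rewrite mulrBr addrA subrK.
case=> [|N]; first by rewrite big_ord0 addr_ge0// invr_ge0 ltW.
apply: le_trans (S N) _; rewrite lerBlDr lerDl.
by rewrite mulr_ge0 ?powR_ge0// invr_ge0 ltW.
Qed.

Lemma powR_le_linear (z e N : R) : 0 <= z -> 0 <= e <= 1 -> 0 < N ->
  z `^ e <= N `^ (- e) * (1 + N * z).
Proof.
move=> z0 e01 N0.
have -> : z `^ e = N `^ (- e) * (N * z) `^ e.
  rewrite powRM ?(ltW N0)// mulrA -powRD ?(gt_eqF N0) ?implybT//.
  by rewrite addNr powRr0 mul1r.
by rewrite ler_wpM2l ?powR_ge0// powR_le1D// mulr_ge0// ltW.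
Qed.

Lemma powR_doubling (s t c : R) : 0 < s -> 0 < t -> t <= 2 * s -> s <= 2 * t ->
  t `^ c <= 2 `^ `|c| * s `^ c.
Proof.
move=> s0 t0 ts st.
have -> : t = (t / s) * s by rewrite divfK// gt_eqF.
have r0 : 0 < t / s by rewrite divr_gt0.
rewrite powRM ?(ltW r0) ?(ltW s0)// ler_wpM2r ?powR_ge0//.
have [c0|c0] := leP 0 c.
  rewrite ger0_norm// ge0_ler_powR ?nnegrE ?(ltW r0)// ler_pdivrMr//.
have -> : (t / s) `^ c = (s / t) `^ (- c).
  by rewrite -[s / t]invf_div -[(t / s)^-1]powR_inv1 ?(ltW r0)// -powRrM mulN1r opprK.
rewrite ltr0_norm// ge0_ler_powR ?nnegrE ?oppr_ge0 ?(ltW c0) ?divr_ge0 ?(ltW s0) ?(ltW t0)//.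
by rewrite ler_pdivrMr.
Qed.

Variables (p q tau a mu A B : R).
Hypotheses (p1 : 1 <= p) (q1 : 1 <= q) (tau1 : 1 <= tau) (a01 : 0 < a <= 1).
Hypothesis cond : a * (p^-1 - 1) + (1 - a) * q^-1 <= tau^-1.
Hypothesis scaling : a * A + (1 - a) * B = 0.
Hypothesis taumu : tau <= mu.
Let e1 : R := a / p.
Let e2 : R := (1 - a) / q.
Let e : R := e1 + e2.
Hypothesis e_gt : tau^-1 < a / p + (1 - a) / q.

Let p0 : 0 < p. Proof. exact: lt_le_trans p1. Qed.
Let q0 : 0 < q. Proof. exact: lt_le_trans q1. Qed.
Let t0 : 0 < tau. Proof. exact: lt_le_trans tau1. Qed.
Let a0 : 0 < a. Proof. by case/andP: a01. Qed.
Let a1 : 0 <= 1 - a. Proof. by rewrite subr_ge0; case/andP: a01. Qed.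

Let e1_ge0 : 0 <= e1. Proof. by rewrite divr_ge0 ?(ltW a0) ?(ltW p0). Qed.
Let e2_ge0 : 0 <= e2. Proof. by rewrite divr_ge0 ?(ltW q0). Qed.

Let e01 : 0 <= e <= 1.
Proof.
apply/andP; split; first exact: addr_ge0.
rewrite -[leRHS](subrKC a); apply: lerD; rewrite ler_pdivrMr// ler_peMr//.
exact: ltW.
Qed.

Let kap : R := mu - tau * (1 - e).

Let kap1 : 1 < kap.
Proof.
rewrite /kap; apply: (@lt_le_trans _ _ (tau * e)).
  by rewrite mulrC -ltr_pdivrMr// mul1r.
by rewrite mulrBr mulr1 opprB addrCA lerDl subr_ge0.
Qed.

Variables (H H' : R).
Hypotheses (H0 : 0 < H) (H'0 : 0 < H').

(** The power a of the gradient bound times the power 1 - a of the sum of two heights; 2^|B q|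
    compares the scales s k and s k.+1. *)
Definition step_const : R :=
  H `^ a * (2 * (2 * H' * 2 `^ `|B * q|) `^ q^-1) `^ (1 - a).

(** 2^tau separates v into its oscillation about the point value and the point value itself, which
    contribute the two summands; the powers of 3 bound single weights x k and y k, and the last
    factor bounds the series of k^-kap. *)
Definition chain_const : R :=
  2 `^ tau * (local_const p q tau a * (H `^ a * (2 * H') `^ e2 * 3 `^ e1 * 3 `^ e2) `^ tau
    + (13 * step_const) `^ tau) * (1 + (kap - 1)^-1).

(** x k and y k dominate the fractions of X and Y carried by the k-th interval; the slack in the
    bound 3 on their sums allows them to be positive. *)
Variables (v : R -> R) (Z : set R) (s x y : nat -> R) (X Y : R).
Hypotheses (mv : measurable_fun setT v) (nZ : leb.-negligible Z).
Hypotheses (X0 : 0 < X) (Y0 : 0 < Y).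
Hypotheses (s0 : forall k, 0 < s k) (x0 : forall k, 0 < x k) (y0 : forall k, 0 < y k).
Hypotheses (x3 : forall N : nat, \sum_(k < N) x k <= 3) (y3 : forall N : nat, \sum_(k < N) y k <= 3).
Hypothesis sr : forall k, s k.+1 = 2 * s k \/ s k = 2 * s k.+1.
Hypothesis loc : forall k s1 s2, s k < s1 -> s1 < s2 -> s2 < 2 * s k -> ~ Z s1 -> ~ Z s2 ->
  `|v s1 - v s2| <= H * (s k `^ (- A) * (X * x k) `^ p^-1) * ((s2 - s1) / s k) `^ (1 - p^-1).
Hypothesis adj : forall k s1 s2, s k < s1 -> s1 < 2 * s k ->
  s k.+1 < s2 -> s2 < 2 * s k.+1 -> ~ Z s1 -> ~ Z s2 ->
  `|v s1 - v s2| <= H * (s k `^ (- A) * (X * (x k + x k.+1)) `^ p^-1).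
Hypothesis vb : forall k, a < 1 ->
  (\int[leb]_(t in `]s k, (2 * s k)%R[) (`|v t| `^ q)%:E <=
   (s k * (H' * (s k `^ (- (B * q)) * (Y * y k))))%:E)%E.
Hypothesis v0 : forall t, s 0 < t -> t < 2 * s 0 -> ~ Z t -> v t = 0.

Let W : R := X `^ e1 * Y `^ e2.

Let W0 : 0 <= W. Proof. by rewrite mulr_ge0 ?powR_ge0. Qed.

(** The place where [scaling] removes the length r, so that every dyadic interval obeys the same
    bound. *)
Let cancel_weight (r z w : R) : 0 < r -> 0 < z -> 0 < w ->
  (r `^ (- A) * (X * z) `^ p^-1) `^ a * (r `^ (- (B * q)) * (Y * w)) `^ e2 =
  W * (z `^ e1 * w `^ e2).
Proof.
move=> r0 z0 w0.
have Xz : 0 <= X * z by rewrite mulr_ge0 ?ltW.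
have Yw : 0 <= Y * w by rewrite mulr_ge0 ?ltW.
rewrite !powRM ?mulr_ge0 ?powR_ge0 ?(ltW X0) ?(ltW Y0) ?(ltW z0) ?(ltW w0)//.
rewrite -!powRrM.
have -> : r `^ (- A * a) = r `^ (B * q * e2).
  congr powR; have -> : B * q * e2 = (1 - a) * B.
    by rewrite /e2; field; rewrite gt_eqF.
  by have := scaling; lra.
have -> : p^-1 * a = e1 by rewrite mulrC.
have rr : r `^ (B * q * e2) * r `^ (- (B * q) * e2) = 1.
  by rewrite -powRD ?(gt_eqF r0) ?implybT// mulNr subrr powRr0.
transitivity ((r `^ (B * q * e2) * r `^ (- (B * q) * e2)) *
  (X `^ e1 * z `^ e1 * (Y `^ e2 * w `^ e2))); first by ring.
by rewrite rr /W; ring.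
Qed.

(** Twice the available bound on the mean of |v|^q, so that the strict inequality of [good_point]
    holds. *)
Let b k : R := 2 * H' * (s k `^ (- (B * q)) * (Y * y k)).

Let b0 k : 0 < b k.
Proof. by rewrite !mulr_gt0// powR_gt0. Qed.

Let pts k : exists t, [/\ s k < t, t < 2 * s k, ~ Z t & a < 1 -> `|v t| `^ q <= b k].
Proof.
have [al|ag] := ltP a 1.
  have [|t [h1 h2 h3 h4]] := @good_point R v Z (s k) q (b k) (s0 k) mv nZ.
    apply: le_lt_trans (vb k al) _; rewrite lte_fin ltr_pM2l// /b -[ltRHS]mulrA.
    by rewrite [ltRHS]mulr_natl mulr2n ltrDl !mulr_gt0// powR_gt0.
  by exists t.
have [t [h1 h2 h3]] := avoid_negligible (s0 k) nZ.
by exists t; split => //; rewrite ltNge ag.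
Qed.

Let c k : R := v (sval (cid (pts k))).

Let c0 : c 0 = 0.
Proof. by rewrite /c; case: cid => t/= [h1 h2 h3 _]; exact: v0. Qed.

Let D : R := 2 * H' * 2 `^ `|B * q|.

(** The difference is at most the gradient bound [adj] and, for a < 1, at most the sum of the
    heights at the two good points. The product of the powers a and 1 - a of these bounds is free of
    the scale by [cancel_weight]. *)
Let step_c k : `|c k - c k.+1| <=
  step_const * W * (x k + x k.+1 + (y k + y k.+1)) `^ e.
Proof.
rewrite /c; case: cid => t/= [h1 h2 h3 h4]; case: cid => t'/= [h1' h2' h3' h4'].
set dl := `|v t - v t'|.
set z := x k + x k.+1; set w := y k + y k.+1.
have z0 : 0 < z by rewrite addr_gt0.
have w0 : 0 < w by rewrite addr_gt0.
have D0 : 0 <= D by rewrite !mulr_ge0 ?powR_ge0// ltW.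
have dl0 : 0 <= dl by exact: normr_ge0.
have sc0 : 0 <= step_const by rewrite mulr_ge0 ?powR_ge0.
have [->|dn0] := eqVneq dl 0; first by rewrite !mulr_ge0 ?powR_ge0.
have -> : dl = dl `^ a * dl `^ (1 - a).
  by rewrite -powRD ?(negbTE dn0) ?implybT// addrC subrK powRr1.
pose P := s k `^ (- (B * q)) * (Y * w).
have P0 : 0 <= P by rewrite mulr_ge0 ?powR_ge0// mulr_ge0 ?(ltW Y0) ?(ltW w0).
have L1 : dl <= H * (s k `^ (- A) * (X * z) `^ p^-1) by exact: adj.
have L2 : a < 1 -> dl <= 2 * (D * P) `^ q^-1.
  move=> al; apply: le_trans (ler_normB _ _) _.
  have root (r : R) : `|r| `^ q <= D * P -> `|r| <= (D * P) `^ q^-1.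
    move=> h; rewrite -[leLHS]powRr1// -(mulfV (lt0r_neq0 q0)) powRrM.
    by rewrite ge0_ler_powR ?nnegrE ?powR_ge0 ?invr_ge0 ?(ltW q0) ?(mulr_ge0 D0 P0).
  have k2 : 1 <= 2 `^ `|B * q| :> R.
    by rewrite -[leLHS](powRr0 2) ler_powR// ler1n.
  have R1 : `|v t| <= (D * P) `^ q^-1.
    apply/root/(le_trans (h4 al)); rewrite /b /D -(mulrA (2 * H') _ P) ler_pM2l ?mulr_gt0//.
    apply: le_trans (ler_peMl P0 k2); rewrite ler_wpM2l ?powR_ge0// ler_pM2l//.
    by rewrite lerDl ltW.
  have R2 : `|v t'| <= (D * P) `^ q^-1.
    apply/root/(le_trans (h4' al)); rewrite /b /D -(mulrA (2 * H') _ P) ler_pM2l ?mulr_gt0//.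
    rewrite /P (mulrA (2 `^ _)); apply: ler_pM; rewrite ?powR_ge0 ?mulr_ge0 ?(ltW Y0) ?(ltW (y0 _))//.
      rewrite -normrN; apply: powR_doubling => //.
        by case: (sr k) => ->; rewrite // ?mulrA ler_peMl ?ltW// ?ltr1n//; lra.
      by case: (sr k) => ->; rewrite // ?mulrA ler_peMl ?ltW// ?ltr1n//; lra.
    by rewrite ler_pM2l// lerDr ltW.
  by rewrite mulr_natl mulr2n; exact: lerD.
have M1 : dl `^ a <= H `^ a * (s k `^ (- A) * (X * z) `^ p^-1) `^ a.
  rewrite -powRM ?(ltW H0) ?mulr_ge0 ?powR_ge0// ge0_ler_powR ?nnegrE ?(ltW a0)//.
  by rewrite !mulr_ge0 ?powR_ge0// ltW.
have M2 : dl `^ (1 - a) <= (2 * D `^ q^-1) `^ (1 - a) * P `^ e2.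
  have [al|ag] := ltP a 1; last first.
    have ea : a = 1 by apply/eqP; rewrite eq_le ag; case/andP: a01 => _ ->.
    by rewrite /e2 ea subrr mul0r !powRr0 mulr1.
  have -> : P `^ e2 = (P `^ q^-1) `^ (1 - a) by rewrite -powRrM mulrC.
  rewrite -powRM ?mulr_ge0 ?powR_ge0// -mulrA -powRM//.
  by rewrite ge0_ler_powR ?nnegrE ?mulr_ge0 ?powR_ge0//; exact: L2.
apply: le_trans (ler_pM _ _ M1 M2) _; rewrite ?powR_ge0//.
rewrite [leLHS]mulrACA.
have -> : (s k `^ (- A) * (X * z) `^ p^-1) `^ a * P `^ e2 = W * (z `^ e1 * w `^ e2).
  exact: cancel_weight.
rewrite -[X in X * _ <= _]/step_const [leLHS]mulrA; apply: ler_wpM2l.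
  exact: (mulr_ge0 sc0 W0).
have zw : 0 < z + w by rewrite addr_gt0.
(* z and w are both replaced by z + w, which merges the exponents e1 and e2 into e. *)
rewrite /e powRD ?(gt_eqF zw) ?implybT//.
apply: ler_pM; rewrite ?powR_ge0// ge0_ler_powR ?nnegrE ?(ltW z0) ?(ltW w0) ?(ltW zw)//.
  by rewrite lerDl ltW.
by rewrite lerDr ltW.
Qed.

(* z^e <= N^-e (1 + N z) takes the place of Hoelder's inequality for sums. *)
Let c_le N : (0 < N)%N -> `|c N| <= 13 * step_const * W * N%:R `^ (1 - e).
Proof.
move=> N0; have Np : 0 < N%:R :> R by rewrite ltr0n.
have sc0 : 0 <= step_const by rewrite mulr_ge0 ?powR_ge0.
pose t k := x k + x k.+1 + (y k + y k.+1).
have tel M : `|c M| <= \sum_(k < M) step_const * W * t k `^ e.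
  elim: M => [|M IH]; first by rewrite big_ord0 c0 normr0.
  rewrite big_ord_recr/=; apply: le_trans (lerD IH (step_c M)).
  rewrite -[X in `|X| <= _](subrKC (c M)); apply: le_trans (ler_normD _ _) _.
  by rewrite lerD2l distrC.
have shift (f : nat -> R) : (forall k, 0 < f k) -> \sum_(k < N) f k.+1 <= \sum_(k < N.+1) f k.
  by move=> f0; rewrite big_ord_recl/= lerDr ltW.
(* Four sums of at most 3 each; with the 1 from [powR_le_linear] they make up the constant 13. *)
have tsum : \sum_(k < N) t k <= 12.
  rewrite /t !big_split/=.
  have := shift x x0; have := shift y y0; have := x3 N; have := y3 N.
  have := x3 N.+1; have := y3 N.+1; lra.
apply: le_trans (tel N) _; rewrite -mulr_sumr.
have -> : 13 * step_const * W * N%:R `^ (1 - e) = step_const * W * (13 * N%:R `^ (1 - e)) by ring.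
have SW : 0 <= step_const * W by exact: mulr_ge0.
rewrite (ler_wpM2l SW)//.
apply: (@le_trans _ _ (\sum_(k < N) (N%:R `^ (- e) * (1 + N%:R * t k)))).
  apply: ler_sum => k _; apply: powR_le_linear => //.
  by rewrite !addr_ge0// ltW.
rewrite -mulr_sumr big_split/= sumr_const card_ord -mulr_sumr.
have -> : N%:R `^ (1 - e) = N%:R `^ (- e) * N%:R :> R.
  by rewrite powRD ?(gt_eqF Np) ?implybT// powRr1 ?ltW// mulrC.
rewrite mulrCA ler_wpM2l ?powR_ge0//.
have : N%:R * \sum_(k < N) t k <= N%:R * 12 by rewrite ler_pM2l.
lra.
Qed.

Notation J k := (`]s k, (2 * s k)%R[%classic : set R).

Let x3' k : x k <= 3.
Proof.
apply: le_trans (x3 k.+1); rewrite big_ord_recr/= lerDr.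
by apply: sumr_ge0 => i _; exact: ltW.
Qed.

Let y3' k : y k <= 3.
Proof.
apply: le_trans (y3 k.+1); rewrite big_ord_recr/= lerDr.
by apply: sumr_ge0 => i _; exact: ltW.
Qed.

Let cell_const : R :=
  2 `^ tau * (local_const p q tau a * (H `^ a * (2 * H') `^ e2 * 3 `^ e1 * 3 `^ e2) `^ tau
    + (13 * step_const) `^ tau).

Let lc0 : 0 <= local_const p q tau a.
Proof. by rewrite !addr_ge0// ?mulr_ge0 ?powR_ge0. Qed.

Let lJ k : leb (J k) = (s k)%:E.
Proof.
have s2 : s k < 2 * s k by rewrite ltr_pMl// ltr1n.
by rewrite lebesgue_measure_itv/= lte_fin s2 -EFinB; congr EFin; ring.
Qed.

(** v is compared with its point value on the interval: [local_interpolation] bounds the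
    oscillation, and [c_le] the point value after k + 1 steps from 0. *)
Let cell k : (\int[leb]_(t in J k.+1) (`|v t| `^ tau)%:E <=
  (s k.+1 * (cell_const * W `^ tau * k.+1%:R `^ (tau * (1 - e))))%:E)%E.
Proof.
have := c_le (ltn0Sn k); rewrite /c; case: cid => t/= [h1 h2 h3 h4] hc.
set j := k.+1 in h1 h2 h3 h4 hc *.
pose G := H * (s j `^ (- A) * (X * x j) `^ p^-1).
have G0 : 0 < G by rewrite !mulr_gt0 ?powR_gt0 ?mulr_gt0.
have LI := @local_interpolation R p q tau a p1 q1 tau1 a01 cond v Z (s j) G (b j) t
  (s0 j) G0 (b0 j) mv nZ (loc (k := j)) _ h1 h2 h3 h4.
have {}LI := LI _.
have vb' : a < 1 -> (\int[leb]_(t in `]s j, (2 * s j)%R[) (`|v t| `^ q)%:E <= (s j * b j)%:E)%E.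
  move=> al; apply: le_trans (vb j al) _; rewrite lee_fin ler_pM2l// /b -[leRHS]mulrA.
  by rewrite [leRHS]mulr_natl mulr2n lerDl ltW// !mulr_gt0// powR_gt0.
have {vb'} LI := LI vb'.
(* Lets the oscillation term, which does not grow with j, take the growth factor of the point
   values. *)
have jp : 1 <= j%:R `^ (tau * (1 - e)) :> R.
  rewrite -[leLHS](powRr0 j%:R) ler_powR ?ler1n//.
  by rewrite mulr_ge0 ?(ltW t0)// subr_ge0; case/andP: e01.
have GE : G `^ a * b j `^ ((1 - a) / q) <=
    H `^ a * (2 * H') `^ e2 * 3 `^ e1 * 3 `^ e2 * W.
  rewrite /G /b !(@powRM _ H) ?(@powRM _ (2 * H')) ?(ltW H0) ?mulr_ge0 ?powR_ge0 ?(ltW Y0) ?(ltW H'0) ?(ltW (y0 _))//.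
  rewrite mulrACA cancel_weight// -!mulrA ler_wpM2l ?powR_ge0// ler_wpM2l ?powR_ge0//.
  rewrite (mulrA (3 `^ e1)) [leRHS]mulrC mulrA ler_wpM2l//; apply: ler_pM; rewrite ?powR_ge0//.
    by rewrite ge0_ler_powR ?nnegrE ?(ltW (x0 _)).
  by rewrite ge0_ler_powR ?nnegrE ?(ltW (y0 _)).
have mvt : measurable_fun setT (fun r => (`|v r - v t| `^ tau)%:E).
  apply/measurable_EFinP; apply: (measurableT_comp (measurable_powR _)).
  by apply: measurableT_comp => //; exact: measurable_funB.
have mJ : measurable (J j) by exact: measurable_itv.
have S1 : (\int[leb]_(r in J j) (`|v r| `^ tau)%:E <=
   (2 `^ tau)%:E * (\int[leb]_(r in J j) (`|v r - v t| `^ tau)%:E + (`|v t| `^ tau * s j)%:E))%E.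
  apply: (@le_trans _ _ (\int[leb]_(r in J j) ((2 `^ tau)%:E * ((`|v r - v t| `^ tau)%:E + (`|v t| `^ tau)%:E)))%E).
    apply: ge0_le_integral => //.
    - apply: measurable_funTS; apply/measurable_EFinP.
      by apply: (measurableT_comp (measurable_powR _)); exact: measurableT_comp.
    - apply: measurable_funTS; apply: emeasurable_funM => //.
      exact: emeasurable_funD.
    - move=> r _; rewrite -EFinD -EFinM lee_fin.
      apply: (@le_trans _ _ ((`|v r - v t| + `|v t|) `^ tau)).
        rewrite ge0_ler_powR ?nnegrE ?addr_ge0 ?(ltW t0)//.
        by rewrite -[X in `|X| <= _](subrK (v t)) ler_normD.
      by apply: powR_add_le => //; exact: ltW.
  rewrite ge0_integralZl//; last 2 first.
  - by apply: measurable_funTS; exact: emeasurable_funD.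
  - by move=> r _; rewrite adde_ge0.
  rewrite ge0_integralD//; last exact: measurable_funTS.
  by rewrite integral_cst// [X in (_ * (_ + _ * X))%E]lJ.
apply: le_trans S1 _.
apply: (@le_trans _ _ ((2 `^ tau)%:E * ((local_const p q tau a * s j *
   (G `^ a * b j `^ ((1 - a) / q)) `^ tau)%:E + (`|v t| `^ tau * s j)%:E))%E).
  by apply: lee_wpmul2l => //; exact: leeD.
rewrite -EFinD -EFinM lee_fin.
have E1 : (G `^ a * b j `^ ((1 - a) / q)) `^ tau <=
  (H `^ a * (2 * H') `^ e2 * 3 `^ e1 * 3 `^ e2) `^ tau * W `^ tau * j%:R `^ (tau * (1 - e)).
  rewrite -powRM ?mulr_ge0 ?powR_ge0//; apply: le_trans (ler_peMr _ jp); last exact: powR_ge0.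
  by rewrite ge0_ler_powR ?nnegrE ?mulr_ge0 ?powR_ge0 ?(ltW t0).
have E2 : `|v t| `^ tau <= (13 * step_const) `^ tau * W `^ tau * j%:R `^ (tau * (1 - e)).
  have sc0 : 0 <= step_const by rewrite mulr_ge0 ?powR_ge0.
  rewrite [tau * (1 - e)]mulrC powRrM -!powRM ?mulr_ge0 ?powR_ge0//.
  by rewrite ge0_ler_powR ?nnegrE ?mulr_ge0 ?powR_ge0 ?(ltW t0).
have -> : s j * (cell_const * W `^ tau * j%:R `^ (tau * (1 - e))) =
  2 `^ tau * (local_const p q tau a * s j *
      ((H `^ a * (2 * H') `^ e2 * 3 `^ e1 * 3 `^ e2) `^ tau * W `^ tau * j%:R `^ (tau * (1 - e)))
   + (13 * step_const) `^ tau * W `^ tau * j%:R `^ (tau * (1 - e)) * s j).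
  rewrite /cell_const.
  move: (local_const p q tau a) (_ `^ tau) ((13 * step_const) `^ tau) (W `^ tau)
    (j%:R `^ _) (2 `^ tau) => L Q1 Q2 Q3 Q4 Q5; ring.
rewrite ler_wpM2l ?powR_ge0//; apply: lerD.
  by rewrite ler_wpM2l// mulr_ge0// ltW.
by rewrite ler_pM2r.
Qed.

(** [om] is the radial weight in the variable |x|^n. Its factor 1 / s k.+1 cancels the length of the
    interval in [cell], and the remaining powers of k.+1 combine to exponent - kap. *)
Lemma chain_estimate (om : R -> R) : measurable_fun setT om -> (forall t, 0 <= om t) ->
  trivIset setT (fun k => J k.+1) ->
  (forall k t, s k.+1 < t -> t < 2 * s k.+1 -> om t <= (s k.+1)^-1 * k.+1%:R `^ (- mu)) ->
  (\int[leb]_(t in \bigcup_k J k.+1) (om t * `|v t| `^ tau)%:E <=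
   (chain_const * (X `^ (a / p) * Y `^ ((1 - a) / q)) `^ tau)%:E)%E.
Proof.
move=> mom om0 tJ omle.
have mvt : measurable_fun setT (fun t => `|v t| `^ tau).
  by apply: (measurableT_comp (measurable_powR _)); exact: measurableT_comp.
have mf : measurable_fun setT (fun t => (om t * `|v t| `^ tau)%:E).
  by apply/measurable_EFinP; exact: measurable_funM.
have f0 t : (0 <= (om t * `|v t| `^ tau)%:E)%E by rewrite lee_fin mulr_ge0// powR_ge0.
have mJ k : measurable (J k) by exact: measurable_itv.
rewrite ge0_integral_bigcup//; last exact: measurable_funTS.
have cc0 : 0 <= cell_const.
  by rewrite mulr_ge0 ?addr_ge0 ?mulr_ge0 ?powR_ge0.
have cW : 0 <= cell_const * W `^ tau by rewrite mulr_ge0// powR_ge0.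
have cellw k : (\int[leb]_(t in J k.+1) (om t * `|v t| `^ tau)%:E <=
    (cell_const * W `^ tau * k.+1%:R `^ (- kap))%:E)%E.
  set j := k.+1; pose om1 := (s j)^-1 * j%:R `^ (- mu).
  have om10 : 0 <= om1 by rewrite mulr_ge0 ?powR_ge0// invr_ge0 ltW.
  apply: (@le_trans _ _ (\int[leb]_(t in J j) (om1%:E * (`|v t| `^ tau)%:E))%E).
    apply: ge0_le_integral => //.
    - exact: measurable_funTS.
    - by apply: measurable_funTS; apply/measurable_EFinP; exact: measurable_funM.
    - move=> t; rewrite /= in_itv/= => /andP[t1 t2].
      by rewrite -EFinM lee_fin ler_wpM2r ?powR_ge0//; exact: omle.
  rewrite ge0_integralZl//; last by apply: measurable_funTS; exact/measurable_EFinP.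
  apply: le_trans (lee_wpmul2l _ (cell k)) _ => //.
  rewrite -EFinM lee_fin -/j le_eqVlt; apply/orP; left; apply/eqP.
  have -> : j%:R `^ (- kap) = j%:R `^ (- mu) * j%:R `^ (tau * (1 - e)) :> R.
    by rewrite -powRD ?pnatr_eq0 ?implybT//; congr powR; rewrite /kap; ring.
  by rewrite /om1; field; rewrite gt_eqF.
apply: le_trans (lee_nneseries _ _) _; [|by move=> k _; exact: cellw|].
  by move=> k _ _; exact: integral_ge0.
apply: lime_le.
  by apply: is_cvg_nneseries => k _ _; rewrite lee_fin (mulr_ge0 cW)// powR_ge0.
apply: nearW => N; rewrite sumEFin lee_fin big_mkord -mulr_sumr.
have -> : chain_const * (X `^ (a / p) * Y `^ ((1 - a) / q)) `^ tau =
  cell_const * W `^ tau * (1 + (kap - 1)^-1).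
  rewrite -[chain_const]/(cell_const * (1 + (kap - 1)^-1)); exact: mulrAC.
by rewrite (ler_wpM2l cW)//; exact: powR_sum_le.
Qed.

End chain.

(** * Dyadic sequences and normalized weights *)

Section dyadic.
Context {R : realType}.
Notation leb := (@lebesgue_measure R).

(** Halving sequences serve functions supported in a ball, doubling ones functions that vanish near
    the origin. *)
Definition dyadic (s : nat -> R) : Prop := (forall k, 0 < s k) /\
  ((forall k, s k.+1 = 2 * s k) \/ (forall k, s k = 2 * s k.+1)).

Lemma dyadic_trivIset s : dyadic s ->
  trivIset setT (fun k => `[s k, (2 * s k)%R[%classic : set R).
Proof.
move=> [s0 sD]; apply: ltn_trivIset => j i ij.
rewrite -subset0 => t [] /=; rewrite !in_itv/= => /andP[i1 i2] /andP[j1 j2].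
case: sD => sE.
- have h m : s i.+1 <= s (i.+1 + m)%N.
    elim: m => [|m IH]; first by rewrite addn0.
    rewrite addnS [leRHS]sE; apply: (le_trans IH); rewrite ler_peMl ?(ltW (s0 _))// ler1n //.
  have := h (j - i.+1)%N; rewrite subnKC// sE; lra.
- have h m : s (i.+1 + m)%N <= s i.+1.
    elim: m => [|m IH]; first by rewrite addn0.
    by apply: (le_trans _ IH); rewrite addnS [leRHS]sE ler_peMl ?(ltW (s0 _))// ler1n.
  have := h (j - i.+1)%N; rewrite subnKC//; have := sE i; lra.
Qed.

Lemma dyadic_head s t : dyadic s -> s 0 <= t < 2 * s 0 ->
  forall k, ~ (s k.+1 <= t < 2 * s k.+1).
Proof.
move=> /dyadic_trivIset tI t0 k tk; suff : 0%N = k.+1 by [].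
by apply: (tI 0 k.+1 I I); exists t; rewrite /= !in_itv.
Qed.

Lemma sum_integral_le d (T : measurableType d) (m : {measure set T -> \bar R})
  (D : set T) (F : nat -> set T) (f : T -> \bar R) :
  measurable D -> (forall k, measurable (F k)) -> (forall k, F k `<=` D) ->
  trivIset setT F -> measurable_fun D f -> (forall x, 0 <= f x)%E ->
  forall N, (\sum_(k < N) \int[m]_(x in F k) f x <= \int[m]_(x in D) f x)%E.
Proof.
move=> mD mF FD tF mf f0 N.
have mU : measurable (\big[setU/set0]_(k <- index_iota 0 N) F k).
  exact: bigsetU_measurable.
have UD : \big[setU/set0]_(k <- index_iota 0 N) F k `<=` D.
  by rewrite -bigcup_seq => x [k _ /FD].
rewrite -(big_mkord xpredT (fun k => \int[m]_(x in F k) f x)%E).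
rewrite -ge0_integral_bigsetU ?iota_uniq//.
- exact: ge0_subset_integral.
- by apply: sub_trivIset tF.
- exact: measurable_funS mf.
Qed.

(* The summand 2^-k keeps the weights positive. *)
Lemma normalize_series (E : nat -> \bar R) (X : R) : 0 < X -> (forall k, 0 <= E k)%E ->
  (forall N, \sum_(k < N) E k <= X%:E)%E ->
  exists x : nat -> R, [/\ forall k, 0 < x k, forall N, \sum_(k < N) x k <= 3 &
    forall k, (E k <= (X * x k)%:E)%E].
Proof.
move=> X0 E0 EX.
have Efin k : E k \is a fin_num.
  rewrite ge0_fin_numE//; apply: le_lt_trans (ltry X); apply: le_trans (EX k.+1).
  rewrite big_ord_recr/=; apply: leeDr; exact: sume_ge0.
exists (fun k => fine (E k) / X + 2^-1 ^+ k); split => [k|N|k].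
- by rewrite ltr_wpDl ?exprn_gt0// divr_ge0 ?fine_ge0// ltW.
(* 1 for the energy fractions and 2 for the geometric series. *)
- have -> : 3 = 1 + 2 :> R by ring.
  rewrite big_split/=; apply: lerD.
    rewrite -mulr_suml ler_pdivrMr// mul1r -lee_fin -sumEFin.
    by under eq_bigr do rewrite fineK//; exact: EX.
  suff -> : \sum_(k < N) 2^-1 ^+ k = 2 * (1 - 2^-1 ^+ N) :> R.
    by rewrite mulrBr mulr1 gerBl mulr_ge0// exprn_ge0.
  elim: N => [|N IH]; first by rewrite big_ord0 expr0 subrr mulr0.
  by rewrite big_ord_recr/= IH exprS; field.
- rewrite mulrDr mulrC divfK ?gt_eqF// EFinD fineK//.
  by rewrite leeDl// lee_fin mulr_ge0 ?exprn_ge0// ltW.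
Qed.

End dyadic.

(** * Vanishing outside the essential support *)

Section support.
Context {R : realType} {n : nat}.
Hypothesis n0 : (0 < n)%N.
Notation leb := (@lebesgue_measure R).
Notation mu := (@lebesgue_rV R n).

(* The sets whose complement in K is, up to a null set, a zero set of u form a
   filter; it would cluster in K at a point of the essential support. *)
Lemma ess_supp_compact (u : 'rV[R]_n -> R) (K : set 'rV[R]_n) : compact K ->
  (forall x, K x -> ~ ess_supp u x) -> {ae mu, forall x, K x -> u x = 0}.
Proof.
move=> cK Ku.
pose F : set (set 'rV[R]_n) := [set A | {ae mu, forall x, (K `\` A) x -> u x = 0}].
have FF : Filter F.
  split.
  - by rewrite /F/=; apply: aeW => x [_ []].
  - move=> A B; rewrite /F/= => hA hB; apply: filterS2 hA hB => x h1 h2 [Kx /not_andP[]] h.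
      exact: h1.
    exact: h2.
  - by move=> A B AB; rewrite /F/=; apply: filterS => x h [Kx nB]; apply: h; split => // /AB.
apply: contrapT => nK.
have PF : ProperFilter F.
  split => // h; apply: nK; move: h; rewrite /F/=; apply: filterS => x h Kx.
  by apply: h; split => //; case.
have FK : F K by rewrite /F/=; apply: aeW => x []; tauto.
have [x [Kx clx]] := cK F PF FK.
apply: (Ku x Kx) => V nV hV.
have FV : F (~` V).
  by rewrite /F/=; apply: filterS hV => y h [Ky /contrapT Vy]; exact: h.
by have [y [nVy Vy]] := clx _ _ FV nV.
Qed.

Variables (u : 'rV[R]_n -> R) (v : R -> R).
Hypothesis mv : measurable_fun setT v.
Hypothesis uv : {ae mu, forall x, u x = v (enormX x)}.

(** [ess_supp_compact] treats one compact set at a time, so the region is given as a countable union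
    of closed annuli. *)
Lemma profile_vanish (al bl : nat -> R) : (forall j, 0 < al j) ->
  (forall j x, al j <= enormX x <= bl j -> ~ ess_supp u x) ->
  leb.-negligible [set s | (exists j, al j <= s <= bl j) /\ v s != 0].
Proof.
move=> al0 hs.
have sub : [set s | (exists j, al j <= s <= bl j) /\ v s != 0] `<=`
    \bigcup_j [set s | al j <= s <= bl j /\ v s != 0].
  by move=> s [[j hj] vs]; exists j.
suff h : leb.-negligible (\bigcup_j [set s | al j <= s <= bl j /\ v s != 0]).
  have [N [mN N0 sN]] := h; exists N; split => //; exact: subset_trans sub sN.
apply: negligible_bigcup => j.
pose A := `[al j, bl j]%classic `&` (v @^-1` (~` [set 0])).
have mA : measurable A.
  apply: measurableI; first exact: measurable_itv.
  by rewrite -[X in measurable X]setTI; apply: mv => //; apply: measurableC; exact: measurable_set1.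
have AE : [set s | al j <= s <= bl j /\ v s != 0] = A.
  apply/seteqP; split => s /=; rewrite /A/= in_itv/=.
    by move=> [h /eqP].
  by move=> [h /eqP].
have A0 : A `&` pos = A.
  by apply/setIidl => s []; rewrite /= in_itv/= => /andP[h _] _; exact: lt_le_trans h.
rewrite AE; apply/negligibleP => //.
have K := ess_supp_compact (@compact_annulus R n n0 (al j) (bl j)) (hs j).
have mX : measurable ((@enormX R n) @^-1` A).
  by rewrite -[X in measurable X]setTI; apply: measurable_enormX.
have : mu ((@enormX R n) @^-1` A) = 0%E.
  apply: measure_negligible => //.
  have [N [mN N0 sN]] := filterI K uv; exists N; split => //; apply: subset_trans sN.
  move=> x /= [h1 h2] [h3 h4]; apply: h2; rewrite -h4; apply: h3.
  by move: h1; rewrite /= in_itv.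
rewrite polar_measure// A0 => /eqP; rewrite mule_eq0 eqe gt_eqF ?ball_vol_gt0//=.
by move/eqP.
Qed.

Lemma profile_vanish_outside (r : R) : 0 < r -> ess_supp u `<=` eball r ->
  leb.-negligible [set s | r ^+ n <= s /\ v s != 0].
Proof.
move=> r0 su.
apply: (negligibleS _ (profile_vanish (al := fun=> r ^+ n) (bl := fun j => r ^+ n + j%:R) _ _)).
- move=> s [rs vs]; split => //; exists (Num.truncn (s - r ^+ n)).+1.
  by rewrite rs/= -lerBlDl ltW// truncnS_gt.
- by move=> _; exact: exprn_gt0.
- move=> j x /andP[h _] /su; rewrite /eball/= => h'.
  have : enormX x < r ^+ n by rewrite /enormX ltrXn2r ?enorm_ge0// ?lt0n_neq0// ltW.
  by rewrite ltNge h.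
Qed.

Lemma profile_vanish_inside (r : R) : 0 < r -> ess_supp u `&` eball r = set0 ->
  leb.-negligible [set s | 0 < s < r ^+ n /\ v s != 0].
Proof.
move=> r0 su; have c0 : 0 < r ^+ n by exact: exprn_gt0.
(* Closed annuli strictly inside the open ball and away from 0, exhausting the punctured ball as j
   grows. *)
apply: (negligibleS _ (profile_vanish (al := fun j => r ^+ n / j.+1%:R)
  (bl := fun j => r ^+ n - r ^+ n / j.+1%:R) _ _)).
- move=> s [/andP[s0 sc] vs]; split => //.
  pose m := Num.min s (r ^+ n - s).
  have m0 : 0 < m by rewrite lt_min s0 subr_gt0.
  exists (Num.truncn (r ^+ n / m)).
  set J := (X in X.+1).
  have : r ^+ n / J.+1%:R <= m.
    by rewrite ler_pdivrMr// mulrC -ler_pdivrMr// ltW// truncnS_gt.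
  by rewrite le_min => /andP[-> /= h]; rewrite lerBrDr -lerBrDl.
- by move=> j; rewrite divr_gt0.
- move=> j x /andP[_ h] sx.
  have : eball r x.
    rewrite /eball/= ltNge; apply/negP => rx.
    have : r ^+ n <= enormX x by rewrite /enormX lerXn2r// nnegrE ?enorm_ge0// ltW.
    have d0 : 0 < r ^+ n / j.+1%:R by rewrite divr_gt0.
    by move=> /le_trans /(_ h); rewrite leNgt => /negP; apply; rewrite ltrBlDr ltrDl.
  by move=> ex; have : (ess_supp u `&` eball r) x by []; rewrite su.
Qed.

End support.

(** * The critical inequality *)

Section radial_chain.
Context {R : realType} {n : nat}.
Hypothesis n0 : (0 < n)%N.
Notation leb := (@lebesgue_measure R).
Notation mu := (@lebesgue_rV R n).

Variables (p q tau a kap al be : R).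
Hypotheses (p1 : 1 <= p) (q1 : 1 <= q) (tau1 : 1 <= tau) (a01 : 0 < a <= 1).
Let A : R := p^-1 + (al - 1) / n%:R.
Let B : R := q^-1 + be / n%:R.
Let c : R := be * q / n%:R.

(** Two neighbouring dyadic intervals form a window [m, 4 m[, hence the ratio 4; 2^|A| replaces m by
    s k, which may be the larger scale, and the last 4 bounds the relative distance to the power 1 -
    1/p. In H', 2^|c| compares t^c with (s k)^c. *)
Let H : R := @hoelder_const R n p al 4 * 2 `^ `|A| * 4.
Let H' : R := 2 `^ `|c| / ball_vol n.

Let w0 : 0 < ball_vol n :> R. Proof. exact: ball_vol_gt0. Qed.
Let p0 : 0 < p. Proof. exact: lt_le_trans p1. Qed.
Let q0 : 0 < q. Proof. exact: lt_le_trans q1. Qed.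

Let hc_gt0 (K : R) : 0 < K -> 0 < @hoelder_const R n p al K.
Proof. by move=> K0; rewrite divr_gt0 ?mulr_gt0 ?powR_gt0 ?mulr_gt0. Qed.

Variables (u : 'rV[R]_n -> R) (g : 'rV[R]_n -> 'rV[R]_n) (v : R -> R).
Hypothesis lu : Lp_loc punctured 1 u.
Hypothesis mv : measurable_fun setT v.
Hypothesis uv : {ae mu, forall x, u x = v (enormX x)}.
Hypothesis dg : distr_gradient punctured u g.

Let mg i : measurable_fun punctured (fun x => g x ord0 i).
Proof. by have [[]] := dg i. Qed.

Let y x := enorm x `^ al * enorm (g x).

Let mP : measurable (@punctured R n). Proof. exact: measurable_punctured. Qed.

Let my : measurable_fun punctured (fun x => (y x `^ p)%:E).
Proof.
apply/measurable_EFinP; apply: (measurableT_comp (measurable_powR _)).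
exact: measurable_weighted_grad.
Qed.

Let shell_punctured (r r' : R) : 0 < r -> shell r r' `<=` @punctured R n.
Proof.
by move=> r0 x /andP[h _]; rewrite /punctured/= -enormX_gt0//; exact: lt_le_trans h.
Qed.

Let energy_le (r r' : R) : 0 < r ->
  (energy g p al r r' <= \int[mu]_(x in punctured) (y x `^ p)%:E)%E.
Proof.
move=> r0; apply: ge0_subset_integral => //; [exact: measurable_shell| |exact: shell_punctured].
by move=> x _; rewrite lee_fin powR_ge0.
Qed.

Let energy_add (r r' r'' : R) : 0 < r -> r <= r' -> r' <= r'' ->
  energy g p al r r'' = (energy g p al r r' + energy g p al r' r'')%E.
Proof.
move=> r0 rr' rr''; have -> : energy g p al r r'' =
    (\int[mu]_(x in shell r r' `|` shell r' r'') (y x `^ p)%:E)%E.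
  congr (integral _ _ _); apply/seteqP; split => x /=.
    by move=> /andP[h1 h2]; have [h|h] := ltP (enormX x) r'; [left|right];
      rewrite /shell/= ?h1 ?h.
  by rewrite /shell/= => -[|] /andP[h1 h2]; lra.
rewrite ge0_integral_setU//.
- exact: measurable_shell.
- exact: measurable_shell.
- apply: measurable_funS my => // x [|]; apply: shell_punctured => //.
  exact: lt_le_trans rr'.
- by move=> x _; rewrite lee_fin powR_ge0.
- by apply/disj_setPS => x [/andP[_ h1] /andP[h2 _]]; lra.
Qed.

(** With zero energy, X in [hoelder_estimate] may be taken arbitrarily small, so v is constant off a
    null set; one interval on which it vanishes fixes the constant. This is the case that the
    positive X of the chain leaves out. *)
Lemma zero_gradient (Zv : set R) (m : R) : 0 < m -> leb.-negligible Zv ->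
  (forall t : R, m < t -> t < 2 * m -> ~ Zv t -> v t = 0) ->
  (\int[mu]_(x in punctured) (y x `^ p)%:E <= 0)%E ->
  leb.-negligible [set t | 0 < t /\ v t != 0].
Proof.
move=> m0 nZv vz E0.
have [Z nZ key] := key_estimate n0 lu mv uv dg.
have nZZ : leb.-negligible (Z `|` Zv) by exact: negligibleU.
have [t [t1 t2 /not_orP[Zt Zvt]]] := avoid_negligible m0 nZZ.
have eqv (s1 s2 : R) : 0 < s1 -> s1 < s2 -> ~ Z s1 -> ~ Z s2 -> v s1 = v s2.
  move=> s10 s12 Z1 Z2; apply/eqP; rewrite -subr_eq0 -normr_eq0; apply: contraT => dn.
  set dl := `|v s1 - v s2| in dn.
  have d0 : 0 < dl by rewrite lt_def dn normr_ge0.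
  pose r := s1 / 2; have r0 : 0 < r by rewrite divr_gt0.
  pose K := 2 * s2 / r.
  have Kr : K * r = 2 * s2 by rewrite divfK// gt_eqF.
  pose D := @hoelder_const R n p al K * r `^ (- A) * ((s2 - s1) / r) `^ (1 - p^-1).
  have K0 : 0 < K by rewrite divr_gt0// mulr_gt0// (lt_trans s10).
  have D0 : 0 <= D by rewrite mulr_ge0 ?powR_ge0// (mulr_ge0 (ltW (hc_gt0 K0)))// powR_ge0.
  (* Chosen so that the Hoelder bound becomes dl D / (2 (D + 1)), which is less than dl. *)
  pose X := (dl / (2 * (D + 1))) `^ p.
  have D1 : 0 < 2 * (D + 1) by rewrite mulr_gt0// ltr_pwDr.
  have X0 : 0 < X by rewrite powR_gt0// divr_gt0.
  have EX : (energy g p al r (K * r) <= X%:E)%E.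
    by apply: le_trans (energy_le _ r0) (le_trans E0 _); rewrite lee_fin ltW.
  have := hoelder_estimate n0 p1 mg key r0 X0 EX _ s12 _ Z1 Z2.
  rewrite Kr -/dl => /(_ _ _) h.
  have {}h : dl <= @hoelder_const R n p al K * (r `^ (- A) * X `^ p^-1) * ((s2 - s1) / r) `^ (1 - p^-1).
    by apply: h; rewrite /r; lra.
  have XE : X `^ p^-1 = dl / (2 * (D + 1)).
    by rewrite /X -powRrM mulfV ?gt_eqF// powRr1// divr_ge0 ?(ltW D1) ?(ltW d0).
  suff : dl < dl by rewrite ltxx.
  rewrite XE in h; apply: (le_lt_trans h).
  have -> : @hoelder_const R n p al K * (r `^ (- A) * (dl / (2 * (D + 1)))) * ((s2 - s1) / r) `^ (1 - p^-1) =
    D * (dl / (2 * (D + 1))) by rewrite /D; ring.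
  rewrite mulrA ltr_pdivrMr// mulrC ltr_pM2l//; lra.
have [N [mN N0 sN]] := nZ; exists N; split => //; apply: subset_trans sN.
move=> s [s0 vs]; apply: contrapT => Zs; move/eqP: vs; apply.
have t0 : 0 < t by exact: lt_trans t1.
have vt : v t = 0 by exact: vz.
have [st|ts|->//] := ltgtP s t; first by rewrite (eqv s t).
by rewrite -(eqv t s).
Qed.

Hypothesis cond : a * (p^-1 - 1) + (1 - a) * q^-1 <= tau^-1.
Hypothesis scaling : a * A + (1 - a) * B = 0.
Hypothesis taukap : tau <= kap.
Hypothesis e_gt : tau^-1 < a / p + (1 - a) / q.

Definition radial_const : R := chain_const p q tau a kap B H H'.

Let H0 : 0 < H.
Proof. by rewrite /H mulr_gt0// mulr_gt0 ?powR_gt0// hc_gt0. Qed.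

Let H'0 : 0 < H'. Proof. by rewrite divr_gt0 ?powR_gt0. Qed.

(** The restrictions of the two energies to the dyadic shells become the weights x and z of the
    chain, and the cells of index at least 1 carry v up to a null set. *)
Lemma radial_chain (s : nat -> R) (X Y : R) (Zv : set R) (om : R -> R) :
  dyadic s -> 0 < X -> 0 < Y ->
  (\int[mu]_(x in punctured) (y x `^ p)%:E <= X%:E)%E ->
  (a < 1 -> (\int[leb]_(t in pos) (ball_vol n * (t `^ c * `|v t| `^ q))%:E <= Y%:E)%E) ->
  leb.-negligible Zv ->
  (forall t : R, 0 < t -> ~ Zv t -> (forall k, ~ (s k.+1 <= t < 2 * s k.+1)) -> v t = 0) ->
  measurable_fun setT om -> (forall t, 0 <= om t) ->
  (forall k t, s k.+1 < t -> t < 2 * s k.+1 -> om t <= (s k.+1)^-1 * k.+1%:R `^ (- kap)) ->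
  (\int[leb]_(t in pos) (om t * `|v t| `^ tau)%:E <=
   (radial_const * (X `^ (a / p) * Y `^ ((1 - a) / q)) `^ tau)%:E)%E.
Proof.
move=> ds X0 Y0 EX EY nZv vout mom om0 omle.
have [s0 sD] := ds.
have tI := dyadic_trivIset ds.
have [Z1 nZ1 key] := key_estimate n0 lu mv uv dg.
(* The end points s k join the exceptional set, since the cells are open in the chain and half-open
   in [vout]. *)
pose Z := Z1 `|` Zv `|` range s.
have nZ : leb.-negligible Z.
  apply: negligibleU; first exact: negligibleU.
  have cs : countable (range s) by exact: (card_le_trans (card_image_le _ _)).
  have ms : measurable (range s) by exact: countable_measurable.
  by apply/negligibleP => //; exact: countable_lebesgue_measure0.
have Z1E t : ~ Z t -> ~ Z1 t by move=> h h'; apply: h; left; left.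
have ZvE t : ~ Z t -> ~ Zv t by move=> h h'; apply: h; left; right.
have [x [x0 x3 xE]] : exists x : nat -> R, [/\ forall k, 0 < x k, forall N, \sum_(k < N) x k <= 3 &
    forall k, (energy g p al (s k) (2 * s k) <= (X * x k)%:E)%E].
  apply: normalize_series => // [k|N].
    by apply: integral_ge0 => t _; rewrite lee_fin powR_ge0.
  apply: (le_trans _ EX); apply: (@sum_integral_le R _ _ mu punctured
    (fun k => shell (s k) (2 * s k)) (fun x => (y x `^ p)%:E)) => // [k|k||t].
  - exact: measurable_shell.
  - exact: shell_punctured.
  - move=> i j _ _ [t [h1 h2]]; apply: (tI i j I I); exists (enormX t).
    by rewrite /= !in_itv.
  - by rewrite lee_fin powR_ge0.
have mf : measurable_fun setT (fun t => (ball_vol n * (t `^ c * `|v t| `^ q))%:E).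
  apply/measurable_EFinP; apply: measurable_funM => //; apply: measurable_funM.
    exact: measurable_powR.
  by apply: (measurableT_comp (measurable_powR _)); exact: measurableT_comp.
have f0 t : (0 <= (ball_vol n * (t `^ c * `|v t| `^ q))%:E)%E.
  by rewrite lee_fin !mulr_ge0 ?powR_ge0// ltW.
(* Set to 0 for a = 1, where no bound on the L^q energy is given. *)
pose E k : \bar R := if a < 1 then
  (\int[leb]_(t in `[s k, (2 * s k)%R[) (ball_vol n * (t `^ c * `|v t| `^ q))%:E)%E else 0%E.
have [z [z0 z3 zE]] : exists z : nat -> R, [/\ forall k, 0 < z k, forall N, \sum_(k < N) z k <= 3 &
    forall k, (E k <= (Y * z k)%:E)%E].
  apply: normalize_series => // [k|N]; rewrite /E.
    by case: ifP => // _; apply: integral_ge0 => t _; exact: f0.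
  have [a1|_] := ltP a 1; last by rewrite big1// lee_fin ltW.
  apply: (le_trans _ (EY a1)); apply: (@sum_integral_le R _ _ leb pos
    (fun k => `[s k, (2 * s k)%R[%classic)) => // [|k t|].
  - exact: measurable_pos.
  - by rewrite /= in_itv/= => /andP[h _]; exact: lt_le_trans h.
  - exact: measurable_funTS.
have rat k : s k.+1 <= 2 * s k /\ s k <= 2 * s k.+1.
  by have := s0 k; have := s0 k.+1; case: sD => sE; have := sE k; lra.
have hc4 : 0 <= @hoelder_const R n p al 4 by rewrite ltW// hc_gt0.
have hc24 : @hoelder_const R n p al 2 <= H.
  have l1 : 1 <= 2 `^ `|A| :> R by rewrite -[leLHS](powRr0 2) ler_powR// ler1n.
  have l2 : @hoelder_const R n p al 2 <= @hoelder_const R n p al 4.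
    rewrite /hoelder_const ler_pM2r ?invr_gt0// ler_pM2r ?powR_gt0 ?mulr_gt0//.
    by rewrite ler_pM2l// ge0_ler_powR ?nnegrE// ler_nat.
  apply: (le_trans l2); rewrite /H -mulrA ler_peMr ?(ltW (hc_gt0 _))//.
  have : 1 * 1 <= 2 `^ `|A| * 4 :> R by apply: ler_pM => //; rewrite ler1n.
  by rewrite mulr1.
have AB : B * q = 1 + c.
  by rewrite /B /c; field; rewrite pnatr_eq0 -lt0n n0 gt_eqF.
pose J k := (`]s k, (2 * s k)%R[%classic : set R).
have JI k : J k `<=` `[s k, (2 * s k)%R[%classic.
  by move=> t; rewrite /J/= !in_itv/= => /andP[/ltW -> ->].
have loc k s1 s2' : s k < s1 -> s1 < s2' -> s2' < 2 * s k -> ~ Z s1 -> ~ Z s2' ->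
    `|v s1 - v s2'| <= H * (s k `^ (- A) * (X * x k) `^ p^-1) * ((s2' - s1) / s k) `^ (1 - p^-1).
  move=> h1 h2 h3 Zs1 Zs2.
  have Xx : 0 < X * x k by rewrite mulr_gt0.
  apply: le_trans (hoelder_estimate n0 p1 mg key (s0 k) Xx (xE k) h1 h2 h3 (Z1E _ Zs1) (Z1E _ Zs2)) _.
  by rewrite ler_wpM2r ?powR_ge0// ler_wpM2r// mulr_ge0 ?powR_ge0.
have adj k s1 s2' : s k < s1 -> s1 < 2 * s k -> s k.+1 < s2' -> s2' < 2 * s k.+1 ->
    ~ Z s1 -> ~ Z s2' ->
    `|v s1 - v s2'| <= H * (s k `^ (- A) * (X * (x k + x k.+1)) `^ p^-1).
  move=> h1 h2 h3 h4 Zs1 Zs2.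
  have Xx : 0 < X * (x k + x k.+1) by rewrite mulr_gt0// addr_gt0.
  (* m will be the smaller of s k and s k.+1, so that both growth directions of s share one
     estimate. *)
  have window m t1 t2 : 0 < m -> m <= 2 * s k -> s k <= 2 * m ->
      (energy g p al m (4 * m) <= (X * (x k + x k.+1))%:E)%E ->
      m < t1 -> t1 < t2 -> t2 < 4 * m -> ~ Z t1 -> ~ Z t2 ->
      `|v t1 - v t2| <= H * (s k `^ (- A) * (X * (x k + x k.+1)) `^ p^-1).
    move=> m0 ms sm Em k1 k2 k3 Zt1 Zt2.
    apply: le_trans (hoelder_estimate n0 p1 mg key m0 Xx Em k1 k2 k3 (Z1E _ Zt1) (Z1E _ Zt2)) _.
    have r4 : ((t2 - t1) / m) `^ (1 - p^-1) <= 4.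
      have pv : 0 < p^-1 <= 1 by rewrite invr_gt0 p0 invf_le1.
      apply: (@le_trans _ _ (4 `^ (1 - p^-1))).
        rewrite ge0_ler_powR ?nnegrE ?divr_ge0 ?subr_ge0 ?(ltW m0) ?(ltW k2)//; first by case/andP: pv.
        by rewrite ler_pdivrMr//; lra.
      by apply: ler1_powR; [rewrite ler1n|lra].
    have mA : m `^ (- A) <= 2 `^ `|A| * s k `^ (- A).
      by rewrite -[`|A|]normrN; exact: powR_doubling.
    have XX : 0 <= (X * (x k + x k.+1)) `^ p^-1 by exact: powR_ge0.
    apply: (@le_trans _ _ (@hoelder_const R n p al 4 *
       (2 `^ `|A| * s k `^ (- A) * (X * (x k + x k.+1)) `^ p^-1) * 4)).
      apply: ler_pM => //; rewrite ?powR_ge0//.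
        by rewrite (mulr_ge0 hc4)// mulr_ge0 ?powR_ge0.
      by rewrite (ler_wpM2l hc4)// ler_wpM2r.
    by rewrite /H le_eqVlt; apply/orP; left; apply/eqP; ring.
  have xE' : (energy g p al (s k) (2 * s k) + energy g p al (s k.+1) (2 * s k.+1) <=
      (X * (x k + x k.+1))%:E)%E.
    by rewrite mulrDr EFinD; apply: leeD.
  have [r1 r2] := rat k.
  case: sD => sE.
  - have sk := sE k; have s0k := s0 k.
    apply: (window (s k) s1 s2' (s0 k) _ _ _ h1 _ _ Zs1 Zs2); [lra|lra| |lra|lra].
    have -> : 4 * s k = 2 * s k.+1 by rewrite sk; ring.
    rewrite (energy_add (r' := s k.+1))//; [|lra|lra].
    by rewrite -sk in xE'.
  - have sk := sE k; have s0k := s0 k.+1; rewrite distrC.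
    apply: (window (s k.+1) s2' s1 (s0 _) _ _ _ h3 _ _ Zs2 Zs1); [lra|lra| |lra|lra].
    have -> : 4 * s k.+1 = 2 * s k by rewrite sk; ring.
    rewrite (energy_add (r' := s k))//; [|lra|lra].
    by rewrite -sk addeC in xE'.
have vb k : a < 1 -> (\int[leb]_(t in `]s k, (2 * s k)%R[) (`|v t| `^ q)%:E <=
   (s k * (H' * (s k `^ (- (B * q)) * (Y * z k))))%:E)%E.
  move=> a1; have := zE k; rewrite /E a1 => zEk.
  have mJ : measurable (J k) by exact: measurable_itv.
  have cst0 : 0 <= H' * s k `^ (- c) by rewrite mulr_ge0 ?powR_ge0// ltW.
  apply: (@le_trans _ _ (\int[leb]_(t in J k) ((H' * s k `^ (- c))%:E *
      (ball_vol n * (t `^ c * `|v t| `^ q))%:E))%E).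
    apply: ge0_le_integral => //.
    - apply: measurable_funTS; apply/measurable_EFinP.
      by apply: (measurableT_comp (measurable_powR _)); exact: measurableT_comp.
    - by apply: measurable_funTS; apply: emeasurable_funM.
    - move=> t; rewrite /J/= in_itv/= => /andP[t1 t2].
      have t0 : 0 < t by exact: lt_trans t1.
      rewrite -EFinM lee_fin.
      have -> : H' * s k `^ (- c) * (ball_vol n * (t `^ c * `|v t| `^ q)) =
         (2 `^ `|c| * s k `^ (- c) * t `^ c) * `|v t| `^ q.
        by rewrite /H'; field; rewrite gt_eqF.
      apply: ler_peMl; first exact: powR_ge0.
      have : t `^ (- c) <= 2 `^ `|c| * s k `^ (- c).
        by rewrite -[`|c|]normrN; apply: powR_doubling => //; lra.
      move=> /(ler_wpM2r (powR_ge0 t c)); apply: le_trans.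
      by rewrite -powRD ?(gt_eqF t0) ?implybT// addNr powRr0.
  rewrite ge0_integralZl//; last exact: measurable_funTS.
  apply: (@le_trans _ _ ((H' * s k `^ (- c))%:E * (Y * z k)%:E)%E).
    apply: lee_wpmul2l => //; apply: le_trans zEk.
    by apply: ge0_subset_integral => //; exact: measurable_funTS.
  rewrite -EFinM lee_fin le_eqVlt; apply/orP; left; apply/eqP.
  have -> : s k `^ (- c) = s k * s k `^ (- (B * q)).
    rewrite -[X in _ = X * _]powRr1 ?(ltW (s0 k))// -powRD ?(gt_eqF (s0 k)) ?implybT//.
    by congr powR; rewrite AB; ring.
  by ring.
have v0 t : s 0 < t -> t < 2 * s 0 -> ~ Z t -> v t = 0.
  move=> t1 t2 Zt; apply: vout; [exact: lt_trans t1|exact: ZvE|].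
  by apply: (dyadic_head ds); rewrite (ltW t1).
have tJ : trivIset setT (fun k => J k.+1).
  move=> i j _ _ [t [ti tj]]; apply: succn_inj; apply: (tI i.+1 j.+1) => //.
  by exists t; split; apply: JI.
have main := @chain_estimate R p q tau a kap A B p1 q1 tau1 a01 cond scaling taukap e_gt
  H H' H0 H'0 v Z s x z X Y mv nZ X0 Y0 s0 x0 z0 x3 z3 _ loc adj vb v0 om mom om0 tJ omle.
have {}main := main _.
apply: le_trans (main _); last first.
  by move=> k; case: sD => sE; [left|right].
have mF : measurable_fun setT (fun t => (om t * `|v t| `^ tau)%:E).
  apply/measurable_EFinP; apply: measurable_funM => //.
  by apply: (measurableT_comp (measurable_powR _)); exact: measurableT_comp.
have F0 t : (0 <= (om t * `|v t| `^ tau)%:E)%E by rewrite lee_fin mulr_ge0 ?powR_ge0.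
have mU : measurable (\bigcup_k J k.+1).
  by apply: bigcupT_measurable => k; exact: measurable_itv.
rewrite integral_mkcond [leRHS]integral_mkcond.
have mpos := @measurable_pos R.
apply: ae_ge0_le_integral => //.
- by move=> t _; apply: erestrict_ge0.
- by apply: measurable_patch => //; exact: measurable_funTS.
- by move=> t _; apply: erestrict_ge0.
- by apply: measurable_patch => //; exact: measurable_funTS.
- have [N [mN N0 sN]] := nZ; exists N; split => //; apply: subset_trans sN.
  move=> t /= ht; apply: contrapT => Zt; apply: ht => _.
  rewrite !patchE; case: ifPn => // tp; case: ifPn => // tU.
  have -> : v t = 0; last first.
    by rewrite normr0 powR0 ?mulr0// gt_eqF// (lt_le_trans _ tau1).
  apply: vout; [by rewrite inE in tp|exact: ZvE|].
  move=> k /andP[t1 t2]; move/negP: tU; apply; rewrite inE; exists k => //.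
  rewrite /J/= in_itv/= t2 andbT lt_neqAle t1 andbT; apply/eqP => st.
  by apply: Zt; right; exists k.+1.
Qed.

End radial_chain.

(** * The weighted norms in terms of the profile *)

Section norms.
Context {R : realType} {n : nat}.
Hypothesis n0 : (0 < n)%N.
Notation leb := (@lebesgue_measure R).
Notation mu := (@lebesgue_rV R n).

Lemma enorm_powR (x : 'rV[R]_n) (r : R) : enorm x `^ r = enormX x `^ (r / n%:R).
Proof.
rewrite /enormX -powR_mulrn ?enorm_ge0// -powRrM; congr powR.
by rewrite mulrC divfK// pnatr_eq0 -lt0n.
Qed.

Lemma measurable_punctured_setT (u : 'rV[R]_n -> R) :
  measurable_fun punctured u -> measurable_fun setT u.
Proof.
move=> mu_; have -> : [set: 'rV[R]_n] = punctured `|` [set 0].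
  apply/seteqP; split => // x _; rewrite /punctured/=.
  by have [->|] := eqVneq x 0; [right|left].
have m0 : measurable [set (0 : 'rV[R]_n)].
  have -> : [set (0 : 'rV[R]_n)] = ~` punctured.
    apply/seteqP; split => x; rewrite /punctured/=; first by move=> ->; rewrite eqxx.
    by move/negP; rewrite negbK => /eqP.
  by apply: measurableC; exact: measurable_punctured.
apply/measurable_funU => //; first exact: measurable_punctured.
by split => //; exact: measurable_fun_set1.
Qed.

(** Gives a name to the gradient chosen inside the norm; without an admissible gradient the norm is
    infinite by definition. *)
Lemma weighted_gradient_normP (al p : R) (u : 'rV[R]_n -> R) : 0 < p ->
  weighted_gradient_norm al p u = +oo%E \/
  exists2 g, Lp_loc_gradient punctured p u g &
    (weighted_gradient_norm al p u `^ p =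
     \int[mu]_(x in punctured) ((enorm x `^ al * enorm (g x)) `^ p)%:E)%E.
Proof.
move=> p0; rewrite /weighted_gradient_norm; case: pselect => [ex|_]; last by left.
right; exists (projT1 (cid ex)); first exact: (projT2 (cid ex)).
rewrite poweR_Lnorm ?gt_eqF// [RHS]integral_mkcond.
apply: eq_integral => x _; rewrite !patchE; case: ifPn => _.
  by rewrite abse_EFin poweR_EFin ger0_norm// mulr_ge0 ?powR_ge0 ?enorm_ge0.
by rewrite abse0 poweR0r// gt_eqF.
Qed.

Lemma weighted_gradient_norm_ge0 (al p : R) (u : 'rV[R]_n -> R) :
  (0 <= weighted_gradient_norm al p u)%E.
Proof.
rewrite /weighted_gradient_norm; case: pselect => [ex|_]; last exact: leey.
exact: Lnorm_ge0.
Qed.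

Variables (u : 'rV[R]_n -> R) (v : R -> R).
Hypothesis mu_ : measurable_fun punctured u.
Hypothesis mv : measurable_fun setT v.
Hypothesis uv : {ae mu, forall x, u x = v (enormX x)}.

Lemma polar_profile (om : R -> R) (r : R) : measurable_fun setT om ->
  (forall t, 0 <= om t) ->
  (\int[mu]_x (om (enormX x) * `|u x| `^ r)%:E =
   (ball_vol n)%:E * \int[leb]_(t in pos) (om t * `|v t| `^ r)%:E)%E.
Proof.
move=> mom om0.
have mf : measurable_fun setT (fun t => (om t * `|v t| `^ r)%:E).
  apply/measurable_EFinP; apply: measurable_funM => //.
  by apply: (measurableT_comp (measurable_powR _)); exact: measurableT_comp.
have f0 t : (0 <= (om t * `|v t| `^ r)%:E)%E by rewrite lee_fin mulr_ge0 ?powR_ge0.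
rewrite -(polar_integral n0 mf f0); apply: ge0_ae_eq_integral => //.
- apply/measurable_EFinP; apply: measurable_funM.
    by apply: measurableT_comp => //; exact: measurable_enormX.
  apply: (measurableT_comp (measurable_powR _)); apply: measurableT_comp => //.
  exact: measurable_punctured_setT.
- by apply: (measurableT_comp mf); exact: measurable_enormX.
- by move=> x _; rewrite lee_fin mulr_ge0 ?powR_ge0.
- by apply: filterS uv => x -> _.
Qed.

Lemma weighted_norm_pow (be q : R) : 0 < q ->
  (weighted_norm be q u `^ q =
   \int[leb]_(t in pos) (ball_vol n * (t `^ (be * q / n%:R) * `|v t| `^ q))%:E)%E.
Proof.
move=> q0; rewrite /weighted_norm poweR_Lnorm ?gt_eqF//.
have -> : (\int[mu]_x (`|(enorm x `^ be * u x)%:E| `^ q) =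
    \int[mu]_x (enormX x `^ (be * q / n%:R) * `|u x| `^ q)%:E)%E.
  apply: eq_integral => x _.
  rewrite abse_EFin poweR_EFin normrM ger0_norm ?powR_ge0// powRM ?powR_ge0//.
  by rewrite -powRrM enorm_powR.
rewrite (@polar_profile (fun t => t `^ (be * q / n%:R)))//; last by move=> t; exact: powR_ge0.
rewrite -ge0_integralZl//.
- exact: measurable_pos.
- apply: measurable_funTS; apply/measurable_EFinP; apply: measurable_funM.
    exact: measurable_powR.
  by apply: (measurableT_comp (measurable_powR _)); exact: measurableT_comp.
- by move=> t _; rewrite lee_fin mulr_ge0 ?powR_ge0.
- by rewrite lee_fin ball_vol_ge0.
Qed.

Lemma weighted_norm_eq0 (be q : R) : 0 < q -> weighted_norm be q u = 0%E ->
  leb.-negligible [set t | 0 < t /\ v t != 0].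
Proof.
move=> q0 W0; have := weighted_norm_pow be q0; rewrite W0 poweR0r ?gt_eqF// => /esym I0.
set f := (fun t => _) in I0.
have mf : measurable_fun pos f.
  apply: measurable_funTS; apply/measurable_EFinP; apply: measurable_funM => //.
  apply: measurable_funM; first exact: measurable_powR.
  by apply: (measurableT_comp (measurable_powR _)); exact: measurableT_comp.
have : (\int[leb]_(t in pos) `|f t| = 0)%E.
  rewrite -[RHS]I0; apply: eq_integral => t _; rewrite gee0_abs//.
  by rewrite lee_fin !mulr_ge0 ?powR_ge0 ?ball_vol_ge0.
move=> /(ae_eq_integral_abs leb (@measurable_pos R) mf).1 [N [mN N0 sN]].
exists N; split => //; apply: subset_trans sN => t [t0 vt] /=.
move=> /(_ t0) /eqP; rewrite /f /cst eqe !mulf_eq0 gt_eqF ?ball_vol_gt0//=.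
by rewrite !powR_eq0 (gt_eqF t0) normr_eq0 (negbTE vt).
Qed.

Lemma profile_integral_eq0 (om : R -> R) (tau : R) : 0 < tau ->
  measurable_fun setT om -> (forall t, 0 <= om t) ->
  leb.-negligible [set t | 0 < t /\ v t != 0] ->
  (\int[leb]_(t in pos) (om t * `|v t| `^ tau)%:E = 0)%E.
Proof.
move=> tau0 mom om0 [N [mN N0 sN]].
have <- : (\int[leb]_(t in pos) 0 = 0)%E by exact: integral0.
apply: ge0_ae_eq_integral => //.
- exact: measurable_pos.
- apply: measurable_funTS; apply/measurable_EFinP; apply: measurable_funM => //.
  by apply: (measurableT_comp (measurable_powR _)); exact: measurableT_comp.
- by move=> t _; rewrite lee_fin mulr_ge0 ?powR_ge0.
- exists N; split => //; apply: subset_trans sN => t /= h.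
  have [t0|t0] := ltP 0 t; last by exfalso; apply: h; rewrite /pos/= ltNge t0.
  split => //; apply/eqP => vt; apply: h => _.
  by rewrite vt normr0 powR0 ?gt_eqF// mulr0.
Qed.

End norms.

Section log_estimate.
Context {R : realType} {n : nat}.
Hypothesis n0 : (0 < n)%N.
Notation leb := (@lebesgue_measure R).
Notation mu := (@lebesgue_rV R n).
Variables (p q tau a m al be gam : R).
Hypotheses (p1 : 1 <= p) (q1 : 1 <= q) (tau1 : 1 <= tau) (a01 : 0 < a <= 1).
Hypothesis cond : a * (p^-1 - 1) + (1 - a) * q^-1 <= tau^-1.
Hypothesis scaling :
  a * (p^-1 + (al - 1) / n%:R) + (1 - a) * (q^-1 + be / n%:R) = 0.
Hypothesis taum : tau <= m.
Hypothesis e_gt : tau^-1 < a / p + (1 - a) / q.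
Hypothesis gamtau : gam * tau = - n%:R.

(** The growth of ln |x| when |x|^n doubles. *)
Let c0 : R := ln 2 / n%:R.

(** The summand 1 makes the constant positive. *)
Definition log_const : R :=
  (ball_vol n * c0 `^ (- m) * @radial_const R n p q tau a m al be) `^ tau^-1 + 1.

Let c00 : 0 < c0. Proof. by rewrite divr_gt0 ?ltr0n// ln_gt0// ltr1n. Qed.

Let p0 : 0 < p. Proof. exact: lt_le_trans p1. Qed.
Let q0 : 0 < q. Proof. exact: lt_le_trans q1. Qed.
Let t0 : 0 < tau. Proof. exact: lt_le_trans tau1. Qed.

Variables (u : 'rV[R]_n -> R) (lu : Lp_loc punctured 1 u) (ru : radial u).

(** Common form of both inequalities, with [lr] the argument of the logarithm as a function of
    |x|^n. If either norm is 0, then v vanishes a.e. and so does the left-hand side. An infinite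
    factor makes the right-hand side infinite, since the other factor is then positive. *)
Lemma log_estimate (s : nat -> R) (lr : R -> R) (l : 'rV[R]_n -> R) :
  dyadic s -> measurable_fun setT lr -> (forall x, l x = lr (enormX x)) ->
  (forall k t, s k.+1 < t -> t < 2 * s k.+1 -> k.+1%:R * c0 <= ln (lr t)) ->
  (forall v, measurable_fun setT v -> {ae mu, forall x, u x = v (enormX x)} ->
    exists2 Zv, leb.-negligible Zv & forall t, 0 < t -> ~ Zv t ->
      (forall k, ~ (s k.+1 <= t < 2 * s k.+1)) -> v t = 0) ->
  (log_weighted_integral l gam tau m u `^ (tau^-1)%R <=
    log_const%:E * (weighted_gradient_norm al p u `^ a *
                    weighted_norm be q u `^ (1 - a)%R))%E.
Proof.
move=> ds mlr lE lnb hv.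
have [s0 sD] := ds.
have [v mv uv] := radial_profile n0 lu.1 ru.
have [Zv nZv vout] := hv v mv uv.
have [a0 a1] := andP a01.
(* t^-1 is |x|^(gam tau), because gam tau = -n; the factor c0^m turns the bound ln >= k.+1 c0 into
   the normalization that the chain expects. *)
pose om t := c0 `^ m * (t `^ (-1) * ln (lr t) `^ (- m)).
have om0 t : 0 <= om t by rewrite !mulr_ge0 ?powR_ge0.
have mom : measurable_fun setT om.
  apply: measurable_funM => //; apply: measurable_funM; first exact: measurable_powR.
  apply: (measurableT_comp (measurable_powR _)).
  by apply: (measurableT_comp (@measurable_ln R)).
have omle k t : s k.+1 < t -> t < 2 * s k.+1 -> om t <= (s k.+1)^-1 * k.+1%:R `^ (- m).
  move=> t1 t2; have tp : 0 < t by exact: lt_trans t1.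
  have kc : 0 < k.+1%:R * c0 by rewrite mulr_gt0.
  have L := lnb k t t1 t2.
  rewrite /om mulrCA powR_inv1 ?(ltW tp)//; apply: ler_pM; rewrite ?invr_ge0 ?(ltW tp) ?mulr_ge0 ?powR_ge0//.
    by rewrite lef_pV2 ?posrE// ltW.
  have -> : k.+1%:R `^ (- m) = c0 `^ m * (k.+1%:R * c0) `^ (- m).
    rewrite powRM ?(ltW c00)// mulrCA -powRD ?(gt_eqF c00) ?implybT//.
    by rewrite subrr powRr0 mulr1.
  rewrite ler_wpM2l ?powR_ge0// !powRN lef_pV2 ?posrE ?powR_gt0// ?(lt_le_trans kc L)//.
  rewrite ge0_ler_powR ?nnegrE ?(ltW kc)// ?(le_trans (ltW kc) L)//.
  exact: le_trans (ltW t0) taum.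
pose I := (\int[leb]_(t in pos) (om t * `|v t| `^ tau)%:E)%E.
have I0 : (0 <= I)%E by apply: integral_ge0 => t _; rewrite lee_fin mulr_ge0 ?powR_ge0.
have LE : log_weighted_integral l gam tau m u = ((ball_vol n * c0 `^ (- m))%:E * I)%E.
  rewrite EFinM muleAC -(polar_profile n0 lu.1 mv uv tau mom om0) -ge0_integralZr//; last 3 first.
  - apply/measurable_EFinP; apply: measurable_funM.
      by apply: measurableT_comp => //; exact: measurable_enormX.
    apply: (measurableT_comp (measurable_powR _)); apply: measurableT_comp => //.
    exact: measurable_punctured_setT lu.1.
  - by move=> x _; rewrite lee_fin mulr_ge0 ?powR_ge0.
  - by rewrite lee_fin powR_ge0.
  apply: eq_integral => x _; rewrite -EFinM; congr EFin.
  have [->|ux] := eqVneq; first by rewrite normr0 powR0 ?gt_eqF// mulr0 mul0r.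
  rewrite gamtau enorm_powR// mulNr divff ?pnatr_eq0 -?lt0n// lE -powRN /om.
  have cc : c0 `^ m * c0 `^ (- m) = 1.
    by rewrite -powRD ?(gt_eqF c00) ?implybT// subrr powRr0.
  transitivity ((c0 `^ m * c0 `^ (- m)) *
    (enormX x `^ (-1) * ln (lr (enormX x)) `^ (- m) * `|u x| `^ tau)); last by ring.
  by rewrite cc mul1r.
have Gr0 := weighted_gradient_norm_ge0 al p u.
have Bn0 : (0 <= weighted_norm be q u)%E by exact: Lnorm_ge0.
have rc0 : 0 <= log_const by rewrite addr_ge0 ?powR_ge0.
have RHS0 : (0 <= log_const%:E * (weighted_gradient_norm al p u `^ a *
    weighted_norm be q u `^ (1 - a)))%E.
  by rewrite mule_ge0 ?lee_fin// mule_ge0 ?poweR_ge0.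
have null : leb.-negligible [set t | 0 < t /\ v t != 0] ->
    (log_weighted_integral l gam tau m u `^ (tau^-1)%R <=
    log_const%:E * (weighted_gradient_norm al p u `^ a *
                    weighted_norm be q u `^ (1 - a)%R))%E.
  move=> nv; rewrite LE /I (profile_integral_eq0 mv t0 mom om0 nv) mule0.
  by rewrite poweR0r// gt_eqF// invr_gt0.
have lcp : 0 < log_const by rewrite ltr_wpDl ?powR_ge0.
have [B0|Bp] := eqVneq (weighted_norm be q u) 0%E.
  by apply: null; exact: (weighted_norm_eq0 n0 lu.1 mv uv q0 B0).
have {}Bp : (0 < weighted_norm be q u)%E by rewrite lt_def Bp.
have BPp : (0 < weighted_norm be q u `^ (1 - a))%E by exact: poweR_gt0.
have [->|[g [dg Lg] gE]] := weighted_gradient_normP al u p0.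
  rewrite poweRyr ?gt_eqF// gt0_mulye// gt0_muley ?lte_fin//; exact: leey.
have [G0|Gp] := eqVneq (weighted_gradient_norm al p u) 0%E.
  apply: null; apply: (zero_gradient (al := al) n0 p1 lu mv uv dg (s0 0) nZv) => [t t1 t2 Zt|].
    apply: vout => //; first exact: lt_trans t1.
    by apply: dyadic_head => //; rewrite (ltW t1).
  by rewrite -gE G0 poweR0r// gt_eqF.
have {}Gp : (0 < weighted_gradient_norm al p u)%E by rewrite lt_def Gp.
have [->|Gfin] := eqVneq (weighted_gradient_norm al p u) +oo%E.
  rewrite poweRyr ?gt_eqF// gt0_mulye// gt0_muley ?lte_fin//; exact: leey.
have GE : weighted_gradient_norm al p u = (fine (weighted_gradient_norm al p u))%:E.
  by rewrite fineK// ge0_fin_numE// lt_neqAle Gfin leey.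
move: GE gE Gp; set r := fine _ => -> gE Gp.
have {}Gp : 0 < r by rewrite lte_fin in Gp.
(* Y is left free: it will be the q-th power of the L^q norm for a < 1, and 1 for a = 1, when that
   norm may be infinite. *)
have fin (Y : R) : 0 < Y -> (a < 1 -> (weighted_norm be q u `^ q <= Y%:E)%E) ->
    (log_weighted_integral l gam tau m u `^ (tau^-1)%R <=
     (log_const * (r `^ a * Y `^ ((1 - a) / q)))%:E)%E.
  move=> Y0 hY.
  have X0 : 0 < r `^ p by rewrite powR_gt0.
  have EX : (\int[mu]_(x in punctured) ((enorm x `^ al * enorm (g x)) `^ p)%:E <= (r `^ p)%:E)%E.
    by rewrite -gE poweR_EFin.
  have EY : a < 1 -> (\int[leb]_(t in pos) (ball_vol n * (t `^ (be * q / n%:R) * `|v t| `^ q))%:E <= Y%:E)%E.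
    by move=> /hY; rewrite (weighted_norm_pow n0 lu.1 mv uv).
  have := radial_chain n0 p1 q1 tau1 a01 lu mv uv dg cond scaling taum e_gt ds X0 Y0 EX EY nZv vout mom om0 omle.
  rewrite -/I -powRrM.
  have -> : p * (a / p) = a by rewrite mulrC divfK// gt_eqF.
  set K := radial_const _ _ _ _ _ _ _; set W := r `^ a * _ => IW.
  have W0 : 0 <= W by rewrite mulr_ge0 ?powR_ge0.
  have bc0 : 0 <= ball_vol n * c0 `^ (- m) by rewrite mulr_ge0 ?powR_ge0 ?ball_vol_ge0.
  (* A negative K would force the integral to vanish, so the sign of the constant can be settled
     here. *)
  have [K0|K0] := ltP K 0.
    have : (I <= 0)%E by apply: (le_trans IW); rewrite lee_fin nmulr_rle0// powR_ge0.
    move=> I00; have -> : log_weighted_integral l gam tau m u = 0%E.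
      by rewrite LE; have -> : I = 0%E; [apply/eqP; rewrite eq_le I00|rewrite mule0].
    by rewrite poweR0r ?gt_eqF ?invr_gt0// lee_fin mulr_ge0.
  apply: (@le_trans _ _ ((ball_vol n * c0 `^ (- m) * (K * W `^ tau))%:E `^ (tau^-1)%R)%E).
    apply: gt0_ler_poweR; rewrite ?invr_ge0 ?(ltW t0)// ?in_itv/= ?leey ?andbT//.
    - by rewrite LE mule_ge0.
    - by rewrite lee_fin (mulr_ge0 bc0)// (mulr_ge0 K0)// powR_ge0.
    - by rewrite LE [leRHS]EFinM; apply: lee_wpmul2l.
  rewrite poweR_EFin lee_fin mulrA powRM ?(mulr_ge0 bc0 K0) ?powR_ge0// -powRrM mulfV ?gt_eqF// powRr1//.
  by rewrite ler_wpM2r// /log_const lerDl.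
have [an1|ae1] := ltP a 1; last first.
  have ea : a = 1 by apply/eqP; rewrite eq_le a1.
  have := fin 1 ltr01; rewrite ltNge ae1/= => /(_ (fun h => False_ind _ (notF h))).
  by rewrite ea subrr mul0r powRr0 mulr1 poweRe0 mule1 EFinM.
have [->|Bfin] := eqVneq (weighted_norm be q u) +oo%E.
  rewrite poweRyr ?gt_eqF ?subr_gt0// gt0_muley ?gt0_muley ?lte_fin ?powR_gt0//; exact: leey.
have BE : weighted_norm be q u = (fine (weighted_norm be q u))%:E.
  by rewrite fineK// ge0_fin_numE// lt_neqAle Bfin leey.
move: BE Bp fin; set b := fine _ => -> Bp fin.
have {}Bp : 0 < b by rewrite lte_fin in Bp.
have := fin (b `^ q) (powR_gt0 _ Bp) (fun=> lexx _).
rewrite -powRrM; have -> : q * ((1 - a) / q) = 1 - a by rewrite mulrC divfK// gt_eqF.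
by rewrite -!EFinM.
Qed.

End log_estimate.

(** * Dyadic covers and the two support conditions *)

Section dyadic_cover.
Context {R : realType}.

Lemma exists_dyadic_gt (x : R) : exists k : nat, x < 2 ^+ k.
Proof.
exists (Num.truncn x).+1; apply: lt_trans (truncnS_gt x) _.
by rewrite -natrX ltr_nat ltn_expl.
Qed.

Lemma dyadic_up (S : R) : 0 < S -> dyadic (fun k => S * 2 ^+ k).
Proof.
by move=> S0; split=> [k|]; [rewrite mulr_gt0// exprn_gt0|left => k; rewrite exprS mulrCA].
Qed.

Lemma dyadic_down (S : R) : 0 < S -> dyadic (fun k => S / 2 ^+ k).
Proof.
move=> S0; split=> [k|]; first by rewrite divr_gt0// exprn_gt0.
by right => k; rewrite exprS invfM [RHS]mulrCA (mulrA 2) divff ?mul1r// pnatr_eq0.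
Qed.

Lemma dyadic_up_cover (S t : R) : 0 < S -> 2 * S <= t ->
  exists k : nat, S * 2 ^+ k.+1 <= t < 2 * (S * 2 ^+ k.+1).
Proof.
move=> S0 St.
have ex : exists k, t < S * 2 ^+ k.+2.
  have [k hk] := exists_dyadic_gt (t / S); exists k.
  rewrite ltr_pdivrMr// mulrC in hk; apply: (lt_le_trans hk).
  by rewrite ler_pM2l// ler_weXn2l ?ler1n// (leqW (leqnSn k)).
have [k hk kmin] := ex_minnP ex; exists k.
rewrite mulrCA -exprS hk andbT.
case: k {hk} kmin => [|k] kmin; first by rewrite expr1 mulrC.
by rewrite leNgt; apply/negP => /kmin; rewrite ltnn.
Qed.

Lemma dyadic_down_cover (S t : R) : 0 < t -> t < S ->
  exists k : nat, S / 2 ^+ k.+1 <= t < 2 * (S / 2 ^+ k.+1).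
Proof.
move=> t0 tS; have S0 : 0 < S by exact: lt_trans tS.
have ex : exists k, S / 2 ^+ k.+1 <= t.
  have [k hk] := exists_dyadic_gt (S / t); exists k.
  rewrite ltr_pdivrMr// in hk; rewrite ler_pdivrMr ?exprn_gt0//.
  apply: (le_trans (ltW hk)); rewrite [leRHS]mulrC ler_pM2r//.
  by rewrite ler_weXn2l ?ler1n.
have [k hk kmin] := ex_minnP ex; exists k.
have [_ [h|/(_ k) <-]] := dyadic_down S0.
  by have := h 0; rewrite expr0 expr1 divr1; lra.
rewrite hk/=; case: k {hk} kmin => [|k] kmin; first by rewrite expr0 divr1.
by rewrite ltNge; apply/negP => /kmin; rewrite ltnn.
Qed.

End dyadic_cover.

Theorem theorem4p4 (R : realType) (d : nat)
    (p q tau a alpha beta gamma mu sigma : R) :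
  (2 <= d)%N -> 1 <= p -> 1 <= q -> 1 <= tau -> 0 < a <= 1 -> 1 < mu ->
  tau <= mu ->
  gamma = a * sigma + (1 - a) * beta ->
  tau^-1 + gamma / d%:R =
    a * (p^-1 + (alpha - 1) / d%:R) + (1 - a) * (q^-1 + beta / d%:R) ->
  - (d%:R - 1) <= alpha - sigma < 0 ->
  exists2 C : R, 0 < C &
    forall u : 'rV[R]_d -> R, Lp_loc punctured 1 u -> radial u ->
    forall R1 R2 : R, 0 < R1 < R2 ->
      (tau^-1 + gamma / d%:R = 0 -> ess_supp u `<=` eball R2 ->
        (log_weighted_integral (fun x => 2 * R2 / enorm x)%R gamma tau mu u
           `^ (tau^-1)%R
         <= C%:E * (weighted_gradient_norm alpha p u `^ a
                    * weighted_norm beta q u `^ (1 - a)%R))%E) /\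
      (tau^-1 + gamma / d%:R = 0 -> ess_supp u `&` eball R1 = set0 ->
        (log_weighted_integral (fun x => 2 * enorm x / R1)%R gamma tau mu u
           `^ (tau^-1)%R
         <= C%:E * (weighted_gradient_norm alpha p u `^ a
                    * weighted_norm beta q u `^ (1 - a)%R))%E).
Proof.
move=> d2 p1 q1 tau1 a01 mu1 taumu gE scE /andP[as1 as2].
have d0 : (0 < d)%N by exact: leq_trans d2.
have dp : 0 < d%:R :> R by rewrite ltr0n.
have [a0 _] := andP a01.
have t0 : 0 < tau by exact: lt_le_trans tau1.
have tauE : tau^-1 = a / p + (1 - a) / q + a * (alpha - sigma - 1) / d%:R.
  have -> : tau^-1 = (tau^-1 + gamma / d%:R) - gamma / d%:R by ring.
  by rewrite scE gE; ring.
(* The difference of the two sides is a (alpha - sigma - 1 + d) / d, nonnegative by the lower bound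
   on alpha - sigma. *)
have cond : a * (p^-1 - 1) + (1 - a) * q^-1 <= tau^-1.
  rewrite tauE -subr_ge0.
  have -> : a / p + (1 - a) / q + a * (alpha - sigma - 1) / d%:R -
      (a * (p^-1 - 1) + (1 - a) / q) = a * (alpha - sigma - 1 + d%:R) / d%:R.
    by rewrite !(mulrDr a, mulrDl) mulfK ?gt_eqF//; ring.
  by rewrite divr_ge0 ?(ltW dp)// mulr_ge0 ?(ltW a0)//; lra.
(* alpha - sigma < 0 makes the correction term in [tauE] negative. *)
have e_gt : tau^-1 < a / p + (1 - a) / q.
  rewrite tauE gtrDl pmulr_llt0 ?invr_gt0// pmulr_rlt0//; lra.
exists (@log_const R d p q tau a mu alpha beta).
  by rewrite ltr_wpDl ?powR_ge0.
move=> u lu ru R1 R2 /andP[R10 R12].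
have R20 : 0 < R2 by exact: lt_trans R12.
have ln2 : 0 < ln 2 :> R by rewrite ln_gt0// ltr1n.
(* The factor 2 inside the logarithms contributes ln 2, which covers the last of the k + 1
   increments ln 2 / d. *)
have nln2 : ln 2 / d%:R <= ln 2 :> R.
  by rewrite ler_pdivrMr// ler_peMr ?(ltW ln2)// ler1n.
have gamtau : tau^-1 + gamma / d%:R = 0 -> gamma * tau = - d%:R.
  move=> h; have : (tau^-1 + gamma / d%:R) * (tau * d%:R) = 0 by rewrite h mul0r.
  have -> : (tau^-1 + gamma / d%:R) * (tau * d%:R) = d%:R + gamma * tau.
    by field; rewrite (gt_eqF dp) gt_eqF.
  by lra.
have nrm (x : 'rV[R]_d) : enorm x = enormX x `^ d%:R^-1.
  by rewrite -[LHS]powRr1 ?enorm_ge0// (enorm_powR d0) mul1r.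
split => [h0 supp|h0 supp]; have scaling := h0; rewrite scE in scaling.
- have S0 : 0 < R2 ^+ d by exact: exprn_gt0.
  (* The interval of index 0 lies just outside the ball of radius R2, where v vanishes; the later
     ones descend to the origin. *)
  apply: (log_estimate d0 p1 q1 tau1 a01 cond scaling taumu e_gt (gamtau h0) lu ru
    (s := fun k => R2 ^+ d / 2 ^+ k) (lr := fun t => 2 * R2 * t `^ (- d%:R^-1))).
  + exact: dyadic_down.
  + by apply: measurable_funM => //; exact: measurable_powR.
  + by move=> x; rewrite powRN -nrm.
  + move=> k t t1 t2.
    have E0 : 0 < R2 ^+ d / 2 ^+ k.+1 by rewrite divr_gt0// exprn_gt0.
    have tp : 0 < t by exact: lt_trans t1.
    have tk : t < R2 ^+ d / 2 ^+ k.
      move: t2; have [_ [h|/(_ k) <-//]] := dyadic_down S0.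
      by have := h 0; rewrite expr0 expr1 divr1; lra.
    have lt : ln t <= ln R2 * d%:R - ln 2 * k%:R.
      rewrite !mulr_natr -!lnXn// -ln_div ?posrE ?exprn_gt0//.
      by rewrite ler_ln ?posrE ?divr_gt0 ?exprn_gt0// ltW.
    rewrite !lnM ?posrE ?mulr_gt0 ?powR_gt0// ln_powR.
    have : ln t / d%:R <= (ln R2 * d%:R - ln 2 * k%:R) / d%:R by rewrite ler_pM2r ?invr_gt0.
    have -> : (ln R2 * d%:R - ln 2 * k%:R) / d%:R = ln R2 - k%:R * (ln 2 / d%:R).
      by field; rewrite gt_eqF.
    rewrite -natr1 mulNr [_^-1 * _]mulrC; lra.
  + move=> v mv uv; exists [set s | R2 ^+ d <= s /\ v s != 0].
      exact: (profile_vanish_outside d0 mv uv R20 supp).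
    move=> t tp Zt hk; apply/eqP; apply: contraT => vt.
    have [tS|St] := ltP t (R2 ^+ d); last by case: Zt.
    by have [k] := dyadic_down_cover tp tS; move/hk.
- have S0 : 0 < R1 ^+ d / 2 by rewrite divr_gt0// exprn_gt0.
  (* Starting at R1^d / 2 puts the interval of index 0 inside the ball of radius R1, where v
     vanishes; the later ones ascend from R1^d. *)
  apply: (log_estimate d0 p1 q1 tau1 a01 cond scaling taumu e_gt (gamtau h0) lu ru
    (s := fun k => R1 ^+ d / 2 * 2 ^+ k) (lr := fun t => 2 * t `^ d%:R^-1 / R1)).
  + exact: dyadic_up.
  + by apply: measurable_funM => //; apply: measurable_funM => //; exact: measurable_powR.
  + by move=> x; rewrite -nrm.
  + move=> k t t1 t2.
    have E0 : 0 < R1 ^+ d / 2 * 2 ^+ k.+1 by rewrite mulr_gt0// exprn_gt0.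
    have tp : 0 < t by exact: lt_trans t1.
    have tk : R1 ^+ d * 2 ^+ k < t by move: t1; rewrite exprS mulrA divfK.
    have lt : ln R1 * d%:R + ln 2 * k%:R <= ln t.
      rewrite !mulr_natr -!lnXn// -lnM ?posrE ?exprn_gt0//.
      by rewrite ler_ln ?posrE ?mulr_gt0 ?exprn_gt0// ltW.
    rewrite ln_div ?posrE ?mulr_gt0 ?powR_gt0// lnM ?posrE ?powR_gt0// ln_powR.
    have : (ln R1 * d%:R + ln 2 * k%:R) / d%:R <= ln t / d%:R by rewrite ler_pM2r ?invr_gt0.
    have -> : (ln R1 * d%:R + ln 2 * k%:R) / d%:R = ln R1 + k%:R * (ln 2 / d%:R).
      by field; rewrite gt_eqF.
    rewrite -natr1 [_^-1 * _]mulrC; lra.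
  + move=> v mv uv; exists [set s | 0 < s < R1 ^+ d /\ v s != 0].
      exact: (profile_vanish_inside d0 mv uv R10 supp).
    move=> t tp Zt hk; apply/eqP; apply: contraT => vt.
    have [tS|St] := ltP t (R1 ^+ d); first by case: Zt; rewrite /= tp.
    have St' : 2 * (R1 ^+ d / 2) <= t by rewrite mulrC divfK.
    by have [k] := dyadic_up_cover S0 St'; move/hk.
Qed.
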